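(* Let $\mathbb{D}$ be the unit disc in $\mathbb{C}$. (1) If $U\subset\mathbb{D}$ is a horodisc, then the spectrum of $T_U$ (as an operator on $A^2(\mathbb{D})$) is the full interval $[0,1]$. (2) Let $0<\rho_1<\rho_2<1$ and let $U\subset\mathbb{D}$ be a horocyclic strip between two horocycles of Euclidean radii $\rho_1$ and $\rho_2$ tangent to the unit circle at the same point. Then the spectrum of $T_U$ is the interval $$\left[0,\ \alpha^{-\frac{1}{\alpha-1}}-\alpha^{-\frac{\alpha}{\alpha-1}}\right],\qquad\text{where}\qquad \alpha=\frac{\frac{1}{\rho_1}-1}{\frac{1}{\rho_2}-1}.$$
   Context: For an open set $W\subset\mathbb{C}$, $A^2(W)$ is the Bergman space: the Hilbert space of holomorphic functions on $W$ square integrable with respect to Lebesgue measure. For a non-empty open $U\subset\mathbb{D}$, $R_U:A^2(\mathbb{D})\to A^2(U)$ is the restriction operator $R_Uf=f|_U$ and $T_U=R_U^*R_U:A^2(\mathbb{D})\to A^2(\mathbb{D})$, where $R_U^*$ is the Hilbert space adjoint. Equivalently, $T_Uf=P(\chi_Uf)$ with $P:L^2(\mathbb{D})\to A^2(\mathbb{D})$ the Bergman (orthogonal) projection and $\chi_U$ the characteristic function of $U$. A horodisc in $\mathbb{D}$ is an open Euclidean disc contained in $\mathbb{D}$ (and different from $\mathbb{D}$) whose boundary is tangent to the unit circle, i.e. a set $\{z\in\mathbb{C}:|z-c|<1-|c|\}$ with $0<|c|<1$. Its boundary in $\mathbb{D}$, $\{z:|z-c|=1-|c|,\ |z|\ne1\}$,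 is called a horocycle, of Euclidean radius $1-|c|$. A horocyclic strip is the open set between two horocycles tangent to $\partial\mathbb{D}$ at the same point $p$: if their Euclidean radii are $\rho_1<\rho_2$, it is $\{z: |z-(1-\rho_2)p|<\rho_2,\ |z-(1-\rho_1)p|>\rho_1\}$. *)

(* Defs.v *)
From HB Require Import structures.
From mathcomp Require Import all_boot all_order all_algebra.
From mathcomp Require Import sesquilinear.
From mathcomp Require Import complex.
From mathcomp Require Import all_classical all_reals all_analysis.
From mathcomp Require Import measurable_realfun.
From mathcomp Require Import ring lra.
Set Implicit Arguments. Unset Strict Implicit. Unset Printing Implicit Defensive.
Import Order.TTheory GRing.Theory Num.Theory.
Import numFieldNormedType.Exports.
Local Open Scope classical_set_scope.
Local Open Scope ring_scope.

Section dot_norm.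
Context {K : numClosedFieldType} {V : lmodType K} (form : {dot V for Num.conj}).

Definition dot_norm (u : V) : K := sqrtC (form u u).

Lemma dot_cauchy_schwarz u v : `|form u v| <= dot_norm u * dot_norm v.
Proof.
have [->|v0] := eqVneq v 0.
  by rewrite /dot_norm !linear0r normr0 sqrtC0 mulr0.
have vv : 0 < form v v by rewrite dnorm_gt0.
rewrite /dot_norm -sqrtCM ?nnegrE ?dnorm_ge0//.
rewrite -(@ler_pXn2r _ 2)// ?nnegrE ?sqrtC_ge0 ?mulr_ge0 ?dnorm_ge0//.
rewrite sqrtCK; set a := form u u; set b := form v v; set c := form u v.
have bR : b^* = b.
  rewrite conj_Creal.
  by [].
 exact: gtr0_real.
have := dnorm_ge0 form (b *: u - c *: v).
rewrite dnormB !dnormZ/= linearZr_LR/= [form (b *: u) v]linearZl_LR/= -/a -/b -/c.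
have -> : c^* * (b * c) = b * `|c| ^+ 2 by rewrite normCKC mulrCA.
rewrite rmorphM rmorphXn/= bR conj_normC (gtr0_norm vv).
have -> : b ^+ 2 * a + `|c| ^+ 2 * b - (b * `|c| ^+ 2 + b * `|c| ^+ 2) =
  b * (a * b - `|c| ^+ 2) by ring.
by rewrite pmulr_rge0// subr_ge0.
Qed.

Lemma ler_dot_normD u v : dot_norm (u + v) <= dot_norm u + dot_norm v.
Proof.
rewrite -(@ler_pXn2r _ 2)// ?nnegrE ?addr_ge0 ?sqrtC_ge0 ?dnorm_ge0//.
rewrite sqrrD !sqrtCK dnormD/= addrAC lerD2r lerD2l.
have -> : form u v + (form u v)^* = 'Re (form u v) *+ 2.
  by rewrite ReE -mulr_natr divfK ?pnatr_eq0.
by rewrite lerMn2r (le_trans (leif_Re_Creal _).1)// dot_cauchy_schwarz.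
Qed.

Lemma dot_normZ a u : dot_norm (a *: u) = `|a| * dot_norm u.
Proof.
rewrite /dot_norm dnormZ sqrtCM ?nnegrE ?exprn_ge0 ?dnorm_ge0//.
by rewrite sqrCK.
Qed.

Lemma dot_norm0_eq0 u : dot_norm u = 0 -> u = 0.
Proof. by move=> /eqP; rewrite sqrtC_eq0 dnorm_eq0 => /eqP. Qed.

End dot_norm.

(* The Hilbert adjoint, picked by choice: at most one B satisfies the adjunction
   identity since dotU is definite, and for a bounded A on a complete space one
   exists by Riesz representation. The default value 0 is only there for
   totality. *)
Definition adjoint {K : numClosedFieldType} {U V : lmodType K}
    (dotU : {dot U for Num.conj}) (dotV : {dot V for Num.conj})
    (A : U -> V) : V -> U :=
  xget (fun=> 0) [set B : V -> U | forall u v, dotV (A u) v = dotU u (B v)].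

(* l is in the resolvent set iff T - l has a two-sided inverse among the
   continuous (i.e., bounded) linear operators. *)
Definition spectrum {K : numFieldType} {V : normedModType K} (T : V -> V) :
    set K :=
  [set l | ~ exists S : {linear V -> V},
    [/\ continuous S, cancel (fun f => T f - l *: f) S &
        cancel S (fun f => T f - l *: f)]].

Local Open Scope complex_scope.

(* The alias ^o gives R[i] its canonical structure of normed module over itself,
   so that "derivable f z 1" below is complex differentiability at z. *)
Notation Cplx R := ((R[i])^o).

Section plane.
Context {R : realType}.
Implicit Types (W : set (Cplx R)) (f g : Cplx R -> Cplx R) (p : R * R).

Definition plane p : Cplx R := p.1 +i* p.2.

Lemma open_measurable_plane (A : set (R * R)) : open A -> measurable A.
Proof.
move=> oA.
pose B (q : rat * rat * rat) : set (R * R) :=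
  ball (ratr q.1.1 : R) (ratr q.2) `*` ball (ratr q.1.2 : R) (ratr q.2).
suff -> : A = \bigcup_(q in [set: rat * rat * rat])
    (if `[< B q `<=` A >] then B q else set0).
  apply: countable_bigcupT_measurable => [|q]; first exact: countableP.
  case: ifPn => // _.
  by apply: measurableX; exact: open_measurable (ball_open _ _).
apply/seteqP; split=> [[x y] Axy|z [q _]]; last by case: asboolP => // BA /BA.
have /nbhs_ballP[e /= e0 exy] := open_nbhs_nbhs (conj oA Axy).
have [r /andP[r0 re]] : exists r : rat, (0 < r) && (ratr r < e / 2).
  have [|r] := @rat_in_itvoo R 0 (e / 2); first by rewrite divr_gt0.
  by rewrite in_itv/= => /andP[r0 ?]; exists r; rewrite -(ltr0q R) r0.
have rr0 : 0 < ratr r :> R by rewrite ltr0q.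
have app (t : R) : exists q : rat, ball (ratr q : R) (ratr r) t.
  have [|q] := @rat_in_itvoo R (t - ratr r) (t + ratr r).
    by rewrite ltrBlDr -addrA ltrDl addr_gt0.
  by rewrite in_itv/= => /andP[? ?]; exists q; rewrite /ball/= ltr_norml; apply/andP; split; lra.
have [[q1 h1] [q2 h2]] := (app x, app y).
exists (q1, q2, r) => //; case: asboolP => [_|[]]; first by split.
move=> [u v] [/= h3 h4]; apply: exy.
have D (a b c : R) : ball c (ratr r) a -> ball c (ratr r) b -> ball a e b.
  rewrite /ball/= => H1 H2; have := ler_normD (a - c) (c - b).
  rewrite (distrC a c) subrKA; lra.
by split=> /=; [exact: D h1 h3|exact: D h2 h4].
Qed.

Lemma plane_continuous : continuous plane.
Proof.
move=> [x y]; apply/cvgrPdist_lt => /= e e0.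
have /complex_realP[e' ee'] : e \is Num.real by rewrite gtr0_real.
have e'0 : 0 < e' by move: e0; rewrite ee' ltcR.
near=> p; rewrite ee' normc_def ltcR.
have /= h1 : `|x - p.1| < e' / 2.
  by near: p; exists (ball x (e'/2), setT) => /=; [split; [apply: nbhsx_ballx; rewrite divr_gt0|exact: filterT]|move=> q []].
have /= h2 : `|y - p.2| < e' / 2.
  by near: p; exists (setT, ball y (e'/2)) => /=; [split; [exact: filterT|apply: nbhsx_ballx; rewrite divr_gt0]|move=> q []].
rewrite -(ger0_norm (ltW e'0)) -sqrtr_sqr ltr_sqrt ?exprn_gt0//=.
have sq t : `|t| < e' / 2 -> t ^+ 2 < (e' / 2) ^+ 2.
  move=> ht; rewrite -real_normK ?num_real// ltr_pXn2r// nnegrE//.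
  by rewrite divr_ge0// ltW.
have := sq _ h1; have := sq _ h2; have : 0 < e' ^+ 2 by rewrite exprn_gt0.
lra.
Unshelve. all: by end_near. Qed.

Lemma RecB (z w : R[i]) : complex.Re (z - w) = complex.Re z - complex.Re w.
Proof. by case: z w => [? ?] [? ?]. Qed.

Lemma ImcB (z w : R[i]) : complex.Im (z - w) = complex.Im z - complex.Im w.
Proof. by case: z w => [? ?] [? ?]. Qed.

Lemma normc_ge_Im (z : R[i]) : `|complex.Im z|%:C <= `|z|.
Proof.
by rewrite normc_def lecR -sqrtr_sqr ler_sqrt ?addr_ge0 ?sqr_ge0// lerDr sqr_ge0.
Qed.

Lemma Re_continuous : continuous (@complex.Re R : Cplx R -> R).
Proof.
move=> z; apply/(@cvgrPdist_lt _ _ _ (nbhs z)) => e e0; near=> w.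
rewrite -RecB -ltcR (le_lt_trans (normc_ge_Re (z - w)))//.
by near: w; exists e%:C; rewrite //= ltcR.
Unshelve. all: by end_near. Qed.

Lemma Im_continuous : continuous (@complex.Im R : Cplx R -> R).
Proof.
move=> z; apply/(@cvgrPdist_lt _ _ _ (nbhs z)) => e e0; near=> w.
rewrite -ImcB -ltcR (le_lt_trans (normc_ge_Im (z - w)))//.
by near: w; exists e%:C; rewrite //= ltcR.
Unshelve. all: by end_near. Qed.

Lemma open_continuous_measurable_plane (D : set (R * R)) (g : R * R -> R) :
  open D -> {in D, continuous g} -> measurable_fun D g.
Proof.
move=> oD cg; apply: (measurability _ (RGenOpens.measurableE R)).
move=> _ [_ [a [b ->] <-]]; apply: open_measurable_plane.
rewrite openE => z [Dz gz]; apply: filterI; first exact: open_nbhs_nbhs.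
by apply: (cg z (mem_set Dz)); apply: open_nbhs_nbhs; split => //; exact: interval_open.
Qed.

Lemma open_plane W : open W -> open (plane @^-1` W).
Proof. by apply: open_comp => // ? _; exact: plane_continuous. Qed.

Definition holomorphic W f := forall z, W z -> derivable f z 1.

Lemma holomorphic_continuous W f z : holomorphic W f -> W z -> {for z, continuous f}.
Proof. by move=> hf /hf /derivable1_diffP; exact: differentiable_continuous. Qed.

Lemma holomorphic_measurable_Re W f : open W -> holomorphic W f ->
  measurable_fun (plane @^-1` W) (fun p => complex.Re (f (plane p))).
Proof.
move=> oW hf; apply: open_continuous_measurable_plane; first exact: open_plane.
move=> p /set_mem Wp.
apply: (@continuous_comp _ _ _ (f \o plane)); last exact: Re_continuous.
apply: continuous_comp; first exact: plane_continuous.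
exact: holomorphic_continuous Wp.
Qed.

Lemma holomorphic_measurable_Im W f : open W -> holomorphic W f ->
  measurable_fun (plane @^-1` W) (fun p => complex.Im (f (plane p))).
Proof.
move=> oW hf; apply: open_continuous_measurable_plane; first exact: open_plane.
move=> p /set_mem Wp.
apply: (@continuous_comp _ _ _ (f \o plane)); last exact: Im_continuous.
apply: continuous_comp; first exact: plane_continuous.
exact: holomorphic_continuous Wp.
Qed.

End plane.

Section cintegral.
Context {R : realType}.
Local Notation area := (@lebesgue_measure R \x @lebesgue_measure R)%E.

(* Lebesgue integrals over W are taken on R * R with respect to the product
   measure, through the identification plane : R * R -> R[i]. *)
Definition square_integrable (W : set (Cplx R)) (f : Cplx R -> Cplx R) : Prop :=
  area.-integrable (plane @^-1` W)
    (fun p => (Normc.normc (f (plane p)) ^+ 2)%:E).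

Definition Cintegral (W : set (Cplx R)) (h : Cplx R -> Cplx R) : R[i] :=
  (\int[area]_(p in plane @^-1` W) complex.Re (h (plane p)))%R +i*
  (\int[area]_(p in plane @^-1` W) complex.Im (h (plane p)))%R.

Definition Cintegrable (W : set (Cplx R)) (h : Cplx R -> Cplx R) :=
  area.-integrable (plane @^-1` W) (fun p => (complex.Re (h (plane p)))%:E) /\
  area.-integrable (plane @^-1` W) (fun p => (complex.Im (h (plane p)))%:E).

Lemma sqr_normcE (z : R[i]) :
  Normc.normc z ^+ 2 = complex.Re z ^+ 2 + complex.Im z ^+ 2.
Proof. by case: z => x y; rewrite /= sqr_sqrtr// addr_ge0 ?sqr_ge0. Qed.

Lemma measurable_plane (W : set (Cplx R)) : open W -> measurable (plane @^-1` W).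
Proof. by move=> /open_plane; exact: open_measurable_plane. Qed.

Lemma holomorphic_measurable_normc (W : set (Cplx R)) f :
  open W -> holomorphic W f ->
  measurable_fun (plane @^-1` W) (fun p => Normc.normc (f (plane p)) ^+ 2).
Proof.
move=> oW hf; under eq_fun do rewrite sqr_normcE.
apply: measurable_funD; apply: measurable_funX.
  exact: holomorphic_measurable_Re.
exact: holomorphic_measurable_Im.
Qed.

Lemma normcDM (a z w : R[i]) : Normc.normc (a * z + w) ^+ 2 <=
  2 * Normc.normc a ^+ 2 * Normc.normc z ^+ 2 + 2 * Normc.normc w ^+ 2.
Proof.
rewrite !sqr_normcE; case: a z w => [a1 a2] [x y] [u v] /=.
have := sqr_ge0 (a1 * x - a2 * y - u); have := sqr_ge0 (a1 * y + a2 * x - v).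
lra.
Qed.

Lemma square_integrable_lin (W : set (Cplx R)) (a : R[i]) f g : open W ->
  holomorphic W f -> holomorphic W g ->
  square_integrable W f -> square_integrable W g ->
  square_integrable W (a *: f + g).
Proof.
move=> oW hf hg sf sg; have mW := measurable_plane oW.
have hfg : holomorphic W (a *: f + g).
  by move=> z Wz; apply: derivableD; [apply: derivableZ; exact: hf|exact: hg].
pose N := Normc.normc a ^+ 2; rewrite /square_integrable.
apply: (@le_integrable _ _ _ area _ mW _
  ((fun p => (2 * N)%:E * (Normc.normc (f (plane p)) ^+ 2)%:E) \+
   (fun p => 2%:E * (Normc.normc (g (plane p)) ^+ 2)%:E))%E).
- by apply/measurable_EFinP; exact: holomorphic_measurable_normc.
- move=> p _; rewrite /= lee_fin.
  rewrite ger0_norm ?sqr_ge0//; apply: le_trans (ler_norm _).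
  exact: normcDM.
- by apply: integrableD => //; apply: integrableZl.
Qed.

Lemma Cintegrable_mul (W : set (Cplx R)) f g : open W ->
  holomorphic W f -> holomorphic W g ->
  square_integrable W f -> square_integrable W g ->
  Cintegrable W (fun z => f z * (g z)^*).
Proof.
move=> oW hf hg sf sg; have mW := measurable_plane oW.
have mRf := holomorphic_measurable_Re oW hf.
have mIf := holomorphic_measurable_Im oW hf.
have mRg := holomorphic_measurable_Re oW hg.
have mIg := holomorphic_measurable_Im oW hg.
have ReE z w : complex.Re (z * w^*) =
    complex.Re z * complex.Re w + complex.Im z * complex.Im w :> R.
  by case: z w => [x y] [u v] /=; rewrite mulrN opprK.
have ImE z w : complex.Im (z * w^*) =
    complex.Im z * complex.Re w - complex.Re z * complex.Im w :> R.
  by case: z w => [x y] [u v] /=; ring.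
split; apply: (@le_integrable _ _ _ area _ mW _
  ((fun p => (Normc.normc (f (plane p)) ^+ 2)%:E) \+
   (fun p => (Normc.normc (g (plane p)) ^+ 2)%:E))%E).
- apply/measurable_EFinP; under eq_fun do rewrite ReE.
  by apply: measurable_funD; exact: measurable_funM.
- move=> p _; rewrite /= !sqr_normcE lee_fin ReE.
  move: (f (plane p)) (g (plane p)) => [x y] [u v] /=.
  rewrite [leRHS]ger0_norm ?addr_ge0 ?sqr_ge0// ler_norml.
  have := sqr_ge0 (x + u); have := sqr_ge0 (x - u).
  have := sqr_ge0 (y + v); have := sqr_ge0 (y - v).
  by move=> *; apply/andP; split; nra.
- exact: integrableD.
- apply/measurable_EFinP; under eq_fun do rewrite ImE.
  by apply: measurable_funB; exact: measurable_funM.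
- move=> p _; rewrite /= !sqr_normcE lee_fin ImE.
  move: (f (plane p)) (g (plane p)) => [x y] [u v] /=.
  rewrite [leRHS]ger0_norm ?addr_ge0 ?sqr_ge0// ler_norml.
  have := sqr_ge0 (x + v); have := sqr_ge0 (x - v).
  have := sqr_ge0 (y + u); have := sqr_ge0 (y - u).
  by move=> *; apply/andP; split; nra.
- exact: integrableD.
Qed.

Lemma Cintegral_lin (W : set (Cplx R)) (a : R[i]) f g : open W ->
  Cintegrable W f -> Cintegrable W g ->
  Cintegral W (fun z => a * f z + g z) = a * Cintegral W f + Cintegral W g.
Proof.
move=> oW [rf imf] [rg img]; have mW := measurable_plane oW.
have I (x y : R) (u v w : R * R -> R) :
    area.-integrable (plane @^-1` W) (EFin \o u) ->
    area.-integrable (plane @^-1` W) (EFin \o v) ->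
    area.-integrable (plane @^-1` W) (EFin \o w) ->
  (\int[area]_(p in plane @^-1` W) (x * u p + y * v p + w p) =
   x * \int[area]_(p in plane @^-1` W) u p +
   y * \int[area]_(p in plane @^-1` W) v p +
   \int[area]_(p in plane @^-1` W) w p)%R.
  move=> iu iv iw.
  have ixu : area.-integrable (plane @^-1` W) (EFin \o (fun p => x * u p)).
    exact: (@integrableZl _ _ _ area _ mW x _ iu).
  have iyv : area.-integrable (plane @^-1` W) (EFin \o (fun p => y * v p)).
    exact: (@integrableZl _ _ _ area _ mW y _ iv).
  rewrite RintegralD//; last exact: (@integrableD _ _ _ area _ mW _ _ ixu iyv).
  by rewrite RintegralD// !RintegralZl.
rewrite /Cintegral; case: a => x y.
apply/eqP; rewrite eq_complex; apply/andP; split; apply/eqP => /=.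
  rewrite -mulNr -I//; apply: eq_Rintegral => p _.
  by case: (f _) (g _) => [? ?] [? ?] /=; rewrite mulNr.
rewrite -I//; apply: eq_Rintegral => p _.
by case: (f _) (g _) => [? ?] [? ?].
Qed.

Lemma Cintegral_conj (W : set (Cplx R)) f :
  Cintegrable W f -> open W ->
  Cintegral W (fun z => (f z)^*) = (Cintegral W f)^*.
Proof.
move=> [_ imf] oW; have mW := measurable_plane oW.
apply/eqP; rewrite eq_complex; apply/andP; split; apply/eqP => /=.
  by apply: eq_Rintegral => p _; case: (f _).
rewrite -mulN1r -RintegralZl//; apply: eq_Rintegral => p _.
by case: (f _) => ? ?; rewrite mulN1r.
Qed.

Lemma Cintegral_sqr (W : set (Cplx R)) f :
  Cintegral W (fun z => f z * (f z)^*) =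
  (\int[area]_(p in plane @^-1` W) (Normc.normc (f (plane p)) ^+ 2))%R%:C.
Proof.
apply/eqP; rewrite eq_complex; apply/andP; split; apply/eqP => /=.
  apply: eq_Rintegral => p _; rewrite sqr_normcE.
  by case: (f _) => ? ? /=; rewrite mulrN opprK.
rewrite (@eq_Rintegral _ _ _ _ _ (fun=> 0)) ?/Rintegral ?integral0// => p _.
by case: (f _) => ? ? /=; ring.
Qed.

Lemma square_integral_eq0 (W : set (Cplx R)) f : open W ->
  holomorphic W f -> square_integrable W f ->
  (\int[area]_(p in plane @^-1` W) (Normc.normc (f (plane p)) ^+ 2))%R = 0 ->
  forall z, W z -> f z = 0.
Proof.
move=> oW hf sf I0 z Wz; apply/eqP/negPn/negP => fz0.
have mW := measurable_plane oW.
have := I0; rewrite /Rintegral => /eqP; rewrite fine_eq0; last first.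
  exact: integrable_fin_num.
move=> /eqP {}I0.
have mh : measurable_fun (plane @^-1` W)
    (fun p => (Normc.normc (f (plane p)) ^+ 2)%:E).
  by apply/measurable_EFinP; exact: holomorphic_measurable_normc.
have [N [mN N0 sN]] : ae_eq area (plane @^-1` W)
    (fun p => (Normc.normc (f (plane p)) ^+ 2)%:E) (cst 0%E).
  apply/(ae_eq_integral_abs area mW mh); rewrite -[RHS]I0.
  by apply: eq_integral => p _; rewrite /= ger0_norm// sqr_ge0.
have : nbhs (complex.Re z, complex.Im z) (plane @^-1` [set w | W w /\ f w != 0]).
  apply: plane_continuous; rewrite /plane/=; case: z Wz fz0 => x y Wz fz0.
  near=> w; split.
    by near: w; exact: open_nbhs_nbhs.
  near: w; apply: (@cvgr_neq0 _ _ _ (nbhs (x +i* y : Cplx R)) _ f); last exact: fz0.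
  exact: holomorphic_continuous Wz.
move=> /nbhs_ballP[e /= e0 eW].
have : (area (ball (complex.Re z) e `*` ball (complex.Im z) e) <= 0)%E.
  rewrite -N0; apply: le_measure; rewrite ?inE//.
    by apply: measurableX; exact: open_measurable (ball_open _ _).
  move=> [u v] [hu hv]; apply: sN => /=.
  have [Wuv /eqP fuv] := eW (u, v) (conj hu hv).
  move=> /(_ Wuv) [] /eqP; rewrite sqrf_eq0 => /eqP /Normc.eq0_normc.
  exact: fuv.
rewrite product_measure1E; [|exact: open_measurable (ball_open _ _)..].
have lb (x : R) : lebesgue_measure (ball x e) = (e *+ 2)%:E.
  exact: lebesgue_measure_ball (ltW e0).
move: (lb (complex.Re z)) (lb (complex.Im z)) => /= -> ->.
by rewrite -EFinM lee_fin leNgt mulr_gt0 ?mulrn_wgt0.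
Unshelve. all: by end_near. Qed.
End cintegral.

(* A function on W is represented by its extension by 0 to the whole plane, so
   that equality in the space is equality of functions on W. The proof oW is a
   parameter because the stability under addition (hence the canonical
   structures below) requires W to be open. *)
Definition bergman_pred {R : realType} {W : set (Cplx R)} (oW : open W) :
    {pred Cplx R -> Cplx R} :=
  mem [set f | [/\ holomorphic W f, square_integrable W f &
                   forall z, ~ W z -> f z = 0]].

Section bergman.
Context {R : realType} {W : set (Cplx R)} (oW : open W).
Local Notation bergman := (bergman_pred oW).

Lemma bergman_submod_closed : submod_closed bergman.
Proof.
split=> [|a f g]; rewrite !inE.
  split=> //.
  rewrite /square_integrable (_ : (fun=> _) = cst 0%E).
    by apply: integrable0; exact: measurable_plane.
  apply/funext => p.
  by rewrite (_ : (0 : Cplx R -> Cplx R) (plane p) = 0)// Normc.normc0 expr0n.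
move=> [hf sf f0] [hg sg g0]; split.
- by move=> z Wz; apply: derivableD; [apply: derivableZ; exact: hf|exact: hg].
- exact: square_integrable_lin.
- move=> z Wz; change (a * f z + g z = 0).
  by rewrite f0// g0// mulr0 addr0.
Qed.

HB.instance Definition _ :=
  GRing.isSubmodClosed.Build R[i] (Cplx R -> Cplx R) bergman bergman_submod_closed.

Record bergmanType := Bergman {
  bergman_fun :> Cplx R -> Cplx R; bergman_subproof : bergman_fun \in bergman }.

HB.instance Definition _ := [isSub of bergmanType for bergman_fun].
HB.instance Definition _ := [Choice of bergmanType by <:].
HB.instance Definition _ := [SubChoice_isSubLmodule of bergmanType by <:].

(* The inner product int_W f conj(g) dA. *)
Definition bergman_dot (f g : bergmanType) : R[i] :=
  Cintegral W (fun z => f z * (g z)^*).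

Lemma bergman_holomorphic (f : bergmanType) : holomorphic W f.
Proof. by have := bergman_subproof f; rewrite inE => -[]. Qed.

Lemma bergman_square_integrable (f : bergmanType) : square_integrable W f.
Proof. by have := bergman_subproof f; rewrite inE => -[]. Qed.

Lemma bergman_out (f : bergmanType) z : ~ W z -> f z = 0.
Proof. by have := bergman_subproof f; rewrite inE => -[_ _]; apply. Qed.

Let Cintegrable_dot (f g : bergmanType) :
  Cintegrable W (fun z => f z * (g z)^*).
Proof.
apply: Cintegrable_mul => //.
- exact: bergman_holomorphic.
- exact: bergman_holomorphic.
- exact: bergman_square_integrable.
- exact: bergman_square_integrable.
Qed.

Lemma bergman_dotC f g : bergman_dot f g = (bergman_dot g f)^*.
Proof.
rewrite /bergman_dot -Cintegral_conj//; congr Cintegral.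
by apply/funext => z; rewrite rmorphM /= conjcK mulrC.
Qed.

Lemma bergman_dot_linear g (a : R[i]) f h :
  bergman_dot (a *: f + h) g = a * bergman_dot f g + bergman_dot h g.
Proof.
rewrite /bergman_dot -Cintegral_lin//; congr Cintegral.
by apply/funext => z; rewrite mulrA -mulrDl.
Qed.

Lemma bergman_dot_bilinear :
  bilinear_for *%R (Num.conj \; *%R) bergman_dot.
Proof.
split=> [g a f h|f a g h] /=; first exact: bergman_dot_linear.
rewrite [LHS]bergman_dotC bergman_dot_linear (bergman_dotC f g).
by rewrite (bergman_dotC f h) rmorphD rmorphM.
Qed.

HB.instance Definition _ := bilinear_isBilinear.Build R[i] bergmanType bergmanType
  R[i] *%R (Num.conj \; *%R) bergman_dot bergman_dot_bilinear.

Lemma bergman_dot_hermitian f g :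
  bergman_dot f g = (-1) ^+ false * Num.conj (bergman_dot g f).
Proof. by rewrite expr0 mul1r bergman_dotC. Qed.

HB.instance Definition _ := isHermitianSesquilinear.Build R[i] bergmanType false
  Num.conj bergman_dot bergman_dot_hermitian.

Lemma bergman_dot_gt0 f : f != 0 -> 0 < bergman_dot f f.
Proof.
move=> f0; rewrite /bergman_dot Cintegral_sqr (ltcR 0) lt_neqAle.
rewrite Rintegral_ge0 ?andbT; last by move=> *; exact: sqr_ge0.
apply: contra_neq f0 => /esym I0; apply/val_inj/funext => z.
have [Wz|Wz] := pselect (W z); last exact: bergman_out.
apply: (square_integral_eq0 oW _ _ I0 Wz).
  exact: bergman_holomorphic.
exact: bergman_square_integrable.
Qed.

HB.instance Definition _ :=
  isDotProduct.Build R[i] bergmanType bergman_dot bergman_dot_gt0.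

End bergman.

(* The norm is the square root of bergman_dot f f. *)
HB.instance Definition _ (R : realType) (W : set (Cplx R)) (oW : open W) :=
  Lmodule_isNormed.Build R[i] (bergmanType oW)
    (ler_dot_normD (@bergman_dot R W oW)) (dot_normZ (@bergman_dot R W oW))
    (@dot_norm0_eq0 _ _ (@bergman_dot R W oW)).

Section restriction.
Context {R : realType} {W V : set (Cplx R)} (oW : open W) (oV : open V).
Context (VW : V `<=` W).

Fact restrict_bergman (f : bergmanType oW) :
  ((f : Cplx R -> Cplx R) \_ V) \in bergman_pred oV.
Proof.
have := bergman_subproof f; rewrite !inE => -[hf sf _]; split.
- move=> z Vz; apply: near_eq_derivable (hf z (VW Vz)).
  near=> w; rewrite patchE mem_set//.
  by near: w; exact: open_nbhs_nbhs.
- have : square_integrable V f.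
    apply: integrableS sf; [exact: measurable_plane..|].
    by move=> p /VW.
  apply: eq_integrable; first exact: measurable_plane.
  by move=> p /set_mem Vp; rewrite patchE mem_set.
- by move=> z Vz; rewrite patchE memNset.
Unshelve. all: by end_near. Qed.

Definition restriction (f : bergmanType oW) : bergmanType oV :=
  Bergman (restrict_bergman f).

(* The operator T_V = R_V^* R_V. *)
Definition restriction_gram : bergmanType oW -> bergmanType oW :=
  adjoint (@bergman_dot R W oW) (@bergman_dot R V oV) restriction \o restriction.
End restriction.
Arguments restriction_gram {R W V} oW oV VW f.

Section disc.
Context {R : realType}.
Implicit Types (U : set (Cplx R)).

Definition disc : set (Cplx R) := [set z | `|z| < 1].

Lemma disc_open : open disc.
Proof.
suff -> : disc = ball (0 : Cplx R) 1 by exact: ball_open.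
by apply/seteqP; split=> z; rewrite /disc /ball/= sub0r normrN.
Qed.

(* The order of R[i] restricts to the usual one on real numbers; z < w
   entails that z and w have the same imaginary part. *)
Definition is_horodisc U := exists c : Cplx R,
  0 < `|c| < 1 /\ U = [set z | `|z - c| < 1 - `|c|].

Definition is_horostrip (r1 r2 : R) U := exists p : Cplx R, `|p| = 1 /\
  U = [set z | `|z - (1 - r2%:C) * p| < r2%:C /\
               r1%:C < `|z - (1 - r1%:C) * p|].

End disc.

(* Main.v *)
(* Let U be the horodisc at p of radius 1/(1+s). In the coordinate
   zeta = 1/(1 - conj(p) z), which maps the disc to a half-plane, U is the image
   of the disc under the translation zeta -> zeta + s, so the reproducing formula
   on U turns T_U f(z) = A^-1 int_U f conj(k_z) into
   C_s f(z) = (1 + s v)^-2 f(psi_s z), where v = 1/zeta and psi_s is that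
   translation. These self-adjoint operators form a semigroup, and a horocyclic
   strip yields the difference C_s2 - C_s1 with s2 < s1.

   Upper bound: phi(s) = <C_s f, f> satisfies phi(s+t)^2 <= phi(2s) phi(2t) by the
   semigroup law and Cauchy-Schwarz, so it is log-convex and bounded, which bounds
   phi(s2) - phi(s1) by M phi(0), M being the maximum over tau >= 0 of
   exp(-tau s2) - exp(-tau s1). A self-adjoint operator with numerical range in
   [0, M] has its spectrum there by a Lax-Milgram argument.

   Lower bound: v^-2 exp(-tau/v) is a formal eigenvector of C_s with eigenvalue
   exp(-tau s), not square integrable; (1 + b v)^-2 exp(-tau/v) is in the Bergman
   space and is an approximate eigenvector as b tends to infinity. *)
Require Import Defs.
From HB Require Import structures.
From mathcomp Require Import all_boot all_order all_algebra.
From mathcomp Require Import sesquilinear complex.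
From mathcomp Require Import all_classical all_reals all_analysis.
From mathcomp Require Import measurable_realfun.
From mathcomp Require Import ring lra.
Set Implicit Arguments. Unset Strict Implicit. Unset Printing Implicit Defensive.
Import Order.TTheory GRing.Theory Num.Theory.
Import numFieldNormedType.Exports.
Local Open Scope classical_set_scope.
Local Open Scope ring_scope.
Local Open Scope complex_scope.

(** A Laplace transform would turn every C_s at once into multiplication by exp(-tau s). The proof
    does without that representation: log-convexity of phi stands in for one half of the spectral
    theorem, approximate eigenvectors for the other.

    What has to be built instead is the reproducing formula on discs of any centre and radius, since
    a horodisc is treated as a disc in its own right. It comes from area integrals alone. For q
    holomorphic and b the square root of the kernel, q(w) (r^2 - |w - a|^2) conj(b(w)) vanishes on
    the circle |w - a| = r, and its derivative in conj(w) is a multiple of q(w) (w - z)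
    conj(b(w))^2; so that function has integral 0. Goursat's theorem supplies local primitives, from
    which higher derivatives follow. The area of the unit disc is never computed: its positivity and
    the scaling by r^2 suffice.

    The maximum M is reached where exp(tau (s1 - s2)) = s1 / s2. Since a radius rho corresponds to s
    = 1/rho - 1, this quotient is alpha, and substitution gives the two powers of alpha. *)

Notation nc := Normc.normc.

(** * Real-valued modulus, real and imaginary parts *)

Section normc_theory.
Context {R : realType}.
Implicit Types (z w : R[i]) (x y : R).

Lemma nc_ge0 z : 0 <= nc z.
Proof. by case: z => x y; rewrite sqrtr_ge0. Qed.

Lemma nc0 : nc (0 : R[i]) = 0. Proof. exact: Normc.normc0. Qed.

Lemma nc1 : nc (1 : R[i]) = 1. Proof. exact: Normc.normc1. Qed.

Lemma nc_eq0 z : (nc z == 0) = (z == 0).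
Proof. by apply/eqP/eqP => [/Normc.eq0_normc|->]; rewrite ?nc0. Qed.

Lemma nc_gt0 z : (0 < nc z) = (z != 0).
Proof. by rewrite lt_neqAle nc_ge0 andbT eq_sym nc_eq0. Qed.

Lemma ncM z w : nc (z * w) = nc z * nc w.
Proof. exact: Normc.normcM. Qed.

Lemma ncX z n : nc (z ^+ n) = nc z ^+ n.
Proof. by elim: n => [|n IH]; rewrite ?expr0 ?nc1// !exprS ncM IH. Qed.

Lemma ncV z : nc z^-1 = (nc z)^-1.
Proof. exact: Normc.normcV. Qed.

Lemma ncN z : nc (- z) = nc z. Proof. exact: normcN. Qed.

Lemma ncD z w : nc (z + w) <= nc z + nc w. Proof. exact: le_normcD. Qed.

Lemma ncBC z w : nc (z - w) = nc (w - z). Proof. by rewrite -ncN opprB. Qed.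

Lemma ncB z w : nc (z - w) <= nc z + nc w.
Proof. by rewrite -(ncN w) ncD. Qed.

Lemma ncB_ge z w : nc z - nc w <= nc (z - w).
Proof. by rewrite lerBlDr -{1}(subrK w z) ncD. Qed.

Lemma ncD_ge z w : nc z - nc w <= nc (z + w).
Proof. by rewrite -(ncN w) -{2}(opprK w) ncB_ge. Qed.

Lemma ncJ z : nc z^* = nc z.
Proof. by case: z => x y /=; rewrite sqrrN. Qed.

Lemma ncR x : nc x%:C = `|x|.
Proof. by rewrite /= expr0n/= addr0 sqrtr_sqr. Qed.

Lemma nc_i : nc ('i : R[i]) = 1.
Proof. by rewrite /= expr0n/= add0r expr1n sqrtr1. Qed.

Lemma normE z : `|z| = (nc z)%:C. Proof. by case: z. Qed.

Lemma nc_Re z : `|complex.Re z| <= nc z.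
Proof. by have := normc_ge_Re z; rewrite normE lecR. Qed.

Lemma nc_Im z : `|complex.Im z| <= nc z.
Proof. by have := normc_ge_Im z; rewrite normE lecR. Qed.

Lemma nc_sqr z : nc z ^+ 2 = complex.Re z ^+ 2 + complex.Im z ^+ 2.
Proof. exact: sqr_normcE. Qed.

Lemma mul_conjc z : z * z^* = (nc z ^+ 2)%:C.
Proof.
by rewrite nc_sqr; case: z => x y; simpc; congr (_ +i* _); ring.
Qed.

Lemma nc_le_ReIm z : nc z <= `|complex.Re z| + `|complex.Im z|.
Proof.
rewrite -ler_sqr ?nnegrE ?nc_ge0 ?addr_ge0// nc_sqr sqrrD !real_normK ?num_real//.
by rewrite lerD2r lerDl mulrn_wge0 ?mulr_ge0.
Qed.

Lemma cReD z w : complex.Re (z + w) = complex.Re z + complex.Re w.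
Proof. by case: z w => ? ? [? ?]. Qed.

Lemma cImD z w : complex.Im (z + w) = complex.Im z + complex.Im w.
Proof. by case: z w => ? ? [? ?]. Qed.

Lemma cReM z w : complex.Re (z * w) =
  complex.Re z * complex.Re w - complex.Im z * complex.Im w.
Proof. by case: z w => ? ? [? ?]. Qed.

Lemma cImM z w : complex.Im (z * w) =
  complex.Re z * complex.Im w + complex.Im z * complex.Re w.
Proof. by case: z w => ? ? [? ?]. Qed.

Lemma complexP z w : complex.Re z = complex.Re w ->
  complex.Im z = complex.Im w -> z = w.
Proof. by case: z w => ? ? [? ?] /= -> ->. Qed.

End normc_theory.

(** * Complex derivatives and the Cauchy-Goursat theorem on rectangles *)

Section complex_derivative.
Context {R : realType}.
Implicit Types (f g q : Cplx R -> Cplx R) (z w d e : Cplx R).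

(** Balls of [Cplx R] have radii in [R[i]]. From here on neighbourhoods are handled with real
    radii. *)
Lemma near_ncP (P : set (Cplx R)) z :
  (\forall w \near z, P w) <->
  exists2 e : R, 0 < e & forall w, nc (w - z) < e -> P w.
Proof.
split=> [/nbhs_ballP[e /= e0 eP]|[e e0 eP]].
  have /complex_realP[e' ee'] : e \is Num.real by rewrite gtr0_real.
  exists e' => [|w wz]; first by move: e0; rewrite ee' ltcR.
  by apply: eP; rewrite /ball/= ee' normE ltcR ncBC.
apply/nbhs_ballP; exists e%:C => /=; first by rewrite ltcR.
by move=> w; rewrite /ball/= normE ltcR ncBC => /eP.
Qed.

Lemma cvg_ncP (T : Type) (F : set_system T) {FF : Filter F} (f : T -> Cplx R) d :
  f @ F --> d <-> forall e : R, 0 < e -> \forall x \near F, nc (f x - d) < e.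
Proof.
split=> [/cvgrPdist_lt fd e e0|fd].
  have := fd e%:C; rewrite ltcR => /(_ e0).
  by apply: filterS => x; rewrite normE ltcR ncBC.
apply/cvgrPdist_lt => e e0.
have /complex_realP[e' ee'] : e \is Num.real by rewrite gtr0_real.
have := fd e'; move: e0; rewrite ee' ltcR => e0 /(_ e0).
by apply: filterS => x; rewrite normE ltcR ncBC.
Qed.

Definition ccont f z := {for z, continuous f}.

Lemma ccontP f z : ccont f z <->
  forall e : R, 0 < e -> \forall w \near z, nc (f w - f z) < e.
Proof. exact: (@cvg_ncP _ (nbhs z)). Qed.

(* Caratheodory's form of complex differentiability at [z], with derivative [d]. *)
Definition cder f z d := exists q : Cplx R -> Cplx R,
  [/\ forall w, f w - f z = q w * (w - z), q z = d & ccont q z].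

(** Caratheodory's form makes the algebraic rules short; this form is the one that estimates
    produce. *)
Lemma cderP f z d : cder f z d <->
  forall e : R, 0 < e ->
    \forall w \near z, nc (f w - f z - d * (w - z)) <= e * nc (w - z).
Proof.
split=> [[q [fq <- cq]] e e0|fd].
  move/ccontP : cq => /(_ _ e0); apply: filterS => w qe.
  by rewrite fq -mulrBl ncM ler_wpM2r ?nc_ge0// ltW.
exists (fun w => if w == z then d else (f w - f z) / (w - z)); split.
- by move=> w; case: eqVneq => [->|wz]; rewrite ?subrr ?mulr0// divfK// subr_eq0.
- by rewrite eqxx.
- apply/ccontP => e e0; rewrite eqxx.
  have /fd : 0 < e / 2 by rewrite divr_gt0.
  apply: filterS => w; case: eqVneq => [_ _|wz h]; first by rewrite subrr nc0.
  have wz0 : w - z != 0 by rewrite subr_eq0.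
  apply: (@le_lt_trans _ _ (e / 2)); last by rewrite ltr_pdivrMr// mulr_natr mulr2n ltrDl.
  rewrite -(@ler_pM2r _ (nc (w - z))) ?nc_gt0// -ncM mulrBl divfK//.
Qed.

Lemma ccont_cst (c : Cplx R) z : ccont (fun=> c) z.
Proof. by apply/ccontP => e e0; apply/near_ncP; exists 1 => // w _; rewrite subrr nc0. Qed.

Lemma ccont_id z : ccont id z.
Proof. by rewrite /ccont; exact: cvg_id. Qed.

Lemma ccontD f g z : ccont f z -> ccont g z -> ccont (fun w => f w + g w) z.
Proof. by rewrite /ccont => cf cg; exact: (cvgD cf cg). Qed.

Lemma ccontN f z : ccont f z -> ccont (fun w => - f w) z.
Proof. by rewrite /ccont => cf; exact: (cvgN cf). Qed.

Lemma ccontB f g z : ccont f z -> ccont g z -> ccont (fun w => f w - g w) z.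
Proof. by move=> cf cg; apply: (ccontD cf); exact: ccontN. Qed.

Lemma ccontM f g z : ccont f z -> ccont g z -> ccont (fun w => f w * g w) z.
Proof. by rewrite /ccont => cf cg; exact: (cvgM cf cg). Qed.

Lemma ccontV f z : f z != 0 -> ccont f z -> ccont (fun w => (f w)^-1) z.
Proof. by rewrite /ccont => f0 cf; exact: (cvgV f0 cf). Qed.

Lemma ccont_comp f g z : ccont f z -> ccont g (f z) -> ccont (fun w => g (f w)) z.
Proof. by rewrite /ccont => cf cg; exact: (continuous_comp cf cg). Qed.

Lemma ccont_near f g z : (\forall w \near z, f w = g w) -> ccont f z -> ccont g z.
Proof.
move=> fg /ccontP cf; have fz := nbhs_singleton fg.
apply/ccontP => e /cf; rewrite -fz.
by apply: filterS2 fg => x ->.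
Qed.

Lemma ccontJ f z : ccont f z -> ccont (fun w => (f w)^*) z.
Proof.
move=> /ccontP cf; apply/ccontP => e /cf; apply: filterS => w.
by rewrite -rmorphB ncJ.
Qed.

Lemma cder_continuous f z d : cder f z d -> ccont f z.
Proof.
move=> [q [fq _ cq]].
rewrite (_ : f = (fun w => q w * (w - z) + f z)); last first.
  by apply/funext => w; rewrite -fq subrK.
apply: ccontD; last exact: ccont_cst.
apply: ccontM; first exact: cq.
apply: ccontD; first exact: ccont_id.
exact: ccont_cst.
Qed.

Lemma cder_cst (c : Cplx R) z : cder (fun=> c) z 0.
Proof.
exists (fun=> 0); split; [by move=> w; rewrite subrr mul0r|by []|exact: ccont_cst].
Qed.

Lemma cder_id z : cder id z 1.
Proof. exists (fun=> 1); split; [by move=> w; rewrite mul1r|by []|exact: ccont_cst]. Qed.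

Lemma cderD f g z d e : cder f z d -> cder g z e ->
  cder (fun w => f w + g w) z (d + e).
Proof.
move=> [p [fp <- cp]] [q [gq <- cq]]; exists (fun w => p w + q w); split=> [w||].
- by rewrite mulrDl -fp -gq; ring.
- by [].
- exact: ccontD.
Qed.

Lemma cderN f z d : cder f z d -> cder (fun w => - f w) z (- d).
Proof.
move=> [p [fp <- cp]]; exists (fun w => - p w); split=> [w||].
- by rewrite mulNr -fp; ring.
- by [].
- exact: ccontN.
Qed.

Lemma cderB f g z d e : cder f z d -> cder g z e ->
  cder (fun w => f w - g w) z (d - e).
Proof. by move=> hf hg; apply: cderD => //; exact: cderN. Qed.

Lemma cderM f g z d e : cder f z d -> cder g z e ->
  cder (fun w => f w * g w) z (d * g z + f z * e).
Proof.
move=> hf hg; have cg := cder_continuous hg.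
move: hf hg => [p [fp <- cp]] [q [gq <- cq]].
exists (fun w => p w * g w + f z * q w); split=> [w||].
- by rewrite mulrDl mulrAC -fp -mulrA -gq; ring.
- by [].
- apply: ccontD; first exact: ccontM.
  by apply: ccontM; [exact: ccont_cst|].
Qed.

Lemma cderZ (c : Cplx R) f z d : cder f z d -> cder (fun w => c * f w) z (c * d).
Proof. by move=> fd; have := cderM (cder_cst c z) fd; rewrite mul0r add0r. Qed.

Lemma cder_comp f g z d e : cder f z d -> cder g (f z) e ->
  cder (fun w => g (f w)) z (e * d).
Proof.
move=> hf; have cf := cder_continuous hf; move: hf.
move=> [p [fp <- cp]] [q [gq <- cq]].
exists (fun w => q (f w) * p w); split=> [w||].
- by rewrite gq fp mulrA.
- by [].
- apply: ccontM; last exact: cp.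
  exact: ccont_comp.
Qed.

Lemma cder_inv z : z != 0 -> cder (fun w => w^-1) z (- z ^- 2).
Proof.
(* The identity must hold for every [w]. As [0^-1 = 0], at [w = 0] it reads [- z^-1 = q 0 * - z],
   which forces the value [z ^- 2]. *)
move=> z0; exists (fun w => if w == 0 then z ^- 2 else - (z * w)^-1).
split=> [w||].
- case: eqVneq => [->|w0]; first by rewrite invr0; field.
  by field; rewrite w0.
- by rewrite (negPf z0) expr2.
- apply: (@ccont_near (fun w => - (z * w)^-1)).
    apply/near_ncP; exists (nc z); first by rewrite nc_gt0.
    by move=> w; case: eqVneq => // ->; rewrite sub0r ncN ltxx.
  apply: ccontN; apply: ccontV; first by rewrite mulf_neq0.
  by apply: ccontM; [exact: ccont_cst|exact: ccont_id].
Qed.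

Lemma cderV f z d : cder f z d -> f z != 0 ->
  cder (fun w => (f w)^-1) z (- d / f z ^+ 2).
Proof.
move=> fd f0; have := cder_comp fd (cder_inv f0).
by rewrite mulNr mulrC mulNr.
Qed.

Lemma cder_near f g z d : (\forall w \near z, f w = g w) -> cder f z d ->
  cder g z d.
Proof.
move=> fg /cderP fd; apply/cderP => e /fd.
have fz := nbhs_singleton fg.
by move=> h; near=> w; rewrite -fz; have <- : f w = g w; near: w.
Unshelve. all: by end_near. Qed.

Lemma cder_eq f z d e : cder f z d -> d = e -> cder f z e.
Proof. by move=> ? <-. Qed.

Lemma near_nc_ball z (e : R) : 0 < e -> \forall w \near z, nc (w - z) < e.
Proof. by move=> e0; apply/near_ncP; exists e. Qed.

Lemma near_nc_ballN0 z (e : R) : 0 < e -> exists w, w != z /\ nc (w - z) < e.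
Proof.
move=> e0; exists (z + (e / 2)%:C); rewrite addrAC subrr add0r ncR.
rewrite -subr_eq0 addrAC subrr add0r -nc_eq0 ncR normr_eq0.
by rewrite gt_eqF ?divr_gt0// gtr0_norm ?divr_gt0// ltr_pdivrMr// mulr_natr mulr2n ltrDl.
Qed.

Lemma cder_unique f z d e : cder f z d -> cder f z e -> d = e.
Proof.
move=> /cderP fd /cderP fe; apply/eqP; rewrite -subr_eq0 -nc_eq0.
rewrite eq_le nc_ge0 andbT; apply/ler_addgt0Pr => k k0; rewrite add0r.
have k2 : 0 < k / 2 by rewrite divr_gt0.
have : \forall w \near z, nc (f w - f z - d * (w - z)) <= k / 2 * nc (w - z) /\
    nc (f w - f z - e * (w - z)) <= k / 2 * nc (w - z).
  exact: filterI (fd _ k2) (fe _ k2).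
move=> /near_ncP[r r0 h].
have [w [wz /h[h1 h2]]] := near_nc_ballN0 z r0.
have wz0 : 0 < nc (w - z) by rewrite nc_gt0 subr_eq0.
rewrite -(ler_pM2r wz0) -ncM.
have -> : (d - e) * (w - z) = (f w - f z - e * (w - z)) - (f w - f z - d * (w - z)) by ring.
apply: le_trans (ncB _ _) _; rewrite (le_trans (lerD h2 h1))// -mulrDl.
by rewrite ler_wpM2r ?nc_ge0//; lra.
Qed.

(** The bridge between [cder] and the predicate [holomorphic] that defines the Bergman space. *)
Lemma derivable_cder f z : derivable f z 1 <-> exists d, cder f z d.
Proof.
have H (d : Cplx R) : ((fun h : Cplx R => h^-1 *: (f (h *: (1 : Cplx R) + z) - f z))
    @ (0 : Cplx R)^' --> d) <-> cder f z d.
  split=> [fd|/cderP fd].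
    apply/cderP => e e0; have := fd.
    move=> /cvg_ncP /(_ _ e0) /near_ncP[r r0 h].
    apply/near_ncP; exists r => // w wz.
    have [->|wz0] := eqVneq w z; first by rewrite !subrr mulr0 subrr nc0 mulr0.
    have wz1 : w - z != 0 by rewrite subr_eq0.
    have := h (w - z); rewrite subr0 => /(_ wz wz1).
    rewrite /GRing.scale/= mulr1 subrK => /ltW h2.
    rewrite -(@ler_pM2r _ (nc (w - z))) ?nc_gt0// -ncM in h2.
    by rewrite mulrBl mulrAC mulVf// mul1r in h2.
  apply/cvg_ncP => e e0; apply/near_ncP.
  have /fd/near_ncP[r r0 h] : 0 < e / 2 by rewrite divr_gt0.
  exists r => // w; rewrite subr0 => wr w0.
  have := h (w + z); rewrite addrK => /(_ wr) h2.
  apply: (@le_lt_trans _ _ (e / 2)); last by rewrite ltr_pdivrMr// mulr_natr mulr2n ltrDl.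
  rewrite -(@ler_pM2r _ (nc w)) ?nc_gt0// -ncM.
  by rewrite /GRing.scale/= mulr1 mulrBl mulrAC mulVf// mul1r.
split=> [fz|[d /H fd]]; last by apply/cvg_ex; exists d.
by exists (lim ((fun h : Cplx R => h^-1 *: (f (h *: (1 : Cplx R) + z) - f z)) @ (0 : Cplx R)^')); apply/H.
Qed.

End complex_derivative.

(** * Derivatives and integrals along segments *)

Section real_line.
Context {R : realType}.
Implicit Types (F h H : R -> R) (a b t x : R) (g G : R -> R[i]).

Lemma is_derive_epsP F t (d : R) :
  (forall e : R, 0 < e -> \forall s \near t, `|F s - F t - d * (s - t)| <= e * `|s - t|) ->
  is_derive t 1 F d.
Proof.
move=> Fd.
have H : (fun k : R => k^-1 *: (F (k *: (1 : R) + t) - F t)) @ (0 : R)^' --> d.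
  apply/cvgrPdist_lt => e e0.
  have /Fd/nbhs_ballP[r /= r0 h] : 0 < e / 2 by rewrite divr_gt0.
  exists r => //= s; rewrite /ball/= sub0r normrN => sr s0.
  have := h (s + t); rewrite /ball/= opprD addrCA subrr addr0 normrN addrK.
  move=> /(_ sr) h2.
  rewrite distrC; apply: (@le_lt_trans _ _ (e / 2)); last by rewrite ltr_pdivrMr// mulr_natr mulr2n ltrDl.
  rewrite -(@ler_pM2r _ `|s|) ?normr_gt0// -normrM.
  by rewrite /GRing.scale/= mulr1 mulrBl mulrAC mulVf// mul1r.
split; first by apply/cvg_ex; exists d.
exact: cvg_lim H.
Qed.

Lemma within_continuous_itv h a b : (forall x, a <= x <= b -> {for x, continuous h}) ->
  {within `[a, b], continuous h}.
Proof.
move=> ch; apply: continuous_in_subspaceT => x; rewrite inE/= in_itv/=.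
exact: ch.
Qed.

Lemma continuous_itv_integrable h a b :
  (forall x, a <= x <= b -> {for x, continuous h}) ->
  (@lebesgue_measure R).-integrable `[a, b] (EFin \o h).
Proof.
move=> ch; apply: continuous_compact_integrable; first exact: segment_compact.
exact: within_continuous_itv.
Qed.

Lemma integral_derive h H a b : a <= b ->
  (forall x, a <= x <= b -> is_derive x 1 H (h x)) ->
  (forall x, a <= x <= b -> {for x, continuous h}) ->
  (\int[lebesgue_measure]_(x in `[a, b]) h x)%R = H b - H a.
Proof.
rewrite le_eqVlt => /predU1P[<-|ab] dH ch.
  by rewrite set_itv1 Rintegral_set1 subrr.
rewrite /Rintegral (@continuous_FTC2 _ h H)//.
- exact: within_continuous_itv.
- have cH x : a <= x <= b -> {for x, continuous H}.
    move=> xab; apply: differentiable_continuous.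
    by apply/derivable1_diffP; have [] := dH _ xab.
  split.
  + move=> x; rewrite in_itv/= => /andP[ax xb].
    by have [|] := dH x; rewrite ?(ltW ax) ?(ltW xb).
  + by apply: cvg_at_right_filter; apply: cH; rewrite lexx (ltW ab).
  + by apply: cvg_at_left_filter; apply: cH; rewrite lexx (ltW ab).
- move=> x; rewrite in_itv/= => /andP[ax xb].
  by rewrite derive1E; have [|_ ->] := dH x; rewrite ?(ltW ax) ?(ltW xb).
Qed.

(** Complex functions of a real variable are treated componentwise, so that the real fundamental
    theorem of calculus applies to each component. *)
Definition rcont g t := {for t, continuous (fun s => complex.Re (g s))} /\
  {for t, continuous (fun s => complex.Im (g s))}.

Definition rder g t (d : R[i]) :=
  is_derive t 1 (fun s => complex.Re (g s)) (complex.Re d) /\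
  is_derive t 1 (fun s => complex.Im (g s)) (complex.Im d).

Definition cint a b g : R[i] :=
  (\int[lebesgue_measure]_(x in `[a, b]) complex.Re (g x))%R +i*
  (\int[lebesgue_measure]_(x in `[a, b]) complex.Im (g x))%R.

Lemma cint_rder g G a b : a <= b -> (forall x, a <= x <= b -> rder G x (g x)) ->
  (forall x, a <= x <= b -> rcont g x) -> cint a b g = G b - G a.
Proof.
move=> ab dG cg; apply: complexP; rewrite ?RecB ?ImcB /=.
  apply: (@integral_derive _ (fun x => complex.Re (G x))) => // x.
    by move=> /dG[].
  by move=> /cg[].
apply: (@integral_derive _ (fun x => complex.Im (G x))) => // x.
  by move=> /dG[].
by move=> /cg[].
Qed.

Lemma cintD g1 g2 a b : (forall x, a <= x <= b -> rcont g1 x) ->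
  (forall x, a <= x <= b -> rcont g2 x) ->
  cint a b (fun x => g1 x + g2 x) = cint a b g1 + cint a b g2.
Proof.
move=> c1 c2; rewrite /cint.
apply: complexP => /=.
  rewrite -RintegralD//; last 2 first.
  - by apply: continuous_itv_integrable => x /c1[].
  - by apply: continuous_itv_integrable => x /c2[].
  by apply: eq_Rintegral => x _; rewrite cReD.
rewrite -RintegralD//; last 2 first.
- by apply: continuous_itv_integrable => x /c1[].
- by apply: continuous_itv_integrable => x /c2[].
by apply: eq_Rintegral => x _; rewrite cImD.
Qed.

Lemma eq_cint g1 g2 a b : (forall x, a <= x <= b -> g1 x = g2 x) ->
  cint a b g1 = cint a b g2.
Proof.
by move=> h; rewrite /cint; congr (_ +i* _); apply: eq_Rintegral => x;
  rewrite inE/= in_itv/= => /h ->.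
Qed.

Lemma integral_itv_cat h a b c : a <= b <= c ->
  (forall x, a <= x <= c -> {for x, continuous h}) ->
  (\int[lebesgue_measure]_(x in `[a, c]) h x)%R =
  (\int[lebesgue_measure]_(x in `[a, b]) h x)%R + (\int[lebesgue_measure]_(x in `[b, c]) h x)%R.
Proof.
move=> /andP[ab bc] ch; apply/eqP; rewrite addrC -subr_eq; apply/eqP.
have ic := continuous_itv_integrable ch.
rewrite (@Rintegral_itvB _ h (BLeft a) (BRight c) b)//.
apply: Rintegral_itv_obnd_cbnd; apply: integrableS ic => //.
by apply: subset_itv; rewrite bnd_simp.
Qed.

Lemma cint_cat g a b c : a <= b <= c -> (forall x, a <= x <= c -> rcont g x) ->
  cint a c g = cint a b g + cint b c g.
Proof.
move=> abc cg; rewrite /cint; apply: complexP => /=.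
  by apply: integral_itv_cat => // x /cg[].
by apply: integral_itv_cat => // x /cg[].
Qed.

Lemma integral_itv_le h a b (K : R) : a <= b ->
  (forall x, a <= x <= b -> {for x, continuous h}) ->
  (forall x, a <= x <= b -> `|h x| <= K) ->
  `|(\int[lebesgue_measure]_(x in `[a, b]) h x)%R| <= K * (b - a).
Proof.
move=> ab ch hK; have ih := continuous_itv_integrable ch.
apply: le_trans (le_normr_Rintegral _ ih) _ => //.
have iK : (@lebesgue_measure R).-integrable `[a, b] (EFin \o (fun=> K)).
  by apply: continuous_itv_integrable => x _; exact: cvg_cst.
apply: le_trans (@le_Rintegral _ _ _ lebesgue_measure _ _ (fun=> K) _ _ _ _) _ => //.
  by apply: continuous_itv_integrable => x /ch cx; exact: (cvg_norm cx).
rewrite Rintegral_cst//= lebesgue_measure_itv/= lte_fin.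
case: ltP => //= ba; rewrite mulr0.
by move: ab; rewrite le_eqVlt ltNge ba orbF => /eqP ->; rewrite subrr mulr0.
Qed.

(** The factor 2 is the price of bounding the two components separately; Goursat's argument
    tolerates any constant. *)
Lemma cint_le g a b (K : R) : a <= b -> (forall x, a <= x <= b -> rcont g x) ->
  (forall x, a <= x <= b -> nc (g x) <= K) -> nc (cint a b g) <= 2 * K * (b - a).
Proof.
move=> ab cg gK; apply: le_trans (nc_le_ReIm _) _.
rewrite -mulrA mulr_natl mulr2n; apply: lerD; apply: integral_itv_le => // x xab.
- by have [] := cg _ xab.
- by rewrite (le_trans (nc_Re _))// gK.
- by have [] := cg _ xab.
- by rewrite (le_trans (nc_Im _))// gK.
Qed.

Lemma cintZ g a b (k : R[i]) : (forall x, a <= x <= b -> rcont g x) ->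
  cint a b (fun x => k * g x) = k * cint a b g.
Proof.
move=> cg.
have i1 : (@lebesgue_measure R).-integrable `[a, b] (EFin \o (fun x => complex.Re (g x))).
  by apply: continuous_itv_integrable => x /cg[].
have i2 : (@lebesgue_measure R).-integrable `[a, b] (EFin \o (fun x => complex.Im (g x))).
  by apply: continuous_itv_integrable => x /cg[].
have Z u (m : R) : (@lebesgue_measure R).-integrable `[a, b] (EFin \o u) ->
    (@lebesgue_measure R).-integrable `[a, b] (EFin \o (fun x => m * u x)).
  by move=> iu; exact: (@integrableZl _ _ _ lebesgue_measure _ _ m _ iu).
case: k => k1 k2; apply: complexP => /=.
  rewrite -!RintegralZl// -RintegralB//; [|exact: Z..].
  by apply: eq_Rintegral => x _; case: (g x).
rewrite -!RintegralZl// -RintegralD//; [|exact: Z..].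
by apply: eq_Rintegral => x _; case: (g x).
Qed.

End real_line.

Section lines.
Context {R : realType}.
Implicit Types (f : Cplx R -> Cplx R) (g : R -> R[i]) (x y t : R).

Lemma rderP g t (d : R[i]) :
  (forall e : R, 0 < e -> \forall s \near t,
    nc (g s - g t - d * (s - t)%:C) <= e * `|s - t|) -> rder g t d.
Proof.
move=> gd; split; apply: is_derive_epsP => e /gd; apply: filterS => s.
  move=> h; apply: le_trans h; apply: le_trans (nc_Re _).
  by rewrite !RecB cReM /= mulr0 subr0.
move=> h; apply: le_trans h; apply: le_trans (nc_Im _).
by rewrite !ImcB cImM /= mulr0 add0r.
Qed.

Lemma near_line (P : set (Cplx R)) (z e : Cplx R) t :
  (\forall w \near z + t%:C * e, P w) -> \forall s \near t, P (z + s%:C * e).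
Proof.
move=> /near_ncP[r r0 h]; have e1 : 0 < nc e + 1 by rewrite ltr_wpDl ?nc_ge0.
apply/nbhs_ballP; exists (r / (nc e + 1)); first by rewrite /= divr_gt0.
move=> s; rewrite /ball/= ltr_pdivlMr// => st; apply: h.
rewrite (_ : z + s%:C * e - (z + t%:C * e) = - ((t - s)%:C * e)); last by rewrite rmorphB /=; ring.
rewrite ncN ncM ncR (le_lt_trans _ st)// ler_wpM2l// lerDl//.
Qed.

Lemma cder_line f (z e d : Cplx R) t : cder f (z + t%:C * e) d ->
  rder (fun s => f (z + s%:C * e)) t (d * e).
Proof.
move=> /cderP fd; apply: rderP => k k0.
have e1 : 0 < nc e + 1 by rewrite ltr_wpDl ?nc_ge0.
have /fd/near_line : 0 < k / (nc e + 1) by rewrite divr_gt0.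
apply: filterS => s.
have -> : z + s%:C * e - (z + t%:C * e) = (s - t)%:C * e by rewrite rmorphB /=; ring.
rewrite -[d * e * _]mulrA [e * _]mulrC => h; apply: le_trans h _.
rewrite ncM ncR mulrCA [leRHS]mulrC ler_wpM2l// -mulrA ler_piMr ?(ltW k0)//.
by rewrite mulrC ler_pdivrMr// mul1r lerDl.
Qed.

Lemma ccont_line f (z e : Cplx R) t : ccont f (z + t%:C * e) ->
  rcont (fun s => f (z + s%:C * e)) t.
Proof.
move=> /ccontP cf; split; apply/cvgrPdist_lt => k /cf/near_line; apply: filterS => s h.
  by rewrite -RecB (le_lt_trans (nc_Re _))// ncBC.
by rewrite -ImcB (le_lt_trans (nc_Im _))// ncBC.
Qed.

Lemma hlineE x y : x +i* y = (0 +i* y) + x%:C * 1 :> R[i].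
Proof. by simpc. Qed.

Lemma vlineE x y : x +i* y = x%:C + y%:C * 'i :> R[i].
Proof. by simpc. Qed.

Lemma cder_hline f (d : Cplx R) x y : cder f (x +i* y) d ->
  rder (fun s => f (s +i* y)) x d.
Proof.
rewrite hlineE => /cder_line; rewrite mulr1.
by under eq_fun do rewrite -hlineE.
Qed.

Lemma cder_vline f (d : Cplx R) x y : cder f (x +i* y) d ->
  rder (fun s => f (x +i* s)) y (d * 'i).
Proof.
by rewrite vlineE => /cder_line; under eq_fun do rewrite -vlineE.
Qed.

Lemma ccont_hline f x y : ccont f (x +i* y) -> rcont (fun s => f (s +i* y)) x.
Proof.
by rewrite hlineE => /ccont_line; under eq_fun do rewrite -hlineE.
Qed.

Lemma ccont_vline f x y : ccont f (x +i* y) -> rcont (fun s => f (x +i* s)) y.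
Proof.
by rewrite vlineE => /ccont_line; under eq_fun do rewrite -vlineE.
Qed.

Lemma eq_rcont g1 g2 t : g1 =1 g2 -> rcont g1 t -> rcont g2 t.
Proof. by move=> /funext ->. Qed.

Lemma rcontM g1 g2 t : rcont g1 t -> rcont g2 t -> rcont (fun s => g1 s * g2 s) t.
Proof.
move=> [c1 c2] [c3 c4].
apply: (@eq_rcont (fun s =>
  (complex.Re (g1 s) * complex.Re (g2 s) - complex.Im (g1 s) * complex.Im (g2 s)) +i*
  (complex.Re (g1 s) * complex.Im (g2 s) + complex.Im (g1 s) * complex.Re (g2 s)))).
  by move=> s; apply: complexP; rewrite ?cReM ?cImM.
split; first exact: (cvgB (cvgM c1 c3) (cvgM c2 c4)).
exact: (cvgD (cvgM c1 c4) (cvgM c2 c3)).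
Qed.

Lemma rcont_cst (k : R[i]) t : rcont (fun=> k) t.
Proof. by split; exact: cvg_cst. Qed.

Lemma rderM g1 g2 t d1 d2 : rder g1 t d1 -> rder g2 t d2 ->
  rder (fun s => g1 s * g2 s) t (d1 * g2 t + g1 t * d2).
Proof.
move=> [a1 a2] [b1 b2]; split.
  under eq_fun do rewrite cReM.
  rewrite (_ : complex.Re _ = (complex.Re (g1 t) *: complex.Re d2 + complex.Re (g2 t) *: complex.Re d1) -
     (complex.Im (g1 t) *: complex.Im d2 + complex.Im (g2 t) *: complex.Im d1)).
    exact: (is_deriveB (is_deriveM a1 b1) (is_deriveM a2 b2)).
  by rewrite cReD !cReM /GRing.scale/=; ring.
under eq_fun do rewrite cImM.
rewrite (_ : complex.Im _ = (complex.Re (g1 t) *: complex.Im d2 + complex.Im (g2 t) *: complex.Re d1) +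
   (complex.Im (g1 t) *: complex.Re d2 + complex.Re (g2 t) *: complex.Im d1)).
  exact: (is_deriveD (is_deriveM a1 b2) (is_deriveM a2 b1)).
by rewrite cImD !cImM /GRing.scale/=; ring.
Qed.

Lemma rderD g1 g2 t d1 d2 : rder g1 t d1 -> rder g2 t d2 ->
  rder (fun s => g1 s + g2 s) t (d1 + d2).
Proof.
move=> [a1 a2] [b1 b2]; split.
  by rewrite cReD; under eq_fun do rewrite cReD; exact: is_deriveD.
by rewrite cImD; under eq_fun do rewrite cImD; exact: is_deriveD.
Qed.

Lemma rderJ g t d : rder g t d -> rder (fun s => (g s)^*) t d^*.
Proof.
have RJ (z : R[i]) : complex.Re z^* = complex.Re z by case: z.
have IJ (z : R[i]) : complex.Im z^* = - complex.Im z by case: z.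
move=> [a1 a2]; split.
  by rewrite RJ; under eq_fun do rewrite RJ.
by rewrite IJ; under eq_fun do rewrite IJ; exact: is_deriveN.
Qed.

Lemma rcontD g1 g2 t : rcont g1 t -> rcont g2 t -> rcont (fun s => g1 s + g2 s) t.
Proof.
move=> [c1 c2] [c3 c4].
apply: (@eq_rcont (fun s =>
  (complex.Re (g1 s) + complex.Re (g2 s)) +i* (complex.Im (g1 s) + complex.Im (g2 s)))).
  by move=> s; apply: complexP; rewrite ?cReD ?cImD.
split; [exact: (cvgD c1 c3)|exact: (cvgD c2 c4)].
Qed.

End lines.

(** * Goursat's theorem by repeated quartering *)

Section goursat.
Context {R : realType}.
Implicit Types (f : Cplx R -> Cplx R) (a b c d x y : R) (q : R * R * (R * R)).

(** The counterclockwise contour integral over the boundary of [a, b] x [c, d]: bottom, right, top,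
    left. *)
Definition rect_integral f q : R[i] :=
  let: (a, b, (c, d)) := q in
  cint a b (fun x => f (x +i* c)) + 'i * cint c d (fun y => f (b +i* y)) -
  cint a b (fun x => f (x +i* d)) - 'i * cint c d (fun y => f (a +i* y)).

Definition rect_wf q := q.1.1 <= q.1.2 /\ q.2.1 <= q.2.2.

Definition in_rect q (z : Cplx R) :=
  q.1.1 <= complex.Re z <= q.1.2 /\ q.2.1 <= complex.Im z <= q.2.2.

Lemma rect_integral_le f q (K : R) : rect_wf q ->
  (forall z, in_rect q z -> ccont f z) ->
  (forall z, in_rect q z -> nc (f z) <= K) ->
  nc (rect_integral f q) <= 4 * K * (q.1.2 - q.1.1 + (q.2.2 - q.2.1)).
Proof.
case: q => -[a b] [c d] [ab cd] cf fK; rewrite /= in ab cd.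
rewrite /rect_integral.
apply: le_trans (ncB _ _) _; rewrite ncM nc_i mul1r.
apply: le_trans (lerD (ncB _ _) (lexx _)) _.
apply: le_trans (lerD (lerD (ncD _ _) (lexx _)) (lexx _)) _; rewrite ncM nc_i mul1r.
have H1 y : c <= y <= d -> nc (cint a b (fun x => f (x +i* y))) <= 2 * K * (b - a).
  move=> ycd; apply: cint_le => // x xab; last exact: fK.
  by apply: ccont_hline; exact: cf.
have H2 x : a <= x <= b -> nc (cint c d (fun y => f (x +i* y))) <= 2 * K * (d - c).
  move=> xab; apply: cint_le => // y ycd; last exact: fK.
  by apply: ccont_vline; exact: cf.
have := H1 c; rewrite lexx cd => /(_ erefl) ?.
have := H1 d; rewrite lexx cd => /(_ erefl) ?.
have := H2 a; rewrite lexx ab => /(_ erefl) ?.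
have := H2 b; rewrite lexx ab => /(_ erefl) ?.
rewrite [leRHS]/=; lra.
Qed.

Lemma rect_integral_primitive f (F : Cplx R -> Cplx R) q : rect_wf q ->
  (forall z, in_rect q z -> ccont f z) ->
  (forall z, in_rect q z -> cder F z (f z)) -> rect_integral f q = 0.
Proof.
case: q => -[a b] [c d] [/= ab cd] cf dF.
have H1 y : c <= y <= d -> cint a b (fun x => f (x +i* y)) = F (b +i* y) - F (a +i* y).
  move=> ycd; apply: (@cint_rder _ _ (fun x => F (x +i* y))) => // x xab.
    by apply: cder_hline; exact: dF.
  by apply: ccont_hline; exact: cf.
have H2 x : a <= x <= b -> 'i * cint c d (fun y => f (x +i* y)) = F (x +i* d) - F (x +i* c).
  move=> xab; rewrite -cintZ; last by move=> y ycd; apply: ccont_vline; exact: cf.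
  apply: (@cint_rder _ _ (fun y => F (x +i* y))) => // y ycd.
    by rewrite mulrC; apply: cder_vline; exact: dF.
  by apply: rcontM; [exact: rcont_cst|apply: ccont_vline; exact: cf].
rewrite !H1 ?H2 ?lexx ?ab ?cd//; ring.
Qed.

Lemma rect_integralB f g q : rect_wf q ->
  (forall z, in_rect q z -> ccont f z) -> (forall z, in_rect q z -> ccont g z) ->
  rect_integral (fun z => f z - g z) q = rect_integral f q - rect_integral g q.
Proof.
case: q => -[a b] [c d] [/= ab cd] cf cg.
have H1 y : c <= y <= d -> cint a b (fun x => f (x +i* y) - g (x +i* y)) =
   cint a b (fun x => f (x +i* y)) - cint a b (fun x => g (x +i* y)).
  move=> ycd; have cx x : a <= x <= b -> rcont (fun x => g (x +i* y)) x.
    by move=> xab; apply: ccont_hline; exact: cg.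
  rewrite -mulN1r -(cintZ _ cx) -cintD.
  - by apply: eq_cint => x _; rewrite mulN1r.
  - by move=> x xab; apply: ccont_hline; exact: cf.
  - by move=> x xab; apply: rcontM; [exact: rcont_cst|exact: cx].
have H2 x : a <= x <= b -> cint c d (fun y => f (x +i* y) - g (x +i* y)) =
   cint c d (fun y => f (x +i* y)) - cint c d (fun y => g (x +i* y)).
  move=> xab; have cy y : c <= y <= d -> rcont (fun y => g (x +i* y)) y.
    by move=> ycd; apply: ccont_vline; exact: cg.
  rewrite -mulN1r -(cintZ _ cy) -cintD.
  - by apply: eq_cint => y _; rewrite mulN1r.
  - by move=> y ycd; apply: ccont_vline; exact: cf.
  - by move=> y ycd; apply: rcontM; [exact: rcont_cst|exact: cy].
rewrite !H1 ?H2 ?lexx ?ab ?cd//; ring.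
Qed.

Definition rect_quarter (l m : bool) q :=
  let: (a, b, (c, d)) := q in
  (if l then (a, (a + b) / 2) else ((a + b) / 2, b),
   if m then (c, (c + d) / 2) else ((c + d) / 2, d)).

Lemma rect_integral_split f q : rect_wf q ->
  (forall z, in_rect q z -> ccont f z) ->
  rect_integral f q =
  rect_integral f (rect_quarter true true q) + rect_integral f (rect_quarter true false q) +
  rect_integral f (rect_quarter false true q) + rect_integral f (rect_quarter false false q).
Proof.
case: q => -[a b] [c d] [/= ab cd] cf.
have am : a <= (a + b) / 2 <= b by apply/andP; split; lra.
have cm : c <= (c + d) / 2 <= d by apply/andP; split; lra.
have H1 y : c <= y <= d -> cint a b (fun x => f (x +i* y)) =
   cint a ((a + b) / 2) (fun x => f (x +i* y)) + cint ((a + b) / 2) b (fun x => f (x +i* y)).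
  by move=> ycd; apply: cint_cat => // x xab; apply: ccont_hline; exact: cf.
have H2 x : a <= x <= b -> cint c d (fun y => f (x +i* y)) =
   cint c ((c + d) / 2) (fun y => f (x +i* y)) + cint ((c + d) / 2) d (fun y => f (x +i* y)).
  by move=> xab; apply: cint_cat => // y ycd; apply: ccont_vline; exact: cf.
rewrite (H1 c) ?lexx// (H1 d) ?lexx ?cd// (H2 a) ?lexx// (H2 b) ?lexx ?ab//; ring.
Qed.

Lemma rect_quarter_wf l m q : rect_wf q -> rect_wf (rect_quarter l m q).
Proof.
by case: q => -[a b] [c d] [/= ab cd]; case: l; case: m; split=> /=; lra.
Qed.

Lemma rect_quarter_sub l m q z : rect_wf q -> in_rect (rect_quarter l m q) z -> in_rect q z.
Proof.
case: q => -[a b] [c d] [/= ab cd].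
by case: l; case: m => -[/= /andP[? ?] /andP[? ?]]; split=> /=; apply/andP; split; lra.
Qed.

Definition rect_size q := q.1.2 - q.1.1 + (q.2.2 - q.2.1).

Lemma rect_quarter_size l m q : rect_size (rect_quarter l m q) = rect_size q / 2.
Proof.
by case: q => -[a b] [c d]; rewrite /rect_size; case: l; case: m => /=; lra.
Qed.

Lemma rect_quarter_large f q : rect_wf q ->
  (forall z, in_rect q z -> ccont f z) ->
  exists l m, nc (rect_integral f q) / 4 <= nc (rect_integral f (rect_quarter l m q)).
Proof.
move=> wq cf; have [h|h1] := leP (nc (rect_integral f q) / 4)
  (nc (rect_integral f (rect_quarter true true q))); first by exists true, true.
have [h|h2] := leP (nc (rect_integral f q) / 4)
  (nc (rect_integral f (rect_quarter true false q))); first by exists true, false.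
have [h|h3] := leP (nc (rect_integral f q) / 4)
  (nc (rect_integral f (rect_quarter false true q))); first by exists false, true.
exists false, false; move: h1 h2 h3; rewrite (rect_integral_split wq cf).
set e1 := rect_integral _ _; set e2 := rect_integral _ _.
set e3 := rect_integral _ _; set e4 := rect_integral _ _.
have := ncD (e1 + e2 + e3) e4; have := ncD (e1 + e2) e3; have := ncD e1 e2; lra.
Qed.

Lemma rect_integral_eq0 f q : rect_wf q ->
  (forall z, in_rect q z -> exists k, cder f z k) -> rect_integral f q = 0.
Proof.
move=> wq df; apply/eqP/negPn/negP => E0.
have cf z : in_rect q z -> ccont f z by move=> /df[k /cder_continuous].
(* The hypotheses on [q'] are placed inside the chosen object so that the choice is a total function
   and can be iterated; where they fail, [q'] itself is returned. *)
have step q' : {q'' | rect_wf q' /\ (forall z, in_rect q' z -> in_rect q z) ->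
    [/\ rect_wf q'', (forall z, in_rect q'' z -> in_rect q' z),
     rect_size q'' = rect_size q' / 2 &
     nc (rect_integral f q') / 4 <= nc (rect_integral f q'')]}.
  apply: cid; have [[wq' qq']|?] := pselect (rect_wf q' /\
    forall z, in_rect q' z -> in_rect q z); last by exists q'.
  have [|l [m lm]] := @rect_quarter_large f q' wq'; first by move=> z /qq'; exact: cf.
  exists (rect_quarter l m q') => _; split=> //.
  - exact: rect_quarter_wf.
  - by move=> z; exact: rect_quarter_sub.
  - exact: rect_quarter_size.
pose Q n := iter n (fun q' => sval (step q')) q.
have QP n : rect_wf (Q n) /\ (forall z, in_rect (Q n) z -> in_rect q z).
  elim: n => [|n IH]; first by split.
  have [w s _ _] := svalP (step (Q n)) IH; split=> //.
  by move=> z /s; apply: IH.2.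
have Qsub n z : in_rect (Q n.+1) z -> in_rect (Q n) z.
  by have [_ s _ _] := svalP (step (Q n)) (QP n); exact: s.
have Qsize n : rect_size (Q n) = rect_size q / 2 ^+ n.
  elim: n => [|n IH]; first by rewrite expr0 divr1.
  have [_ _ + _] := svalP (step (Q n)) (QP n); rewrite -/(Q n.+1) => ->.
  by rewrite IH exprSr invfM mulrA.
have Qlarge n : nc (rect_integral f q) / 4 ^+ n <= nc (rect_integral f (Q n)).
  elim: n => [|n IH]; first by rewrite expr0 divr1.
  have [_ _ _] := svalP (step (Q n)) (QP n); rewrite -/(Q n.+1); apply: le_trans.
  by rewrite exprSr invfM mulrA ler_wpM2r.
have Qmono m n z : in_rect (Q (n + m)%N) z -> in_rect (Q n) z.
  elim: m => [|m IH]; first by rewrite addn0.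
  by rewrite addnS => /Qsub/IH.
have ll q' : rect_wf q' -> in_rect q' (q'.1.1 +i* q'.2.1).
  by case=> ? ?; split; rewrite /= lexx.
have uu q' : rect_wf q' -> in_rect q' (q'.1.2 +i* q'.2.2).
  by case=> ? ?; split; rewrite /= lexx andbT.
have lu m n : (Q m).1.1 <= (Q n).1.2 /\ (Q m).2.1 <= (Q n).2.2.
  have /ll := (QP (m + n)%N).1; set z := _ +i* _ => hz.
  have [/andP[h1 _] /andP[h2 _]] := Qmono _ _ _ hz.
  move: hz; rewrite addnC => /Qmono[/andP[_ h3] /andP[_ h4]].
  by split; [exact: le_trans h1 h3|exact: le_trans h2 h4].
(* By [lu] every lower bound is below every upper bound, so the suprema of the lower bounds give a
   point common to all the rectangles. *)
pose x := sup (range (fun n => (Q n).1.1)); pose y := sup (range (fun n => (Q n).2.1)).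
have pQ n : in_rect (Q n) (x +i* y).
  split; apply/andP; split => /=.
  - apply: ub_le_sup; last by exists n.
    by exists (Q 0).1.2 => _ [m _ <-]; exact: (lu m 0%N).1.
  - apply: ge_sup; first by exists (Q 0).1.1, 0%N.
    by move=> _ [m _ <-]; exact: (lu m n).1.
  - apply: ub_le_sup; last by exists n.
    by exists (Q 0).2.2 => _ [m _ <-]; exact: (lu m 0%N).2.
  - apply: ge_sup; first by exists (Q 0).2.1, 0%N.
    by move=> _ [m _ <-]; exact: (lu m n).2.
set p : Cplx R := x +i* y in pQ.
have [k /cderP dk] := df p ((QP 0%N).2 _ (pQ 0%N)).
pose eta := nc (rect_integral f q); pose S := rect_size q.
have eta0 : 0 < eta by rewrite nc_gt0.
have S0 : 0 <= S by case: wq => ? ?; rewrite /S /rect_size; lra.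
(* The n-th integral will be at most [4 * S ^+ 2 * e / 4 ^+ n], which has to stay below
   [eta / 4 ^+ n]; the added 1 covers [S = 0]. *)
pose e := eta / (4 * S ^+ 2 + 1).
have D0 : 0 < 4 * S ^+ 2 + 1 by rewrite ltr_wpDl// mulr_ge0// sqr_ge0.
have e0 : 0 < e by rewrite divr_gt0.
have /near_ncP[r r0 near_p] := dk _ e0.
have [n Sn] : exists n, S / 2 ^+ n < r.
  exists (Num.bound (S / r)).
  have := @upper_nthrootP _ (S / r) _ (leqnn _).
  by rewrite ltr_pdivrMr// ltr_pdivrMr ?exprn_gt0// mulrC.
(* The affine part of [f] at [p] has a polynomial primitive, so only the remainder of
   differentiability contributes to the integral. *)
pose g (z : Cplx R) := f p + k * (z - p).
have cg z : ccont g z.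
  apply: ccontD; first exact: ccont_cst.
  by apply: ccontM; [exact: ccont_cst|apply: ccontB; [exact: ccont_id|exact: ccont_cst]].
have Eg : rect_integral g (Q n) = 0.
  apply: (@rect_integral_primitive _ (fun z => f p * z + k / 2 * ((z - p) * (z - p)))) => //.
  move=> z _; have d1 := cderB (cder_id z) (cder_cst p z).
  have d2 := cderD (cderZ (f p) (cder_id z)) (cderZ (k / 2) (cderM d1 d1)).
  by apply: cder_eq d2 _; rewrite /g; field.
have cfn z : in_rect (Q n) z -> ccont f z by move=> /(QP n).2; exact: cf.
have := Qlarge n; apply/negP; rewrite -ltNge.
have -> : rect_integral f (Q n) = rect_integral (fun z => f z - g z) (Q n).
  by rewrite (rect_integralB (QP n).1 cfn (fun z _ => cg z)) Eg subr0.
apply: le_lt_trans (@rect_integral_le _ _ (e * (S / 2 ^+ n)) (QP n).1 _ _) _.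
- by move=> z zQ; apply: ccontB => //; exact: cfn.
- move=> z zQ.
  have zp : nc (z - p) <= S / 2 ^+ n.
    rewrite -Qsize; apply: le_trans (nc_le_ReIm _) _.
    have [/andP[? ?] /andP[? ?]] := zQ; have [/andP[? ?] /andP[? ?]] := pQ n.
    rewrite RecB ImcB /rect_size; apply: lerD; rewrite ler_norml; apply/andP; split; lra.
  have /near_p : nc (z - p) < r by exact: le_lt_trans zp Sn.
  rewrite /g opprD addrA => /le_trans; apply.
  by rewrite ler_wpM2l// ltW.
- rewrite -/(rect_size _) Qsize -/S -/eta.
  rewrite (_ : 4 * _ * _ = 4 * S ^+ 2 * e / 4 ^+ n); last first.
    have -> : 4 ^+ n = 2 ^+ n * 2 ^+ n :> R by rewrite -exprMn -natrM.
    by field; rewrite expf_neq0.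
  rewrite ltr_pM2r ?invr_gt0 ?exprn_gt0// /e mulrCA gtr_pMr// ltr_pdivrMr// mul1r ltrDl//.
Qed.

End goursat.

(** * Integration on discs and the reproducing formula *)

Section primitive.
Context {R : realType}.
Implicit Types (f : Cplx R -> Cplx R) (g : R -> R[i]) (a b c d x y u v : R).

(** The estimate that differentiates an indefinite integral at [x], for increments of either sign;
    [key] is the ordered case. *)
Lemma cint_incr g a b x u (k : R[i]) (e : R) : a <= x <= b -> a <= u <= b ->
  (forall s, a <= s <= b -> rcont g s) ->
  (forall s, `|s - x| <= `|u - x| -> nc (g s - k) <= e) ->
  nc (cint a u g - cint a x g - k * (u - x)%:C) <= 2 * e * `|u - x|.
Proof.
move=> xab uab cg ge.
have key y v : a <= y <= b -> a <= v <= b -> y <= v ->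
    (forall s, y <= s <= v -> nc (g s - k) <= e) ->
    nc (cint a v g - cint a y g - k * (v - y)%:C) <= 2 * e * (v - y).
  move=> /andP[ay yb] /andP[av vb] yv h.
  have cyv s : y <= s <= v -> rcont g s.
    by move=> /andP[? ?]; apply: cg; rewrite (le_trans ay)//= (le_trans _ vb).
  rewrite (@cint_cat _ g a y v) ?ay//; last first.
    by move=> s /andP[? ?]; apply: cg; apply/andP; split; lra.
  rewrite [cint a y g + _]addrC addrK.
  have -> : k * (v - y)%:C = cint y v (fun=> k).
    have cL (s : R) : cder (fun z : Cplx R => k * z) (s +i* 0) k.
      by have := cderZ k (cder_id (s +i* 0)); rewrite mulr1.
    rewrite (@cint_rder _ _ (fun s => k * (s +i* 0)))//.
    - by rewrite -mulrBr rmorphB.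
    - by move=> s _; exact: (cder_hline (cL s)).
    - by move=> s _; exact: rcont_cst.
  rewrite -mulN1r -(cintZ _ (fun s _ => rcont_cst k s)).
  rewrite -(cintD cyv (fun s _ => rcontM (rcont_cst (-1) s) (rcont_cst k s))).
  apply: cint_le => // s ys; last by rewrite mulN1r h.
  apply: (rcontD (cyv s ys)).
  exact: (rcontM (rcont_cst (-1) s) (rcont_cst k s)).
have [xu|ux] := leP x u.
  rewrite (ger0_norm (_ : 0 <= u - x)) ?subr_ge0//; apply: key => // s /andP[? ?].
  by apply: ge; rewrite !ger0_norm; lra.
rewrite (ltr0_norm (_ : u - x < 0)) ?subr_lt0// opprB.
rewrite -ncN (_ : - _ = cint a x g - cint a u g - k * (x - u)%:C); last first.
  by rewrite !rmorphB /=; ring.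
apply: key => //; first exact: ltW.
by move=> s /andP[? ?]; apply: ge; rewrite !ler0_norm; lra.
Qed.

Lemma rect_primitive f a b c d :
  (forall z, in_rect (a, b, (c, d)) z -> exists k, cder f z k) ->
  exists F, forall z, a < complex.Re z < b -> c < complex.Im z < d -> cder F z (f z).
Proof.
move=> df.
have cf z : in_rect (a, b, (c, d)) z -> ccont f z by move=> /df[k /cder_continuous].
pose F (z : Cplx R) : Cplx R := cint a (complex.Re z) (fun x => f (x +i* c)) +
   'i * cint c (complex.Im z) (fun y => f (complex.Re z +i* y)).
exists F => -[x y] /= /andP[ax xb] /andP[cy yd].
have ab : a <= b by rewrite ltW// (lt_trans ax).
have cd : c <= d by rewrite ltW// (lt_trans cy).
(* [F] integrates along the bottom, then upwards. By Goursat's theorem, going up the left side and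
   then across gives the same value. *)
have FE (u v : R) : a <= u <= b -> c <= v <= d -> F (u +i* v) =
    cint a u (fun x => f (x +i* v)) + 'i * cint c v (fun y => f (a +i* y)).
  move=> /andP[au ub] /andP[cv vd].
  have := @rect_integral_eq0 _ f (a, u, (c, v)) (conj au cv).
  rewrite /rect_integral /F /= => H; apply/eqP; rewrite -subr_eq0 opprD addrA; apply/eqP.
  apply: H => z [/= /andP[? ?] /andP[? ?]]; apply: df; split => /=; apply/andP; split; lra.
apply/cderP => e e0.
have e4 : 0 < e / 4 by rewrite divr_gt0.
have xy : in_rect (a, b, (c, d)) (x +i* y) by split; rewrite /= !ltW.
have /near_ncP[r r0 fr] := (ccontP f (x +i* y)).1 (cf _ xy) _ e4.
pose r' := Num.min (r / 2) (Num.min (Num.min (x - a) (b - x)) (Num.min (y - c) (d - y))).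
have r'0 : 0 < r' by rewrite !lt_min !subr_gt0 divr_gt0// ax xb cy yd.
apply/near_ncP; exists r' => // -[u v] uv.
have hu : `|u - x| <= nc ((u +i* v) - (x +i* y)).
  by have := nc_Re ((u +i* v) - (x +i* y)).
have hv : `|v - y| <= nc ((u +i* v) - (x +i* y)).
  by have := nc_Im ((u +i* v) - (x +i* y)).
set D := nc _ in uv hu hv.
move: uv; rewrite !lt_min => /and3P[Dr /andP[D1 D2] /andP[D3 D4]].
have uab : a <= u <= b.
  have := le_lt_trans hu D1; have := le_lt_trans hu D2; rewrite !ltr_norml.
  by move=> /andP[? ?] /andP[? ?]; apply/andP; split; lra.
have vcd : c <= v <= d.
  have := le_lt_trans hv D3; have := le_lt_trans hv D4; rewrite !ltr_norml.
  by move=> /andP[? ?] /andP[? ?]; apply/andP; split; lra.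
have xab : a <= x <= b by rewrite !ltW.
have ycd : c <= y <= d by rewrite !ltW.
have fz (s t : R) : `|s - x| <= D -> `|t - y| <= D -> nc (f (s +i* t) - f (x +i* y)) <= e / 4.
  move=> sx ty; apply/ltW/fr; apply: le_lt_trans (nc_le_ReIm _) _ => /=.
  apply: le_lt_trans (lerD sx ty) _; lra.
have A1 := @cint_incr (fun s => f (s +i* v)) a b x u (f (x +i* y)) (e / 4) xab uab.
have A2 := @cint_incr (fun t => f (x +i* t)) c d y v (f (x +i* y)) (e / 4) ycd vcd.
have {}A1 := A1 (fun s sab => ccont_hline (cf (s +i* v) (conj sab vcd)))
  (fun s hs => fz s v (le_trans hs hu) hv).
have {}A2 := A2 (fun s scd => ccont_vline (cf (x +i* s) (conj xab scd))).
have x0 : `|x - x| <= D by rewrite subrr normr0 (le_trans _ hu).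
have {}A2 := A2 (fun s hs => fz x s x0 (le_trans hs hv)).
have -> : F (u +i* v) - F (x +i* y) - f (x +i* y) * ((u +i* v) - (x +i* y)) =
  (cint a u (fun s => f (s +i* v)) - cint a x (fun s => f (s +i* v)) - f (x +i* y) * (u - x)%:C)
  + 'i * (cint c v (fun t => f (x +i* t)) - cint c y (fun t => f (x +i* t)) - f (x +i* y) * (v - y)%:C).
  (* The vertical increment is read from the definition of [F], the horizontal one from [FE]; each
     is then an integral over a short segment. *)
  have -> : F (u +i* v) - F (x +i* y) = (F (u +i* v) - F (x +i* v)) + (F (x +i* v) - F (x +i* y)) by ring.
  have -> : F (u +i* v) - F (x +i* v) =
      cint a u (fun s => f (s +i* v)) - cint a x (fun s => f (s +i* v)).
    by rewrite (FE u v)// (FE x v)//; ring.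
  have -> : F (x +i* v) - F (x +i* y) = 'i * (cint c v (fun t => f (x +i* t)) -
      cint c y (fun t => f (x +i* t))) by rewrite /F /=; ring.
  have -> : (u +i* v) - (x +i* y) = (u - x)%:C + 'i * (v - y)%:C :> R[i] by simpc.
  ring.
apply: le_trans (ncD _ _) _; rewrite [X in _ + X]ncM nc_i mul1r.
apply: le_trans (lerD A1 A2) _.
have eD : e / 4 * `|u - x| <= e / 4 * D by rewrite ler_wpM2l// ltW.
have eD' : e / 4 * `|v - y| <= e / 4 * D by rewrite ler_wpM2l// ltW.
rewrite -/D.
lra.
Qed.

End primitive.

Section cintegral_theory.
Context {R : realType}.
Implicit Types (D : set (R * R)) (h G : R * R -> R) (W : set (Cplx R)) (f g u v : Cplx R -> Cplx R) (a z w : Cplx R) (r : R).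
Local Notation area := (@lebesgue_measure R \x @lebesgue_measure R)%E.

Definition cdisc a r : set (Cplx R) := [set w | nc (w - a) < r].

Lemma cdisc_open a r : open (cdisc a r).
Proof.
suff -> : cdisc a r = ball a (r%:C) by exact: ball_open.
by apply/seteqP; split=> w; rewrite /cdisc /ball/= normE ltcR ncBC.
Qed.

Lemma ccont_plane g (p : R * R) : ccont g (plane p) ->
  forall e : R, 0 < e -> \forall q \near p, nc (g (plane q) - g (plane p)) < e.
Proof.
move=> cg; apply: (@cvg_ncP R _ (nbhs p) (nbhs_filter p) (g \o plane) (g (plane p))).1.
by apply: continuous_comp; [exact: plane_continuous|exact: cg].
Qed.

Lemma ccont_nc_plane g (p : R * R) : ccont g (plane p) ->
  {for p, continuous (fun q : R * R => nc (g (plane q)))}.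
Proof.
move=> cg; apply/(@cvgrPdist_lt _ _ _ (nbhs p)) => e e0.
apply: filterS (ccont_plane cg e0) => q qp; rewrite ltr_norml.
have := ncB_ge (g (plane p)) (g (plane q)); have := ncB_ge (g (plane q)) (g (plane p)).
by rewrite (ncBC (g (plane p))) => ? ?; apply/andP; split; move: qp => /= ?; lra.
Qed.

Lemma plane_cdiscE a r : 0 < r -> plane @^-1` cdisc a r =
  [set p | (p.1 - complex.Re a) ^+ 2 + (p.2 - complex.Im a) ^+ 2 < r ^+ 2].
Proof.
move=> r0; apply/seteqP; split=> p; rewrite /cdisc /=.
  rewrite -(@ltr_pXn2r _ 2)// ?nnegrE ?nc_ge0 ?(ltW r0)// nc_sqr.
  by rewrite RecB ImcB.
by move=> h; rewrite -(@ltr_pXn2r _ 2)// ?nnegrE ?nc_ge0 ?(ltW r0)// nc_sqr RecB ImcB.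
Qed.

Lemma area_cdisc_fin a r : (area (plane @^-1` cdisc a r) < +oo)%E.
Proof.
have mD := measurable_plane (@cdisc_open a r).
have mB (t : R) : measurable (ball t r) by exact: open_measurable (ball_open _ _).
apply: (@le_lt_trans _ _ (area (ball (complex.Re a) r `*` ball (complex.Im a) r))).
  apply: le_measure; rewrite ?inE//; first by apply: measurableX; exact: mB.
  move=> [x y] /= h; split => /=; rewrite /ball/= distrC.
    by have := nc_Re (plane (x, y) - a); rewrite RecB => /le_lt_trans; apply.
  by have := nc_Im (plane (x, y) - a); rewrite ImcB => /le_lt_trans; apply.
rewrite product_measure1E; [|exact: mB..]; have [r0|r0] := leP 0 r.
  have lb (t : R) : lebesgue_measure (ball t r) = (r *+ 2)%:E.
    exact: lebesgue_measure_ball.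
  by move: (lb (complex.Re a)) (lb (complex.Im a)) => /= -> ->; rewrite -EFinM ltry.
have -> : ball (complex.Re a) r = set0 by apply/ball0; exact: ltW.
by rewrite measure0 mul0e.
Qed.

Lemma ccont_measurable W g : open W -> (forall w, W w -> ccont g w) ->
  measurable_fun (plane @^-1` W) (fun p => complex.Re (g (plane p))) /\
  measurable_fun (plane @^-1` W) (fun p => complex.Im (g (plane p))).
Proof.
move=> oW cg; split.
  apply: open_continuous_measurable_plane; first exact: open_plane.
  move=> p /set_mem Wp.
  apply: (@continuous_comp _ _ _ (g \o plane)); last exact: Re_continuous.
  by apply: continuous_comp; [exact: plane_continuous|exact: cg].
apply: open_continuous_measurable_plane; first exact: open_plane.
move=> p /set_mem Wp.
apply: (@continuous_comp _ _ _ (g \o plane)); last exact: Im_continuous.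
by apply: continuous_comp; [exact: plane_continuous|exact: cg].
Qed.

Lemma ccont_measurable_nc W g : open W -> (forall w, W w -> ccont g w) ->
  measurable_fun (plane @^-1` W) (fun p => nc (g (plane p))).
Proof.
move=> oW cg; apply: open_continuous_measurable_plane; first exact: open_plane.
by move=> p /set_mem Wp; apply: ccont_nc_plane; exact: cg.
Qed.

Definition aintegrable (D : set (R * R)) (h : R * R -> R) : Prop :=
  area.-integrable D (EFin \o h).

Definition aint (D : set (R * R)) (h : R * R -> R) : R :=
  (\int[area]_(p in D) h p)%R.

Lemma eq_aintegrable D h1 h2 : measurable D -> (forall p, D p -> h1 p = h2 p) ->
  aintegrable D h1 -> aintegrable D h2.
Proof.
move=> mD h12; apply: eq_integrable => // p /set_mem Dp /=.
by rewrite h12.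
Qed.

Lemma eq_aint D h1 h2 : (forall p, D p -> h1 p = h2 p) -> aint D h1 = aint D h2.
Proof. by move=> h12; apply: eq_Rintegral => p /set_mem /h12. Qed.

Lemma aintegrableD D h1 h2 : measurable D -> aintegrable D h1 -> aintegrable D h2 ->
  aintegrable D (fun p => h1 p + h2 p).
Proof. by move=> mD i1 i2; exact: (@integrableD _ _ _ area _ mD _ _ i1 i2). Qed.

Lemma aintegrableZ D (k : R) h : measurable D -> aintegrable D h ->
  aintegrable D (fun p => k * h p).
Proof. by move=> mD ih; exact: (@integrableZl _ _ _ area _ mD k _ ih). Qed.

Lemma aintegrable_norm D h : measurable D -> aintegrable D h ->
  aintegrable D (fun p => `|h p|).
Proof. by move=> mD ih; exact: (integrable_norm ih). Qed.

Lemma aintegrable_le D (h G : R * R -> R) : measurable D -> measurable_fun D h -> aintegrable D G ->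
  (forall p, D p -> `|h p| <= G p) -> aintegrable D h.
Proof.
move=> mD mh iG hG; apply: (@le_integrable _ _ _ area _ mD _ (EFin \o G)) => //.
  exact/measurable_EFinP.
by move=> p Dp; rewrite /= lee_fin (le_trans (hG _ Dp))// ler_norm.
Qed.

Lemma aint_le D h G : measurable D -> aintegrable D h -> aintegrable D G ->
  (forall p, D p -> h p <= G p) -> aint D h <= aint D G.
Proof. by move=> mD ih iG hG; apply: le_Rintegral. Qed.

Lemma aint_normr_le D h : measurable D -> aintegrable D h ->
  `|aint D h| <= aint D (fun p => `|h p|).
Proof. by move=> mD ih; exact: le_normr_Rintegral. Qed.

Lemma aintD D h1 h2 : measurable D -> aintegrable D h1 -> aintegrable D h2 ->
  aint D (fun p => h1 p + h2 p) = aint D h1 + aint D h2.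
Proof. by move=> mD i1 i2; exact: RintegralD. Qed.

Lemma aintZ D (k : R) h : measurable D -> aintegrable D h ->
  aint D (fun p => k * h p) = k * aint D h.
Proof. by move=> mD ih; exact: RintegralZl. Qed.

Lemma CintegrableP W g : Cintegrable W g <->
  aintegrable (plane @^-1` W) (fun p => complex.Re (g (plane p))) /\
  aintegrable (plane @^-1` W) (fun p => complex.Im (g (plane p))).
Proof. by []. Qed.

Lemma Cintegrable_le W g (G : R * R -> R) : open W -> (forall w, W w -> ccont g w) ->
  aintegrable (plane @^-1` W) G ->
  (forall p, W (plane p) -> nc (g (plane p)) <= G p) -> Cintegrable W g.
Proof.
move=> oW /(ccont_measurable oW)[mR mI] iG gG; have mW := measurable_plane oW.
apply/CintegrableP; split; apply: (aintegrable_le mW _ iG) => // p Wp.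
  by rewrite (le_trans (nc_Re _))// gG.
by rewrite (le_trans (nc_Im _))// gG.
Qed.

Lemma integrable_nc W g : open W -> (forall w, W w -> ccont g w) -> Cintegrable W g ->
  aintegrable (plane @^-1` W) (fun p => nc (g (plane p))).
Proof.
move=> oW cg /CintegrableP[iR iI]; have mW := measurable_plane oW.
apply: (aintegrable_le mW (ccont_measurable_nc oW cg)
  (aintegrableD mW (aintegrable_norm mW iR) (aintegrable_norm mW iI))) => p Wp.
by rewrite ger0_norm ?nc_ge0// nc_le_ReIm.
Qed.

Lemma integrable_cst_fin (D : set (R * R)) (K : R) : measurable D -> (area D < +oo)%E ->
  aintegrable D (fun=> K).
Proof.
move=> mD fD; apply/integrableP; split; first exact: measurable_cst.
by rewrite integral_cst//= lte_mul_pinfty.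
Qed.

Lemma Cintegrable_bounded W g (M : R) : open W -> (area (plane @^-1` W) < +oo)%E ->
  (forall w, W w -> ccont g w) -> (forall w, W w -> nc (g w) <= M) -> Cintegrable W g.
Proof.
move=> oW fW cg gM; apply: (@Cintegrable_le _ _ (fun=> M)) => //; last by move=> p /gM.
by apply: integrable_cst_fin => //; exact: measurable_plane.
Qed.

Lemma eq_Cintegral W g1 g2 : (forall w, W w -> g1 w = g2 w) ->
  Cintegral W g1 = Cintegral W g2.
Proof.
by move=> h; rewrite /Cintegral; congr (_ +i* _); apply: eq_Rintegral => p;
  rewrite inE/= => /h ->.
Qed.

Lemma Cintegral0 W : Cintegral W (fun=> 0) = 0.
Proof.
by rewrite /Cintegral /Rintegral integral0.
Qed.

Lemma Cintegrable0 W : open W -> Cintegrable W (fun=> 0).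
Proof.
by move=> oW; split; apply: integrable0; exact: measurable_plane.
Qed.

Lemma CintegralD W g1 g2 : open W -> Cintegrable W g1 -> Cintegrable W g2 ->
  Cintegral W (fun w => g1 w + g2 w) = Cintegral W g1 + Cintegral W g2.
Proof.
move=> oW i1 i2; rewrite -[in RHS](mul1r (Cintegral W g1)) -Cintegral_lin//.
by apply: eq_Cintegral => w _; rewrite mul1r.
Qed.

Lemma CintegralZ W (k : Cplx R) g : open W -> Cintegrable W g ->
  Cintegral W (fun w => k * g w) = k * Cintegral W g.
Proof.
move=> oW ig; rewrite -[RHS]addr0 -(Cintegral0 W) -Cintegral_lin//; last exact: Cintegrable0.
by apply: eq_Cintegral => w _; rewrite addr0.
Qed.

Lemma CintegrableZ W (k : Cplx R) g : open W -> Cintegrable W g ->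
  Cintegrable W (fun w => k * g w).
Proof.
move=> oW /CintegrableP[iR iI]; have mW := measurable_plane oW; case: k => k1 k2.
apply/CintegrableP; split.
  apply: eq_aintegrable (aintegrableD mW (aintegrableZ k1 mW iR) (aintegrableZ (- k2) mW iI)) => //.
  by move=> p _; rewrite cReM /= mulNr.
apply: eq_aintegrable (aintegrableD mW (aintegrableZ k1 mW iI) (aintegrableZ k2 mW iR)) => //.
by move=> p _; rewrite cImM /=.
Qed.

Lemma CintegrableD W g1 g2 : open W -> Cintegrable W g1 -> Cintegrable W g2 ->
  Cintegrable W (fun w => g1 w + g2 w).
Proof.
move=> oW /CintegrableP[r1 i1] /CintegrableP[r2 i2]; have mW := measurable_plane oW.
apply/CintegrableP; split.
  by apply: eq_aintegrable (aintegrableD mW r1 r2) => // p _; rewrite cReD.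
by apply: eq_aintegrable (aintegrableD mW i1 i2) => // p _; rewrite cImD.
Qed.

Lemma CintegrableB W g1 g2 : open W -> Cintegrable W g1 -> Cintegrable W g2 ->
  Cintegrable W (fun w => g1 w - g2 w).
Proof.
move=> oW i1 i2; have := CintegrableD oW i1 (CintegrableZ (-1) oW i2).
by under eq_fun do rewrite mulN1r.
Qed.

Lemma CintegralB W g1 g2 : open W -> Cintegrable W g1 -> Cintegrable W g2 ->
  Cintegral W (fun w => g1 w - g2 w) = Cintegral W g1 - Cintegral W g2.
Proof.
move=> oW i1 i2; rewrite -mulN1r -CintegralZ// -CintegralD//; last exact: CintegrableZ.
by apply: eq_Cintegral => w _; rewrite mulN1r.
Qed.

Lemma Cintegral_le W g (G : R * R -> R) : open W -> Cintegrable W g ->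
  aintegrable (plane @^-1` W) G ->
  (forall p, W (plane p) -> nc (g (plane p)) <= G p) ->
  nc (Cintegral W g) <= 2 * aint (plane @^-1` W) G.
Proof.
move=> oW /CintegrableP[iR iI] iG gG; have mW := measurable_plane oW.
apply: le_trans (nc_le_ReIm _) _; rewrite mulr_natl mulr2n; apply: lerD.
  apply: le_trans (aint_normr_le mW iR) _; apply: (aint_le mW (aintegrable_norm mW iR) iG).
  by move=> p /gG; apply: le_trans; exact: nc_Re.
apply: le_trans (aint_normr_le mW iI) _; apply: (aint_le mW (aintegrable_norm mW iI) iG).
by move=> p /gG; apply: le_trans; exact: nc_Im.
Qed.

Lemma closed_disc_bounded a r g : (forall w, nc (w - a) <= r -> ccont g w) ->
  exists M, forall w, nc (w - a) <= r -> nc (g w) <= M.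
Proof.
move=> cg; pose ff (p : R * R) : R := nc (plane p - a).
have cff : continuous ff.
  move=> p; apply: (@ccont_nc_plane (fun w => w - a)).
  by apply: ccontB; [exact: ccont_id|exact: ccont_cst].
pose K := ff @^-1` [set x | x <= r].
have cK : compact K.
  apply: (@subclosed_compact _ _ (`[complex.Re a - r, complex.Re a + r]%classic `*`
     `[complex.Im a - r, complex.Im a + r]%classic)).
  - by apply: preimage_closed; [move=> p _; exact: cff|exact: closed_le].
  - by apply: compact_setX; exact: segment_compact.
  - move=> [x y]; rewrite /K /ff /= => h; rewrite !in_itv/=.
    have := le_trans (nc_Re _) h; have := le_trans (nc_Im _) h.
    by rewrite RecB ImcB /= !ler_norml => /andP[? ?] /andP[? ?]; split; apply/andP; split; lra.
pose gg (p : R * R) : R := nc (g (plane p)).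
have cgg : {within K, continuous gg}.
  apply: continuous_in_subspaceT => p; rewrite inE => Kp.
  by apply: ccont_nc_plane; exact: cg.
have [M [_ MP]] := compact_bounded (continuous_compact cgg cK).
exists (M + 1) => -[x y] h.
have /MP : M < M + 1 by rewrite ltrDl.
move=> /(_ (gg (x, y))) /=; rewrite ger0_norm ?nc_ge0//; apply.
by exists (x, y).
Qed.

Lemma cdisc_Cintegrable a r g : (forall w, nc (w - a) <= r -> ccont g w) ->
  Cintegrable (cdisc a r) g.
Proof.
move=> cg; have [M gM] := closed_disc_bounded cg.
apply: (@Cintegrable_bounded _ _ M).
- exact: cdisc_open.
- exact: area_cdisc_fin.
- by move=> w /ltW; exact: cg.
- by move=> w /ltW; exact: gM.
Qed.

End cintegral_theory.

(** * Green's formula on a disc, chord by chord *)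

Section stokes.
Context {R : realType}.
Implicit Types (f g q u v : Cplx R -> Cplx R) (a z w : Cplx R) (r : R).
Local Notation area := (@lebesgue_measure R \x @lebesgue_measure R)%E.
Local Notation mu := (@lebesgue_measure R).

(** On a chord at signed distance [de] from the centre the integral is the difference of the values
    of [K] at the endpoints, which lie on the circle, where [K] vanishes. When [r ^+ 2 <= de ^+ 2]
    the open chord is empty. *)
Lemma chord_integral (k K : R -> R) (al de r : R) : 0 < r ->
  (forall x, (x - al) ^+ 2 + de ^+ 2 <= r ^+ 2 -> is_derive x 1 K (k x)) ->
  (forall x, (x - al) ^+ 2 + de ^+ 2 <= r ^+ 2 -> {for x, continuous k}) ->
  (forall x, (x - al) ^+ 2 + de ^+ 2 = r ^+ 2 -> K x = 0) ->
  (\int[mu]_x (((k \_ [set x | ((x - al) ^+ 2 + de ^+ 2 < r ^+ 2)%R]) x)%:E) = 0)%E.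
Proof.
move=> r0 dK ck K0; set A := [set x | _].
have [s0|s0] := leP (r ^+ 2 - de ^+ 2) 0.
  have -> : A = set0.
    apply/seteqP; split=> // x /=; have := sqr_ge0 (x - al); rewrite /A/=; lra.
  by apply: integral0_eq => x _; rewrite patch_set0.
pose s := Num.sqrt (r ^+ 2 - de ^+ 2).
have s1 : 0 < s by rewrite sqrtr_gt0.
have ss : s ^+ 2 = r ^+ 2 - de ^+ 2 by rewrite sqr_sqrtr// ltW.
have sE x : ((x - al) ^+ 2 + de ^+ 2 < r ^+ 2) = ((x - al) ^+ 2 < s ^+ 2).
  by rewrite ss ltrBrDr.
have AE : A = `]al - s, al + s[%classic.
  apply/seteqP; split=> x; rewrite /A/= in_itv/= sE.
    rewrite -real_normK ?num_real// ltr_pXn2r ?nnegrE ?(ltW s1)//.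
    by rewrite ltr_norml => /andP[? ?]; apply/andP; split; lra.
  move=> /andP[? ?]; rewrite -real_normK ?num_real// ltr_pXn2r ?nnegrE ?(ltW s1)//.
  by rewrite ltr_norml; apply/andP; split; lra.
have inA x : al - s <= x <= al + s -> (x - al) ^+ 2 + de ^+ 2 <= r ^+ 2.
  move=> /andP[? ?]; rewrite -lerBrDr -ss.
  rewrite -real_normK ?num_real// ler_pXn2r ?nnegrE ?(ltW s1)//.
  by rewrite ler_norml; apply/andP; split; lra.
have ik : mu.-integrable `[al - s, al + s] (EFin \o k).
  by apply: continuous_itv_integrable => x /inA; exact: ck.
have ik1 : mu.-integrable `]al - s, al + s] (EFin \o k).
  by apply: integrableS ik => //; apply: subset_itv; rewrite bnd_simp.
have ik2 : mu.-integrable `]al - s, al + s[ (EFin \o k).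
  by apply: integrableS ik => //; apply: subset_itv; rewrite bnd_simp.
have bdry (t : R) : t ^+ 2 = s ^+ 2 -> K (al + t) = 0.
  by move=> ts; apply: K0; rewrite (addrC al) addrK ts ss subrK.
have I0 : (\int[mu]_(x in `[(al - s), (al + s)]) k x)%R = 0.
  transitivity (K (al + s) - K (al - s)); last by rewrite !bdry ?sqrrN// subrr.
  apply: integral_derive; first by lra.
    by move=> x /inA; exact: dK.
  by move=> x /inA; exact: ck.
transitivity (\int[mu]_(x in A) ((k x)%:E))%E.
  by rewrite [RHS]integral_mkcond restrict_EFin.
rewrite AE -[LHS]fineK; last exact: integrable_fin_num.
rewrite -[fine _]/(\int[mu]_(x in `](al - s), (al + s)[) k x)%R.
by rewrite Rintegral_itv_bndo_bndc// Rintegral_itv_obnd_cbnd// I0.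
Qed.

Lemma aint_fubini2 (D : set (R * R)) (h : R * R -> R) : measurable D -> aintegrable D h ->
  (forall y, (\int[mu]_x (((h \_ D) (x, y))%:E) = 0)%E) -> aint D h = 0.
Proof.
move=> mD ih H; rewrite /aint /Rintegral integral_mkcond restrict_EFin.
have ih' : area.-integrable setT (EFin \o (h \_ D)).
  by rewrite -restrict_EFin; exact: (@integrable_mkcond _ _ _ area D (EFin \o h) mD).1 ih.
rewrite -(integral21_prod_meas1 ih') /fubini_G.
under eq_integral do rewrite H.
by rewrite integral0.
Qed.

Lemma aint_fubini1 (D : set (R * R)) (h : R * R -> R) : measurable D -> aintegrable D h ->
  (forall x, (\int[mu]_y (((h \_ D) (x, y))%:E) = 0)%E) -> aint D h = 0.
Proof.
move=> mD ih H; rewrite /aint /Rintegral integral_mkcond restrict_EFin.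
have ih' : area.-integrable setT (EFin \o (h \_ D)).
  by rewrite -restrict_EFin; exact: (@integrable_mkcond _ _ _ area D (EFin \o h) mD).1 ih.
rewrite -(integral12_prod_meas1 ih') /fubini_F.
under eq_integral do rewrite H.
by rewrite integral0.
Qed.

Lemma stokes_x (h k : R * R -> R) a r : 0 < r ->
  (forall x y, (x - complex.Re a) ^+ 2 + (y - complex.Im a) ^+ 2 <= r ^+ 2 ->
     is_derive x 1 (fun s => h (s, y)) (k (x, y))) ->
  (forall x y, (x - complex.Re a) ^+ 2 + (y - complex.Im a) ^+ 2 <= r ^+ 2 ->
     {for x, continuous (fun s => k (s, y))}) ->
  (forall x y, (x - complex.Re a) ^+ 2 + (y - complex.Im a) ^+ 2 = r ^+ 2 -> h (x, y) = 0) ->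
  aintegrable (plane @^-1` cdisc a r) k -> aint (plane @^-1` cdisc a r) k = 0.
Proof.
move=> r0 dh ck h0 ik; have mD := measurable_plane (@cdisc_open R a r).
apply: aint_fubini2 => // y.
rewrite -[RHS](@chord_integral (fun x => k (x, y)) (fun x => h (x, y))
  (complex.Re a) (y - complex.Im a) r r0).
- apply: eq_integral => x _; congr (_%:E); rewrite !patchE; congr (if _ then _ else _).
  by apply/idP/idP; rewrite !inE plane_cdiscE.
- by move=> x; exact: ck.
- by move=> x; exact: h0.
Qed.

Lemma stokes_y (h k : R * R -> R) a r : 0 < r ->
  (forall x y, (x - complex.Re a) ^+ 2 + (y - complex.Im a) ^+ 2 <= r ^+ 2 ->
     is_derive y 1 (fun s => h (x, s)) (k (x, y))) ->
  (forall x y, (x - complex.Re a) ^+ 2 + (y - complex.Im a) ^+ 2 <= r ^+ 2 ->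
     {for y, continuous (fun s => k (x, s))}) ->
  (forall x y, (x - complex.Re a) ^+ 2 + (y - complex.Im a) ^+ 2 = r ^+ 2 -> h (x, y) = 0) ->
  aintegrable (plane @^-1` cdisc a r) k -> aint (plane @^-1` cdisc a r) k = 0.
Proof.
move=> r0 dh ck h0 ik; have mD := measurable_plane (@cdisc_open R a r).
apply: aint_fubini1 => // x.
rewrite -[RHS](@chord_integral (fun y => k (x, y)) (fun y => h (x, y))
  (complex.Im a) (x - complex.Re a) r r0).
- apply: eq_integral => y _; congr (_%:E); rewrite !patchE; congr (if _ then _ else _).
  by apply/idP/idP; rewrite !inE plane_cdiscE//= addrC.
- by move=> y; rewrite addrC; exact: dh.
- by move=> y; rewrite addrC; exact: ck.
- by move=> y; rewrite addrC; exact: h0.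
Qed.

Lemma sqr_le_nc a r (x y : R) : 0 < r ->
  (x - complex.Re a) ^+ 2 + (y - complex.Im a) ^+ 2 <= r ^+ 2 -> nc ((x +i* y) - a) <= r.
Proof.
move=> r0 h; rewrite -ler_sqr ?nnegrE ?nc_ge0 ?(ltW r0)// nc_sqr.
by rewrite RecB ImcB.
Qed.

Lemma sqr_eq_nc a r (x y : R) : 0 < r ->
  (x - complex.Re a) ^+ 2 + (y - complex.Im a) ^+ 2 = r ^+ 2 -> nc ((x +i* y) - a) = r.
Proof.
move=> r0 h; apply/eqP; rewrite -(@eqrXn2 _ 2%N) ?nc_ge0 ?(ltW r0)// nc_sqr.
by rewrite RecB ImcB h.
Qed.

(* Green's formula: the integrand is the derivative of u1 conj(v1) + u2 conj(v2)
   with respect to conj(w), and this function vanishes on the circle. On chords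
   it is Fubini's theorem and the fundamental theorem of calculus. *)
Lemma stokes_conj u1 u2 v1 v2 u1' u2' v1' v2' a r : 0 < r ->
  (forall w, nc (w - a) <= r ->
    [/\ cder u1 w (u1' w), cder u2 w (u2' w), cder v1 w (v1' w) & cder v2 w (v2' w)]) ->
  (forall w, nc (w - a) <= r ->
    [/\ ccont u1' w, ccont u2' w, ccont v1' w & ccont v2' w]) ->
  (forall w, nc (w - a) = r -> u1 w * (v1 w)^* + u2 w * (v2 w)^* = 0) ->
  Cintegral (cdisc a r) (fun w => u1 w * (v1' w)^* + u2 w * (v2' w)^*) = 0.
Proof.
move=> r0 du cu u0; have oD := @cdisc_open R a r.
pose P w := u1 w * (v1 w)^* + u2 w * (v2 w)^*.
pose Px w := (u1' w * (v1 w)^* + u1 w * (v1' w)^*) + (u2' w * (v2 w)^* + u2 w * (v2' w)^*).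
pose Py w := (u1' w * 'i * (v1 w)^* + u1 w * (v1' w * 'i)^*) +
  (u2' w * 'i * (v2 w)^* + u2 w * (v2' w * 'i)^*).
have cuv w : nc (w - a) <= r -> [/\ ccont u1 w, ccont u2 w, ccont v1 w & ccont v2 w].
  by move=> /du[d1 d2 d3 d4]; split; [exact: cder_continuous d1|
    exact: cder_continuous d2|exact: cder_continuous d3|exact: cder_continuous d4].
have cPx w : nc (w - a) <= r -> ccont Px w.
  move=> wr; have [c1 c2 c3 c4] := cu w wr; have [b1 b2 b3 b4] := cuv w wr.
  exact: (ccontD (ccontD (ccontM c1 (ccontJ b3)) (ccontM b1 (ccontJ c3)))
    (ccontD (ccontM c2 (ccontJ b4)) (ccontM b2 (ccontJ c4)))).
have cPy w : nc (w - a) <= r -> ccont Py w.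
  move=> wr; have [c1 c2 c3 c4] := cu w wr; have [b1 b2 b3 b4] := cuv w wr.
  have ci : ccont (fun=> 'i) w by exact: ccont_cst.
  exact: (ccontD (ccontD (ccontM (ccontM c1 ci) (ccontJ b3)) (ccontM b1 (ccontJ (ccontM c3 ci))))
    (ccontD (ccontM (ccontM c2 ci) (ccontJ b4)) (ccontM b2 (ccontJ (ccontM c4 ci))))).
have iPx := cdisc_Cintegrable cPx; have iPy := cdisc_Cintegrable cPy.
have dPx x y : nc ((x +i* y) - a) <= r -> rder (fun s => P (s +i* y)) x (Px (x +i* y)).
  move=> /du[d1 d2 d3 d4].
  exact: (rderD (rderM (cder_hline d1) (rderJ (cder_hline d3))) (rderM (cder_hline d2) (rderJ (cder_hline d4)))).
have dPy x y : nc ((x +i* y) - a) <= r -> rder (fun s => P (x +i* s)) y (Py (x +i* y)).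
  move=> /du[d1 d2 d3 d4].
  exact: (rderD (rderM (cder_vline d1) (rderJ (cder_vline d3))) (rderM (cder_vline d2) (rderJ (cder_vline d4)))).
have Px0 : Cintegral (cdisc a r) Px = 0.
  have [iR iI] := (CintegrableP _ _).1 iPx.
  apply: complexP.
    apply: (@stokes_x (fun p => complex.Re (P (plane p))) (fun p => complex.Re (Px (plane p)))
      a r r0 _ _ _ iR) => x y h.
    - by have [] := dPx x y (sqr_le_nc r0 h).
    - by have [] := ccont_hline (cPx (x +i* y) (sqr_le_nc r0 h)).
    - by rewrite /P u0// (sqr_eq_nc r0 h).
  apply: (@stokes_x (fun p => complex.Im (P (plane p))) (fun p => complex.Im (Px (plane p)))
      a r r0 _ _ _ iI) => x y h.
  - by have [] := dPx x y (sqr_le_nc r0 h).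
  - by have [] := ccont_hline (cPx (x +i* y) (sqr_le_nc r0 h)).
  - by rewrite /P u0// (sqr_eq_nc r0 h).
have Py0 : Cintegral (cdisc a r) Py = 0.
  have [iR iI] := (CintegrableP _ _).1 iPy.
  apply: complexP.
    apply: (@stokes_y (fun p => complex.Re (P (plane p))) (fun p => complex.Re (Py (plane p)))
      a r r0 _ _ _ iR) => x y h.
    - by have [] := dPy x y (sqr_le_nc r0 h).
    - by have [] := ccont_vline (cPy (x +i* y) (sqr_le_nc r0 h)).
    - by rewrite /P u0// (sqr_eq_nc r0 h).
  apply: (@stokes_y (fun p => complex.Im (P (plane p))) (fun p => complex.Im (Py (plane p)))
      a r r0 _ _ _ iI) => x y h.
  - by have [] := dPy x y (sqr_le_nc r0 h).
  - by have [] := ccont_vline (cPy (x +i* y) (sqr_le_nc r0 h)).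
  - by rewrite /P u0// (sqr_eq_nc r0 h).
(* The integrand is the Wirtinger derivative (d/dx + i d/dy) / 2 of [P]. It treats [u1] and [u2] as
   constants, because the terms with [u1'] and [u2'] cancel. *)
have -> : (fun w => u1 w * (v1' w)^* + u2 w * (v2' w)^*) =
    (fun w => 2^-1 * Px w + 2^-1 * 'i * Py w).
  have ii : 'i * 'i = -1 :> R[i] by rewrite -expr2 sqr_i.
  have iJ (z : Cplx R) : Num.conj (z * 'i) = - ('i * Num.conj z).
    by rewrite rmorphM -mulNr mulrC; congr (_ * _); simpc.
  have H (A B X Y : R[i]) : X + Y = 2^-1 * ((A + X) + (B + Y)) +
      2^-1 * 'i * (('i * A - 'i * X) + ('i * B - 'i * Y)).
    rewrite (_ : _ + ('i * B - 'i * Y) = 'i * (A - X + (B - Y))); last by ring.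
    by rewrite mulrA -[_ * 'i * 'i]mulrA ii; field.
  apply/funext => w; rewrite /Px /Py; cbv beta; rewrite !iJ.
  rewrite {1}(H (u1' w * (v1 w)^*) (u2' w * (v2 w)^*)); congr (_ + _ * _); ring.
rewrite CintegralD//; [|exact: CintegrableZ..].
by rewrite !CintegralZ// Px0 Py0 !mulr0 addr0.
Qed.

End stokes.

(** * Divided differences and the Bergman kernel of a disc *)

Section reproducing.
Context {R : realType}.
Implicit Types (f g q F : Cplx R -> Cplx R) (a z w d : Cplx R) (r : R).

Lemma cjM (x y : Cplx R) : Num.conj (x * y) = Num.conj x * Num.conj y.
Proof. exact: rmorphM. Qed.

Lemma cjK (x : Cplx R) : Num.conj (Num.conj x) = x.
Proof. exact: conjcK. Qed.

(** The mean value inequality on the segment from [z] to [w], again with a factor 2 from the two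
    components. *)
Lemma cder_increment_le F f z w (M : R) :
  (forall s : R, 0 <= s <= 1 -> cder F (z + s%:C * (w - z)) (f (z + s%:C * (w - z)))) ->
  (forall s : R, 0 <= s <= 1 -> nc (f (z + s%:C * (w - z))) <= M) ->
  nc (F w - F z) <= 2 * (M * nc (w - z)).
Proof.
move=> dF fM; pose g (s : R) := F (z + s%:C * (w - z)).
have dg s : 0 <= s <= 1 -> rder g s (f (z + s%:C * (w - z)) * (w - z)).
  by move=> /dF/cder_line.
have bnd s : 0 <= s <= 1 -> nc (f (z + s%:C * (w - z)) * (w - z)) <= M * nc (w - z).
  by move=> s01; rewrite ncM ler_wpM2r ?nc_ge0// fM.
have g0 : g 0 = F z by rewrite /g mul0r addr0.
have g1 : g 1 = F w by rewrite /g mul1r addrC subrK.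
have H (h dh : R -> R) : (forall s : R, 0 <= s <= 1 -> is_derive s 1 h (dh s)) ->
    (forall s : R, 0 <= s <= 1 -> `|dh s| <= M * nc (w - z)) ->
    `|h 1 - h 0| <= M * nc (w - z).
  move=> hd hb; have [||c] := @MVT_segment R h dh 0 1 ler01.
  - by move=> x; rewrite in_itv/= => /andP[? ?]; apply: hd; rewrite !ltW.
  - apply: within_continuous_itv => x /hd hx.
    by apply: differentiable_continuous; apply/derivable1_diffP; have [] := hx.
  - rewrite in_itv/= => c01 ->; rewrite subr0 mulr1; exact: hb.
rewrite -g0 -g1; apply: le_trans (nc_le_ReIm _) _; rewrite mulr_natl mulr2n RecB ImcB.
apply: lerD.
  apply: (H (fun s => complex.Re (g s)) (fun s => complex.Re (f (z + s%:C * (w - z)) * (w - z)))).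
    by move=> s /dg[].
  by move=> s /bnd; apply: le_trans; exact: nc_Re.
apply: (H (fun s => complex.Im (g s)) (fun s => complex.Im (f (z + s%:C * (w - z)) * (w - z)))).
  by move=> s /dg[].
by move=> s /bnd; apply: le_trans; exact: nc_Im.
Qed.

(* The divided difference of F at [z] and its derivative, where f = F' and d = f' z. *)
Definition cquot F f z w : Cplx R := if w == z then f z else (F w - F z) / (w - z).

Definition cquot' F f z d w : Cplx R :=
  if w == z then d / 2 else (f w - cquot F f z w) / (w - z).

Lemma cquotE F f z w : F w - F z = cquot F f z w * (w - z).
Proof.
rewrite /cquot; case: eqVneq => [->|wz]; first by rewrite !subrr mulr0.
by rewrite divfK// subr_eq0.
Qed.

Lemma cquot_near F f z d : (\forall w \near z, cder F w (f w)) -> cder f z d ->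
  forall e : R, 0 < e -> \forall w \near z,
    nc (cquot F f z w - f z - d / 2 * (w - z)) <= e * nc (w - z).
Proof.
move=> /near_ncP[r r0 dF] /cderP df e e0.
have /df/near_ncP[r1 r10 df1] : 0 < e / 2 by rewrite divr_gt0.
apply/near_ncP; exists (Num.min r r1) => [|w]; first by rewrite lt_min r0 r10.
rewrite lt_min => /andP[wr wr1].
have [->|wz] := eqVneq w z; first by rewrite /cquot eqxx !subrr mulr0 subrr nc0 mulr0.
have wz0 : w - z != 0 by rewrite subr_eq0.
rewrite /cquot (negPf wz).
rewrite -(@ler_pM2r _ (nc (w - z))) ?nc_gt0// -ncM.
(* Up to a constant, [G] is the remainder of the second-order Taylor expansion of [F] at [z]. Its
   derivative [G'] is the first-order remainder of [f], at most [e / 2 * nc (w - z)] on the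
   segment. *)
pose G (u : Cplx R) := F u - (f z * u + d / 2 * ((u - z) * (u - z))).
pose G' (u : Cplx R) := f u - f z - d * (u - z).
have -> : ((F w - F z) / (w - z) - f z - d / 2 * (w - z)) * (w - z) = G w - G z.
  by rewrite /G; field.
have seg s : 0 <= s <= 1 -> nc (z + s%:C * (w - z) - z) <= nc (w - z).
  move=> /andP[s0 s1]; rewrite (addrC z) addrK ncM ncR ger0_norm//.
  by rewrite ler_piMl ?nc_ge0.
have := @cder_increment_le G G' z w (e / 2 * nc (w - z)).
move=> /(_ _ _)/le_trans; apply; last by rewrite -!mulrA; lra.
- move=> s s01; have d0 := dF _ (le_lt_trans (seg s s01) wr).
  set u := z + _ in d0 *.
  have d1 := cderB (cder_id u) (cder_cst z u).
  have := cderB d0 (cderD (cderZ (f z) (cder_id u)) (cderZ (d / 2) (cderM d1 d1))).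
  by move=> /cder_eq; apply; rewrite /G'; field.
- move=> s s01; apply: le_trans (df1 _ (le_lt_trans (seg s s01) wr1)) _.
  by rewrite ler_wpM2l ?seg// ltW// divr_gt0.
Qed.

Lemma cder_cquot F f z d w : (\forall u \near z, cder F u (f u)) -> cder f z d ->
  cder F w (f w) -> cder (cquot F f z) w (cquot' F f z d w).
Proof.
move=> dF df dFw; have [->|wz] := eqVneq w z.
  rewrite /cquot' eqxx; apply/cderP => e e0.
  have := cquot_near dF df e0; apply: filterS => u.
  by rewrite (_ : cquot F f z z = f z) // /cquot eqxx.
have wz0 : w - z != 0 by rewrite subr_eq0.
apply: (@cder_near _ (fun u => (F u - F z) / (u - z))).
  apply/near_ncP; exists (nc (w - z)); first by rewrite nc_gt0.
  move=> u; rewrite /cquot; case: eqVneq => // ->.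
  by rewrite ncBC ltxx.
have d1 := cderB (cder_id w) (cder_cst z w).
have d2 := cderB dFw (cder_cst (F z) w).
apply: cder_eq (cderM d2 (cderV d1 wz0)) _.
by rewrite /cquot' /cquot (negPf wz); field.
Qed.

Lemma ccont_cquot' F f z d w : (\forall u \near z, cder F u (f u)) -> cder f z d ->
  cder F w (f w) -> ccont f w -> ccont (cquot' F f z d) w.
Proof.
move=> dF df dFw cf; have [->|wz] := eqVneq w z.
  apply/ccontP => e e0; have e4 : 0 < e / 4 by rewrite divr_gt0.
  have dfe := (cderP f z d).1 df _ e4.
  near=> u; rewrite /cquot' eqxx; case: (eqVneq u z) => [_|uz]; first by rewrite subrr nc0.
  have uz0 : u - z != 0 by rewrite subr_eq0.
  rewrite -(@ltr_pM2r _ (nc (u - z))) ?nc_gt0// -ncM.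
  (* Near [z] the slope of [f] is [d] and that of [cquot F f z] is [d / 2]; their difference
     explains the value [d / 2] of [cquot'] at [z]. *)
  have -> : ((f u - cquot F f z u) / (u - z) - d / 2) * (u - z) =
    (f u - f z - d * (u - z)) - (cquot F f z u - f z - d / 2 * (u - z)) by field.
  apply: le_lt_trans (ncB _ _) _.
  have h1 : nc (f u - f z - d * (u - z)) <= e / 4 * nc (u - z) by near: u.
  have h2 : nc (cquot F f z u - f z - d / 2 * (u - z)) <= e / 4 * nc (u - z).
    by near: u; exact: cquot_near.
  apply: le_lt_trans (lerD h1 h2) _; rewrite -mulrDl ltr_pM2r ?nc_gt0//; lra.
have wz0 : w - z != 0 by rewrite subr_eq0.
apply: (@ccont_near _ (fun u => (f u - cquot F f z u) / (u - z))).
  apply/near_ncP; exists (nc (w - z)); first by rewrite nc_gt0.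
  move=> u; rewrite /cquot'; case: eqVneq => // ->.
  by rewrite ncBC ltxx.
have cq := cder_continuous (cder_cquot dF df dFw).
have c1 := ccontB (@ccont_id R w) (@ccont_cst R z w).
have c2 := @ccontV R (fun u => u - z) w wz0 c1.
exact: (ccontM (ccontB cf cq) c2).
Unshelve. all: by end_near. Qed.

(** The square of this function, divided by the area of [cdisc a r], is the Bergman kernel of that
    disc. *)
Definition bker a r z w : Cplx R := (r ^+ 2)%:C / ((r ^+ 2)%:C - Num.conj (z - a) * (w - a)).

Lemma ncJC (z : R[i]) : nc (Num.conj z) = nc z. Proof. exact: ncJ. Qed.

Lemma bker_neq0 a r z w : 0 < r -> nc (z - a) < r -> nc (w - a) <= r ->
  (r ^+ 2)%:C - Num.conj (z - a) * (w - a) != 0.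
Proof.
move=> r0 zr wr; rewrite -nc_gt0; apply: lt_le_trans (ncB_ge _ _).
rewrite ncR ncM ncJC subr_gt0 ger0_norm ?sqr_ge0// expr2.
apply: le_lt_trans (_ : nc (z - a) * r < _); first by rewrite ler_wpM2l ?nc_ge0.
by rewrite ltr_pM2r.
Qed.

Lemma cder_bker a r z w : 0 < r -> nc (z - a) < r -> nc (w - a) <= r ->
  cder (bker a r z) w (Num.conj (z - a) / (r ^+ 2)%:C * bker a r z w ^+ 2).
Proof.
move=> r0 zr wr; have D0 := bker_neq0 r0 zr wr.
have rr : (r ^+ 2)%:C != 0 :> Cplx R.
  by rewrite -nc_eq0 ncR normr_eq0 expf_neq0// gt_eqF.
have d1 := cderB (cder_id w) (cder_cst a w).
have d2 := cderB (cder_cst (r ^+ 2)%:C w) (cderZ (Num.conj (z - a)) d1).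
apply: cder_eq (cderZ _ (cderV d2 D0)) _.
move: D0 rr; rewrite /bker; move: (Num.conj _) (w - a) ((r ^+ 2)%:C) => k e c D0 c0.
by field; rewrite D0 c0.
Qed.

(** With [q = cquot F f z] and b the kernel function [bker a r z], the integrand is q(w) (w - z)
    conj(b)^2. This is minus the conj(w)-derivative of q(w) (r^2 - |w - a|^2) conj(b), which
    vanishes on the circle. To fit Green's formula the product is split into its terms in r^2 and in
    (w - a) conj(w - a); these are the pairs [q], [v1] and [u2], [v2]. *)
Lemma cquot_integral0 F f a r z : 0 < r -> nc (z - a) < r ->
  (forall w, nc (w - a) <= r -> cder F w (f w)) ->
  (forall w, nc (w - a) <= r -> exists d, cder f w d) ->
  Cintegral (cdisc a r) (fun w => (F w - F z) * Num.conj (bker a r z w ^+ 2)) = 0.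
Proof.
move=> r0 zr dF df; have oD := @cdisc_open R a r.
have [d dz] := df z (ltW zr).
have nF : \forall u \near z, cder F u (f u).
  apply/near_ncP; exists (r - nc (z - a)); first by rewrite subr_gt0.
  move=> u uz; apply: dF; rewrite -(subrK z u) -addrA; apply: le_trans (ncD _ _) _.
  by rewrite -lerBrDr ltW.
have rr : (r ^+ 2)%:C != 0 :> Cplx R.
  by rewrite -nc_eq0 ncR normr_eq0 expf_neq0// gt_eqF.
pose q := cquot F f z; pose q' := cquot' F f z d.
pose u2 (w : Cplx R) : Cplx R := - (q w * (w - a)).
pose u2' (w : Cplx R) : Cplx R := - (q' w * (w - a) + q w * (1 - 0)).
pose v1 (w : Cplx R) : Cplx R := (r ^+ 2)%:C * bker a r z w.
pose v1' (w : Cplx R) : Cplx R := (r ^+ 2)%:C * (Num.conj (z - a) / (r ^+ 2)%:C * bker a r z w ^+ 2).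
pose v2 (w : Cplx R) : Cplx R := (w - a) * bker a r z w.
pose v2' (w : Cplx R) : Cplx R := (1 - 0) * bker a r z w +
  (w - a) * (Num.conj (z - a) / (r ^+ 2)%:C * bker a r z w ^+ 2).
have dq w : nc (w - a) <= r -> cder q w (q' w) by move=> wr; exact: (cder_cquot nF dz (dF w wr)).
have cq' w : nc (w - a) <= r -> ccont q' w.
  by move=> wr; have [d' /cder_continuous cfw] := df w wr; exact: (ccont_cquot' nF dz (dF w wr) cfw).
have d1 w : cder (fun u => u - a) w (1 - 0) := cderB (cder_id w) (cder_cst a w).
have := @stokes_conj R q u2 v1 v2 q' u2' v1' v2' a r r0.
have hd w : nc (w - a) <= r -> [/\ cder q w (q' w), cder u2 w (u2' w), cder v1 w (v1' w) & cder v2 w (v2' w)].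
  move=> wr; split; first exact: dq.
  - exact: (cderN (cderM (dq w wr) (d1 w))).
  - exact: (cderZ _ (cder_bker r0 zr wr)).
  - exact: (cderM (d1 w) (cder_bker r0 zr wr)).
have hc w : nc (w - a) <= r -> [/\ ccont q' w, ccont u2' w, ccont v1' w & ccont v2' w].
  move=> wr; have cb := cder_continuous (cder_bker r0 zr wr).
  have c1 := cder_continuous (d1 w); have cc k := @ccont_cst R k w.
  have cb2 : ccont (fun w => Num.conj (z - a) / (r ^+ 2)%:C * bker a r z w ^+ 2) w.
    exact: (ccontM (cc _) (ccontM cb cb)).
  split; first exact: cq'.
  - exact: (ccontN (ccontD (ccontM (cq' w wr) c1) (ccontM (cder_continuous (dq w wr)) (cc _)))).
  - exact: (ccontM (cc _) cb2).
  - exact: (ccontD (ccontM (cc _) cb) (ccontM c1 cb2)).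
have h0 w : nc (w - a) = r -> q w * Num.conj (v1 w) + u2 w * Num.conj (v2 w) = 0.
  move=> wr; rewrite /v1 /v2 /u2 !cjM.
  have -> : Num.conj (r ^+ 2)%:C = (w - a) * Num.conj (w - a) :> Cplx R.
    by rewrite [RHS]mul_conjc wr; exact: conjc_real.
  ring.
move=> /(_ hd hc h0) I0.
have E w : cdisc a r w -> (F w - F z) * Num.conj (bker a r z w ^+ 2) =
   - (q w * Num.conj (v1' w) + u2 w * Num.conj (v2' w)).
  move=> /ltW wr; rewrite (cquotE F f) -/(q w) /u2.
  have -> : v2' w = bker a r z w ^+ 2.
    rewrite /v2'; have := bker_neq0 r0 zr wr; move: rr; rewrite /bker.
    move: (Num.conj _) (w - a) ((r ^+ 2)%:C) => k e c c0 D0; field.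
    by rewrite c0 D0.
  have -> : v1' w = Num.conj (z - a) * bker a r z w ^+ 2.
    by rewrite /v1'; move: (bker _ _ _ _) (Num.conj _) ((r ^+ 2)%:C) rr => b k c c0; field.
  rewrite (cjM (Num.conj (z - a))) cjK; ring.
rewrite (eq_Cintegral E).
have -> : (fun w => - (q w * Num.conj (v1' w) + u2 w * Num.conj (v2' w))) =
  (fun w => -1 * (q w * Num.conj (v1' w) + u2 w * Num.conj (v2' w))).
  by apply/funext => w; rewrite mulN1r.
rewrite CintegralZ ?I0 ?mulr0//.
apply: cdisc_Cintegrable => w wr; have [c1 c2 c3 c4] := hc w wr; have [b1 b2 b3 b4] := hd w wr.
exact: (ccontD (ccontM (cder_continuous b1) (ccontJ c3)) (ccontM (cder_continuous b2) (ccontJ c4))).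
Qed.

Definition disc_area a r : R := aint (plane @^-1` cdisc a r) (fun=> 1).

Lemma Cintegral1 a r : Cintegral (cdisc a r) (fun=> 1) = (disc_area a r)%:C.
Proof.
by apply: complexP => //=; rewrite /Rintegral integral0.
Qed.

(** At the centre of the disc the kernel is the constant 1. *)
Lemma mean_value F f a r : 0 < r ->
  (forall w, nc (w - a) <= r -> cder F w (f w)) ->
  (forall w, nc (w - a) <= r -> exists d, cder f w d) ->
  Cintegral (cdisc a r) F = (disc_area a r)%:C * F a.
Proof.
move=> r0 dF df; have oD := @cdisc_open R a r.
have ar : nc (a - a) < r by rewrite subrr nc0.
have rr : (r ^+ 2)%:C != 0 :> Cplx R.
  by rewrite -nc_eq0 ncR normr_eq0 expf_neq0// gt_eqF.
have := cquot_integral0 r0 ar dF df.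
have iF : Cintegrable (cdisc a r) F.
  by apply: cdisc_Cintegrable => w /dF/cder_continuous.
have ic : Cintegrable (cdisc a r) (fun=> F a * 1).
  by apply: cdisc_Cintegrable => w _; exact: ccont_cst.
have i1 : Cintegrable (cdisc a r) (fun=> 1).
  by apply: cdisc_Cintegrable => w _; exact: ccont_cst.
have E w : (F w - F a) * Num.conj (bker a r a w ^+ 2) = F w - F a * 1.
  by rewrite /bker subrr rmorph0 mul0r subr0 divff// expr1n rmorph1 !mulr1.
under [X in Cintegral _ X]eq_fun do rewrite E.
rewrite CintegralB// CintegralZ// Cintegral1 => /eqP; rewrite subr_eq0 => /eqP ->.
by rewrite mulrC.
Qed.

Lemma repro_closed F f a r z : 0 < r -> nc (z - a) < r ->
  (forall w, nc (w - a) <= r -> cder F w (f w)) ->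
  (forall w, nc (w - a) <= r -> exists d, cder f w d) ->
  Cintegral (cdisc a r) (fun w => F w * Num.conj (bker a r z w ^+ 2)) =
  (disc_area a r)%:C * F z.
Proof.
move=> r0 zr dF df; have oD := @cdisc_open R a r.
have rr : (r ^+ 2)%:C != 0 :> Cplx R.
  by rewrite -nc_eq0 ncR normr_eq0 expf_neq0// gt_eqF.
have db w (wr : nc (w - a) <= r) := cder_bker r0 zr wr.
have cb w (wr : nc (w - a) <= r) := cder_continuous (db w wr).
have cF w : nc (w - a) <= r -> ccont F w by move=> /dF/cder_continuous.
have cbJ w : nc (w - a) <= r -> ccont (fun w => Num.conj (bker a r z w ^+ 2)) w.
  by move=> wr; exact: (ccontJ (ccontM (cb w wr) (cb w wr))).
have ib : Cintegrable (cdisc a r) (fun w => bker a r z w ^+ 2).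
  by apply: cdisc_Cintegrable => w wr; exact: (ccontM (cb w wr) (cb w wr)).
have ibJ : Cintegrable (cdisc a r) (fun w => Num.conj (bker a r z w ^+ 2)).
  by apply: cdisc_Cintegrable.
have iF : Cintegrable (cdisc a r) (fun w => F w * Num.conj (bker a r z w ^+ 2)).
  by apply: cdisc_Cintegrable => w wr; exact: (ccontM (cF w wr) (cbJ w wr)).
(* The mean value property applied to the kernel, which equals 1 at the centre. With this, the
   constant [F z] leaves the integral of [cquot_integral0] with the right factor. *)
have k0 : Cintegral (cdisc a r) (fun w => Num.conj (bker a r z w ^+ 2)) = (disc_area a r)%:C.
  rewrite [LHS](Cintegral_conj ib)//.
  pose k := Num.conj (z - a) / (r ^+ 2)%:C.
  rewrite (@mean_value _ (fun w => k * bker a r z w ^+ 2 * bker a r z w +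
    bker a r z w * (k * bker a r z w ^+ 2)) a r r0).
  - rewrite /bker subrr mulr0 subr0 divff// expr1n mulr1; exact: conjc_real.
  - by move=> w wr; have := cderM (db w wr) (db w wr).
  - move=> w wr; have d2 := cderZ k (cderM (db w wr) (db w wr)).
    by eexists; exact: (cderD (cderM d2 (db w wr)) (cderM (db w wr) d2)).
have := cquot_integral0 r0 zr dF df.
under [X in Cintegral _ X]eq_fun do rewrite mulrBl.
rewrite CintegralB ?CintegralZ ?k0//; last exact: CintegrableZ.
by move=> /eqP; rewrite subr_eq0 => /eqP ->; rewrite mulrC.
Qed.

End reproducing.

(** * Differentiation under the integral; derivatives are holomorphic *)

Section regularity.
Context {R : realType}.
Implicit Types (f g q F : Cplx R -> Cplx R) (a z w d : Cplx R) (r : R) (W : set (Cplx R)).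
Local Notation area := (@lebesgue_measure R \x @lebesgue_measure R)%E.
Local Notation mu := (@lebesgue_measure R).

(** The identity [Y - X = t * X * Y] says that [Y] is [X] moved by [t] as a resolvent, so powers
    have an explicit first-order expansion in [t]. Since [C] depends on [M] and [n] only, the
    remainder can be integrated. *)
Lemma resolvent_expansion (M : R) n : 0 <= M -> exists2 C : R, 0 <= C &
  forall X Y t : Cplx R, Y - X = t * X * Y -> nc X <= M -> nc Y <= M ->
    nc (Y ^+ n - X ^+ n - n%:R * t * X ^+ n.+1) <= C * nc t ^+ 2.
Proof.
move=> M0; elim: n => [|n [C C0 IH]].
  exists 0 => // X Y t _ _ _; rewrite !expr0 subrr !mul0r subr0 nc0//.
exists (M * C + n.+1%:R * M ^+ n.+3) => [|X Y t XY XM YM].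
  by apply: addr_ge0; apply: mulr_ge0 => //; exact: exprn_ge0.
(* [Y] times the previous remainder, plus [n.+1%:R * t * X ^+ n.+1 * (Y - X)], which the resolvent
   identity makes quadratic in [t]. *)
have -> : Y ^+ n.+1 - X ^+ n.+1 - n.+1%:R * t * X ^+ n.+2 =
    Y * (Y ^+ n - X ^+ n - n%:R * t * X ^+ n.+1) + n.+1%:R * t ^+ 2 * (X ^+ n.+2 * Y).
  apply/eqP; rewrite -subr_eq0 -natr1 !exprS.
  rewrite (_ : _ - _ = X ^+ n * (Y - X - t * X * Y) * (1 + (n%:R + 1) * t * X)).
    by rewrite XY subrr mulr0 mul0r.
  move: (X ^+ n) (Y ^+ n) (n%:R : Cplx R) => P Q N; ring.
apply: le_trans (ncD _ _) _.
rewrite [nc (Y * _)]ncM [nc (_ * (X ^+ n.+2 * Y))]ncM [nc (n.+1%:R * _)]ncM.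
rewrite [nc (X ^+ n.+2 * Y)]ncM !ncX mulrDl; apply: lerD.
  by rewrite -[leRHS]mulrA; apply: ler_pM; rewrite ?nc_ge0//; exact: IH.
have -> : nc (n.+1%:R : Cplx R) = n.+1%:R.
  by rewrite -[n.+1%:R]/((n.+1)%:R : R[i]) -(rmorph_nat (real_complex R)) ncR ger0_norm.
have XY1 : nc X ^+ n.+2 * nc Y <= M ^+ n.+3.
  by rewrite [leRHS]exprSr; apply: ler_pM; rewrite ?exprn_ge0 ?nc_ge0// lerXn2r// nnegrE nc_ge0.
have N0 : 0 <= n.+1%:R * nc t ^+ 2 by rewrite mulr_ge0// exprn_ge0// nc_ge0.
by have := ler_wpM2l N0 XY1; rewrite [X in _ -> _ <= X]mulrAC.
Qed.

(** Conjugation makes the kernel holomorphic in [z], the variable of differentiation below. *)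
Definition jker a r z w : Cplx R := Num.conj (bker a r z w).

(** With this direction, [jker a r z w] is the resolvent [(1 - (z - a) * jdir a r w)^-1]. *)
Definition jdir a r w : Cplx R := Num.conj (w - a) / (r ^+ 2)%:C.

Lemma r2_neq0 r : 0 < r -> (r ^+ 2)%:C != 0 :> Cplx R.
Proof. by move=> r0; rewrite -nc_eq0 ncR normr_eq0 expf_neq0// gt_eqF. Qed.

Lemma bker_le a r z w (t : R) : 0 < r -> nc (z - a) <= t -> t < r -> nc (w - a) <= r ->
  nc (bker a r z w) <= r / (r - t).
Proof.
move=> r0 zt tr wr; rewrite /bker ncM ncV ncR ger0_norm ?sqr_ge0//.
have tr0 : 0 < r - t by rewrite subr_gt0.
have H : r * (r - t) <= nc ((r ^+ 2)%:C - Num.conj (z - a) * (w - a)).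
  apply: le_trans (ncB_ge _ _); rewrite ncR ncM ncJC ger0_norm ?sqr_ge0//.
  rewrite mulrBr expr2 lerB// mulrC; apply: ler_pM; rewrite ?nc_ge0//.
rewrite ler_pdivrMr; last by apply: lt_le_trans H; rewrite mulr_gt0.
apply: le_trans (_ : r / (r - t) * (r * (r - t)) <= _).
  by rewrite expr2 mulrCA divfK// gt_eqF.
by rewrite ler_wpM2l// divr_ge0// ltW.
Qed.

Lemma jker_resolvent a r z z' w : 0 < r -> nc (z - a) < r -> nc (z' - a) < r ->
  nc (w - a) <= r ->
  jker a r z' w - jker a r z w = (z' - z) * jdir a r w * jker a r z w * jker a r z' w.
Proof.
move=> r0 zr z'r wr; have D := bker_neq0 r0 zr wr; have D' := bker_neq0 r0 z'r wr.
have c0 := r2_neq0 r0.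
have JE x : jker a r x w = (r ^+ 2)%:C / ((r ^+ 2)%:C - (x - a) * Num.conj (w - a)).
  rewrite /jker /bker [LHS]fmorph_div rmorphB /= (cjM (Num.conj (x - a))) cjK.
  by congr (_ / (_ - _)); exact: conjc_real.
have DE x : ((r ^+ 2)%:C - Num.conj (x - a) * (w - a) != 0) ->
    (r ^+ 2)%:C - (x - a) * Num.conj (w - a) != 0.
  rewrite -!nc_eq0 -(ncJC (_ - Num.conj _ * _)) rmorphB /= (cjM (Num.conj (x - a))) cjK.
  by rewrite (_ : Num.conj (r ^+ 2)%:C = (r ^+ 2)%:C)//; exact: conjc_real.
move: (DE _ D) (DE _ D'); rewrite !JE /jdir.
rewrite (_ : z' - z = (z' - a) - (z - a)); last by ring.
move: (z - a) (z' - a) (Num.conj (w - a)) ((r ^+ 2)%:C) c0 => x x' e c c0 h h'.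
by field; rewrite c0 h h'.
Qed.

Lemma ccont_jker a r z w : 0 < r -> nc (z - a) < r -> nc (w - a) <= r ->
  ccont (jker a r z) w.
Proof.
move=> r0 zr wr; exact: (ccontJ (cder_continuous (cder_bker r0 zr wr))).
Qed.

Lemma ccontX f n w : ccont f w -> ccont (fun u => f u ^+ n) w.
Proof.
move=> cf; elim: n => [|n IH].
  by under eq_fun do rewrite expr0; exact: (@ccont_cst R 1 w).
by under eq_fun do rewrite exprS; exact: (ccontM cf IH).
Qed.

Lemma jker_Cintegrable n g a r z : 0 < r -> nc (z - a) < r ->
  (forall w, cdisc a r w -> ccont g w) -> Cintegrable (cdisc a r) g ->
  Cintegrable (cdisc a r) (fun w => g w * jker a r z w ^+ n).
Proof.
move=> r0 zr cg ig; have oD := @cdisc_open R a r; have mD := measurable_plane oD.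
have zr0 : 0 < r - nc (z - a) by rewrite subr_gt0.
apply: (Cintegrable_le oD) (aintegrableZ ((r / (r - nc (z - a))) ^+ n) mD (integrable_nc oD cg ig)) _.
  move=> w wr; have wr' : nc (w - a) <= r by exact: ltW.
  have cj := @ccontX (jker a r z) n w (ccont_jker r0 zr wr').
  exact: (ccontM (cg w wr) cj).
move=> p /ltW wr; rewrite ncM mulrC ler_wpM2r ?nc_ge0// ncX lerXn2r ?nnegrE ?nc_ge0//.
  by rewrite divr_ge0// ltW.
by rewrite ncJC; exact: bker_le.
Qed.

Lemma ccont_jdir a r w : ccont (jdir a r) w.
Proof.
have c1 := ccontB (@ccont_id R w) (@ccont_cst R a w).
exact: (ccontM (ccontJ c1) (@ccont_cst R _ w)).
Qed.

Lemma jdir_le a r w : 0 < r -> nc (w - a) <= r -> nc (jdir a r w) <= r^-1.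
Proof.
move=> r0 wr; rewrite ncM ncV ncJC ncR ger0_norm ?sqr_ge0//.
by rewrite ler_pdivrMr ?exprn_gt0// expr2 mulrA mulVf ?mul1r// gt_eqF.
Qed.

Lemma jdir_Cintegrable g a r : 0 < r ->
  (forall w, cdisc a r w -> ccont g w) -> Cintegrable (cdisc a r) g ->
  Cintegrable (cdisc a r) (fun w => g w * jdir a r w).
Proof.
move=> r0 cg ig; have oD := @cdisc_open R a r; have mD := measurable_plane oD.
apply: (Cintegrable_le oD) (aintegrableZ r^-1 mD (integrable_nc oD cg ig)) _.
  by move=> w wr; exact: (ccontM (cg _ wr) (@ccont_jdir a r w)).
by move=> p /ltW wr; rewrite ncM mulrC ler_wpM2r ?nc_ge0// jdir_le.
Qed.

(** [g] is merely continuous and integrable. So the lemma serves twice: to differentiate a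
    reproducing formula repeatedly, and to show that a limit satisfying such a formula is
    holomorphic. *)
Lemma kernel_cder n g a r z : 0 < r -> nc (z - a) < r ->
  (forall w, cdisc a r w -> ccont g w) -> Cintegrable (cdisc a r) g ->
  cder (fun z => Cintegral (cdisc a r) (fun w => g w * jker a r z w ^+ n)) z
    (n%:R * Cintegral (cdisc a r) (fun w => g w * jdir a r w * jker a r z w ^+ n.+1)).
Proof.
move=> r0 zr cg ig; have oD := @cdisc_open R a r; have mD := measurable_plane oD.
(* For all points within distance [t] of the centre the kernel has the common bound [M]. *)
pose t := (r + nc (z - a)) / 2.
have tr : t < r by rewrite /t; lra.
have zt : nc (z - a) < t by rewrite /t; lra.
have t0 : 0 <= t by rewrite ltW// (le_lt_trans _ zt)// nc_ge0.
pose M := r / (r - t).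
have M0 : 0 <= M by rewrite divr_ge0 ?subr_ge0// ltW.
have [C C0 CP] := resolvent_expansion n M0.
have igJ := integrable_nc oD cg ig.
pose I := aint (plane @^-1` cdisc a r) (fun p => nc (g (plane p))).
have I0 : 0 <= I by apply: Rintegral_ge0 => p _; exact: nc_ge0.
pose K := 2 * (C * r^-1 ^+ 2 * I).
have K0 : 0 <= K.
  by apply: mulr_ge0 => //; apply: mulr_ge0 => //; apply: mulr_ge0 => //; rewrite exprn_ge0// invr_ge0 ltW.
have cgd w : cdisc a r w -> ccont (fun w => g w * jdir a r w) w.
  by move=> wr; exact: (ccontM (cg _ wr) (@ccont_jdir a r w)).
have igd := jdir_Cintegrable r0 cg ig.
apply/cderP => e e0; apply/near_ncP.
exists (Num.min (t - nc (z - a)) (e / (K + 1))) => [|z'].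
  by rewrite lt_min subr_gt0 zt divr_gt0// ltr_wpDl.
rewrite lt_min => /andP[z'z z'e].
have z't : nc (z' - a) < t.
  rewrite (_ : z' - a = (z' - z) + (z - a)); last by ring.
  by apply: le_lt_trans (ncD _ _) _; rewrite -ltrBrDr.
have z'r := lt_trans z't tr.
pose h := z' - z.
have i1 := jker_Cintegrable n r0 z'r cg ig; have i2 := jker_Cintegrable n r0 zr cg ig.
have i3 := jker_Cintegrable n.+1 r0 zr cgd igd.
have i12 := CintegrableB oD i1 i2.
have i4 := CintegrableB oD i12 (CintegrableZ (n%:R * h) oD i3).
rewrite -/h [n%:R * _ * h]mulrAC -CintegralZ// -CintegralB// -CintegralB//; last exact: CintegrableZ.
apply: le_trans (Cintegral_le oD i4 (aintegrableZ (C * r^-1 ^+ 2 * nc h ^+ 2) mD igJ) _) _.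
  move=> p /ltW wr; set w := plane p.
  rewrite (_ : _ - _ - _ = g w * (jker a r z' w ^+ n - jker a r z w ^+ n -
    n%:R * (h * jdir a r w) * jker a r z w ^+ n.+1)); last by ring.
  rewrite ncM mulrC ler_wpM2r ?nc_ge0//.
  apply: le_trans (CP _ _ (h * jdir a r w) _ _ _) _.
  - exact: jker_resolvent.
  - by rewrite ncJC; apply: bker_le => //; exact: ltW.
  - by rewrite ncJC; apply: bker_le => //; exact: ltW.
  - rewrite -mulrA ler_wpM2l// ncM exprMn mulrC ler_wpM2r ?exprn_ge0 ?nc_ge0//.
    by rewrite lerXn2r ?nnegrE ?nc_ge0 ?invr_ge0 ?(ltW r0)// jdir_le.
rewrite aintZ// -/I (_ : 2 * _ = K * nc h * nc h); last by rewrite /K; ring.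
rewrite ler_wpM2r ?nc_ge0//.
apply: le_trans (_ : K * (e / (K + 1)) <= _); first by rewrite ler_wpM2l// ltW.
by rewrite mulrCA ler_piMr ?(ltW e0)// ler_pdivrMr ?ltr_wpDl// mul1r lerDl.
Qed.

Lemma disc_area_gt0 a r : 0 < r -> 0 < disc_area a r.
Proof.
move=> r0; have mD := measurable_plane (@cdisc_open R a r).
rewrite /disc_area /aint Rintegral_cst// mul1r fine_gt0//; apply/andP; split; last exact: area_cdisc_fin.
have mB (t : R) : measurable (ball t (r / 2)) by exact: open_measurable (ball_open _ _).
apply: (@lt_le_trans _ _ (area (ball (complex.Re a) (r / 2) `*` ball (complex.Im a) (r / 2)))).
  rewrite product_measure1E; [|exact: mB..].
  have lb (t : R) : lebesgue_measure (ball t (r / 2)) = ((r / 2) *+ 2)%:E.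
    by apply: lebesgue_measure_ball; rewrite divr_ge0// ltW.
  move: (lb (complex.Re a)) (lb (complex.Im a)) => /= -> ->.
  by rewrite -EFinM lte_fin mulr_gt0// mulrn_wgt0// divr_gt0.
apply: le_measure; rewrite ?inE//; first by apply: measurableX; exact: mB.
move=> [x y] [/=]; rewrite /ball/= => h1 h2; apply: le_lt_trans (nc_le_ReIm _) _.
by rewrite RecB ImcB /= (distrC x) (distrC y); lra.
Qed.

Definition cderivable W f := forall w, W w -> exists d, cder f w d.

(** [repro_closed] asks for a differentiable derivative, so applying it to [f] would be circular. It
    applies to a local primitive [F] of [f], whose derivative [f] is differentiable; differentiating
    the formula for [F] three times shows that f has a differentiable derivative. *)
Lemma cderivable_deriv W f : open W -> cderivable W f ->
  exists f', (forall w, W w -> cder f w (f' w)) /\ cderivable W f'.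
Proof.
move=> oW df.
have loc p : W p -> exists g, \forall w \near p, cder f w (g w) /\ exists d, cder g w d.
  move=> Wp; have /near_ncP[rho rho0 Wrho] : \forall w \near p, W w by exact: open_nbhs_nbhs.
  (* The square of half-side [s] about [p] then lies in the disc of radius [rho], and the closed
     disc of radius [s / 2] lies inside the open square, where [F] is a primitive. *)
  pose s := rho / 3; have s0 : 0 < s by rewrite divr_gt0.
  have inW w : `|complex.Re w - complex.Re p| <= s -> `|complex.Im w - complex.Im p| <= s -> W w.
    move=> h1 h2; apply: Wrho; apply: le_lt_trans (nc_le_ReIm _) _; rewrite RecB ImcB.
    by apply: le_lt_trans (lerD h1 h2) _; rewrite /s; lra.
  have [F dF] := @rect_primitive R f (complex.Re p - s) (complex.Re p + s)
      (complex.Im p - s) (complex.Im p + s)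
      (fun w => ltac:(by move=> [/= /andP[h1 h2] /andP[h3 h4]]; apply: df; apply: inW;
         rewrite ler_norml; apply/andP; split; lra)).
  pose r := s / 2; have r0 : 0 < r by rewrite divr_gt0.
  have dF' w : nc (w - p) <= r -> cder F w (f w).
    move=> wr; have := le_trans (nc_Re _) wr; have := le_trans (nc_Im _) wr.
    rewrite RecB ImcB !ler_norml /r => /andP[? ?] /andP[? ?].
    by apply: dF; apply/andP; split; lra.
  have dfr w : nc (w - p) <= r -> exists d, cder f w d.
    move=> wr; apply: df; apply: Wrho; apply: le_lt_trans wr _; rewrite /r /s; lra.
  have A0 : (disc_area p r)%:C != 0 :> Cplx R.
    by rewrite -nc_eq0 ncR normr_eq0 gt_eqF// disc_area_gt0.
  have oD := @cdisc_open R p r.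
  have cF w : cdisc p r w -> ccont F w by move=> /ltW/dF'/cder_continuous.
  have iF : Cintegrable (cdisc p r) F.
    by apply: cdisc_Cintegrable => w /dF'/cder_continuous.
  have cF1 w : cdisc p r w -> ccont (fun w => F w * jdir p r w) w.
    by move=> wr; exact: (ccontM (cF w wr) (@ccont_jdir p r w)).
  have iF1 := jdir_Cintegrable r0 cF iF.
  have cF2 w : cdisc p r w -> ccont (fun w => F w * jdir p r w * jdir p r w) w.
    by move=> wr; exact: (ccontM (cF1 w wr) (@ccont_jdir p r w)).
  have iF2 := jdir_Cintegrable r0 cF1 iF1.
  set A := (disc_area p r)%:C in A0.
  have nD z : nc (z - p) < r -> \forall w \near z, nc (w - p) < r.
    by move=> zr; apply: open_nbhs_nbhs.
  have FE z : nc (z - p) < r ->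
      A^-1 * Cintegral (cdisc p r) (fun w => F w * jker p r z w ^+ 2) = F z.
    move=> zr; have := repro_closed r0 zr dF' dfr.
    have -> : (fun w => F w * Num.conj (bker p r z w ^+ 2)) = (fun w => F w * jker p r z w ^+ 2).
      by apply/funext => w; rewrite /jker rmorphXn.
    by move=> ->; rewrite mulrA mulVf// mul1r.
  have fE z : nc (z - p) < r -> A^-1 * (2%:R *
      Cintegral (cdisc p r) (fun w => F w * jdir p r w * jker p r z w ^+ 3)) = f z.
    move=> zr; have h := cderZ A^-1 (kernel_cder 2 r0 zr cF iF).
    apply: cder_unique (dF' _ (ltW zr)); apply: cder_near h.
    by apply: filterS (nD z zr) => w; exact: FE.
  pose g z := A^-1 * (2%:R * (3%:R *
      Cintegral (cdisc p r) (fun w => F w * jdir p r w * jdir p r w * jker p r z w ^+ 4))).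
  exists g; have pp : nc (p - p) < r by rewrite subrr nc0.
  apply: filterS (nD p pp) => z zr; split.
    have h := cderZ A^-1 (cderZ 2%:R (kernel_cder 3 r0 zr cF1 iF1)).
    by apply: cder_near h; apply: filterS (nD z zr) => w; exact: fE.
  by eexists; exact: (cderZ A^-1 (cderZ 2%:R (cderZ 3%:R (kernel_cder 4 r0 zr cF2 iF2)))).
(* The global derivative is picked by choice; uniqueness of derivatives identifies it with each
   local one. *)
pose f' w := xget 0 [set d | cder f w d].
have df' w : W w -> cder f w (f' w).
  by move=> /df[d fd]; exact: (@xgetPex _ 0 [set d | cder f w d] (ex_intro _ d fd)).
exists f'; split=> // p Wp; have [g near_g] := loc p Wp.
have [_ [d gd]] := nbhs_singleton near_g; exists d.
apply: cder_near gd.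
have Wn : \forall w \near p, W w by exact: open_nbhs_nbhs.
near=> w; apply: (@cder_unique _ f w).
  by have [] : cder f w (g w) /\ exists d, cder g w d by near: w.
by apply: df'; near: w.
Unshelve. all: by end_near. Qed.

End regularity.

(** * Areas of discs; the reproducing formula without boundary regularity *)

Section disc_area_and_reproduction.
Context {R : realType}.
Implicit Types (f g : Cplx R -> Cplx R) (a z w : Cplx R) (r : R) (D : set (R * R)).
Local Notation area := (@lebesgue_measure R \x @lebesgue_measure R)%E.
Local Notation mu := (@lebesgue_measure R).

Definition closed_cdisc a r : set (Cplx R) := [set w | nc (w - a) <= r].

Lemma plane_closed_cdiscE a r : 0 < r -> plane @^-1` closed_cdisc a r =
  [set p | (p.1 - complex.Re a) ^+ 2 + (p.2 - complex.Im a) ^+ 2 <= r ^+ 2].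
Proof.
move=> r0; apply/seteqP; split=> p; rewrite /closed_cdisc /=.
  rewrite -(@ler_pXn2r _ 2)// ?nnegrE ?nc_ge0 ?(ltW r0)// nc_sqr.
  by rewrite RecB ImcB.
by move=> h; rewrite -(@ler_pXn2r _ 2)// ?nnegrE ?nc_ge0 ?(ltW r0)// nc_sqr RecB ImcB.
Qed.

Lemma measurable_closed_cdisc a r : measurable (plane @^-1` closed_cdisc a r).
Proof.
rewrite -[X in measurable X]setCK; apply: measurableC.
rewrite preimage_setC; apply: measurable_plane.
rewrite openE => w /= /negP; rewrite -ltNge => rw; apply/near_ncP.
exists (nc (w - a) - r) => [|u uw]; first by rewrite subr_gt0.
apply/negP; rewrite -ltNge.
have -> : u - a = (w - a) + (u - w) by ring.
by apply: lt_le_trans (ncD_ge _ _); rewrite ltrBrDr -ltrBrDl.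
Qed.

(** The vertical sections of the open and the closed disc have the same length. Letting [D] be
    anything in between gives both areas by one formula, hence the nullity of circles. *)
Lemma area_disc_sections D a r : 0 < r -> measurable D ->
  plane @^-1` cdisc a r `<=` D -> D `<=` plane @^-1` closed_cdisc a r ->
  area D = (\int[mu]_x ((2 * Num.sqrt (r ^+ 2 - (x - complex.Re a) ^+ 2))%:E))%E.
Proof.
move=> r0 mD; rewrite plane_cdiscE// plane_closed_cdiscE// => oD Dc.
rewrite /product_measure1 /=; apply: eq_integral => x _.
set c := r ^+ 2 - _; set s := Num.sqrt c; have s0 : 0 <= s by exact: sqrtr_ge0.
have mS : measurable (xsection D x) by exact: measurable_xsection.
have lenc : mu `[complex.Im a - s, complex.Im a + s] = (2 * s)%:E.
  rewrite lebesgue_measure_itv/= lte_fin; case: ltP => [_|h].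
    by rewrite -EFinD; congr (_%:E); ring.
  by rewrite (_ : s = 0) ?mulr0//; apply/eqP; rewrite eq_le s0 andbT; lra.
have leno : mu `]complex.Im a - s, complex.Im a + s[ = (2 * s)%:E.
  rewrite lebesgue_measure_itv/= lte_fin; case: ltP => [_|h].
    by rewrite -EFinD; congr (_%:E); ring.
  by rewrite (_ : s = 0) ?mulr0//; apply/eqP; rewrite eq_le s0 andbT; lra.
apply/eqP; rewrite eq_le; apply/andP; split.
  rewrite -lenc; apply: le_measure; rewrite ?inE// => y /xsectionP/Dc /= h.
  have c0 : 0 <= c by rewrite /c; have := sqr_ge0 (y - complex.Im a); lra.
  have : (y - complex.Im a) ^+ 2 <= s ^+ 2 by rewrite sqr_sqrtr// /c; lra.
  rewrite -real_normK ?num_real// ler_pXn2r ?nnegrE// ler_norml in_itv/=.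
  by move=> /andP[? ?]; apply/andP; split; lra.
rewrite -leno; apply: le_measure; rewrite ?inE// => y /=; rewrite in_itv/= => /andP[h1 h2].
apply/xsectionP/oD => /=.
have s1 : 0 < s by lra.
have c0 : 0 <= c by rewrite leNgt; apply/negP => c0; move: s1; rewrite /s ltr0_sqrtr ?ltxx.
have : (y - complex.Im a) ^+ 2 < s ^+ 2.
  rewrite -real_normK ?num_real// ltr_pXn2r ?nnegrE// ltr_norml.
  by apply/andP; split; lra.
by rewrite sqr_sqrtr// /c; lra.
Qed.

Lemma area_circle a r : 0 < r ->
  area (plane @^-1` closed_cdisc a r `\` plane @^-1` cdisc a r) = 0%E.
Proof.
move=> r0; have mo := measurable_plane (@cdisc_open R a r).
have mc := measurable_closed_cdisc a r.
have oc : plane @^-1` cdisc a r `<=` plane @^-1` closed_cdisc a r by move=> p /ltW.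
set A := plane @^-1` cdisc a r in mo oc *; set B := plane @^-1` closed_cdisc a r in mc oc *.
have AB : area A = area B.
  by rewrite (area_disc_sections r0 mc oc)// (area_disc_sections r0 mo _ oc).
have : area (A `|` (B `\` A)) = (area A + area (B `\` A))%E.
  by apply: measureU => //; [exact: measurableD|rewrite setDE setICA setICr setI0].
rewrite setDUK// -AB.
have : (area A < +oo)%E by exact: area_cdisc_fin.
have : (0 <= area A)%E by exact: measure_ge0.
have : (0 <= area (B `\` A))%E by exact: measure_ge0.
case: (area A) (area (B `\` A)) => [x| |] [y| |]//= _ _ _ [] /eqP.
by rewrite -subr_eq0 opprD addrA subrr sub0r oppr_eq0 => /eqP ->.
Qed.

Lemma disc_areaE a r : (disc_area a r)%:E = area (plane @^-1` cdisc a r).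
Proof.
have mo := measurable_plane (@cdisc_open R a r).
rewrite /disc_area /aint Rintegral_cst// mul1r fineK// ge0_fin_numE//.
exact: area_cdisc_fin.
Qed.

(** An affine substitution in the integral of section lengths. This law relates the kernels of the
    horodisc and of the unit disc, without the value of the area. *)
Lemma disc_area_scale a r : 0 < r -> disc_area a r = r ^+ 2 * disc_area 0 1.
Proof.
move=> r0; apply: EFin_inj; rewrite EFinM !disc_areaE.
have mo b t := measurable_plane (@cdisc_open R b t).
have oc b t : plane @^-1` cdisc b t `<=` plane @^-1` closed_cdisc b t by move=> p /ltW.
rewrite (area_disc_sections r0 (mo _ _) (@subset_refl _ _) (oc _ _)).
rewrite (area_disc_sections ltr01 (mo _ _) (@subset_refl _ _) (oc _ _)) /=.
pose F (x : R) := (x - complex.Re a) / r.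
have dF (x : R) : is_derive x 1 F r^-1.
  have -> : F = (fun x => r^-1 *: (x - complex.Re a)) by apply/funext => y; rewrite /F mulrC.
  rewrite -[X in is_derive _ _ _ X](_ : r^-1 *: (1 - 0) = _); last by rewrite subr0 /GRing.scale/= mulr1.
  exact: is_deriveZ.
have F'E : derive1 F = (fun=> r^-1) by apply/funext => x; rewrite derive1E; have [_ ->] := dF x.
pose G (x : R) := 2 * Num.sqrt (1 ^+ 2 - (x - 0) ^+ 2).
have cG : continuous G.
  move=> x; apply: cvgM; first exact: cvg_cst.
  apply: (@continuous_comp _ _ _ (fun x : R => 1 ^+ 2 - (x - 0) ^+ 2) Num.sqrt); last exact: sqrt_continuous.
  apply: cvgB; first exact: cvg_cst.
  by rewrite /= expr2; under eq_fun do rewrite expr2; apply: cvgM; (apply: cvgB; [exact: cvg_id|exact: cvg_cst]).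
have cGF : continuous (G \o F).
  move=> x; apply: continuous_comp; last exact: cG.
  by apply: differentiable_continuous; apply/derivable1_diffP; have [] := dF x.
rewrite (@increasing_ge0_integration_by_substitutionT R F G).
- rewrite -ge0_integralZl_EFin ?sqr_ge0//; last 2 first.
  + by move=> x _; rewrite lee_fin F'E /G/= mulr_ge0 ?invr_ge0 ?(ltW r0)// mulr_ge0 ?sqrtr_ge0.
  + apply/measurable_EFinP; apply: continuous_measurable_fun => x.
    by rewrite F'E; apply: cvgM; [exact: cGF|exact: cvg_cst].
  apply: eq_integral => x _; rewrite -EFinM; congr (_%:E).
  have -> : ((G \o F) * derive1 F) x = G (F x) * r^-1.
    by rewrite -[LHS]/(G (F x) * derive1 F x) F'E.
  rewrite /G /F subr0.
  have -> : r ^+ 2 - (x - complex.Re a) ^+ 2 = r ^+ 2 * (1 ^+ 2 - ((x - complex.Re a) / r) ^+ 2).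
    by field; rewrite gt_eqF.
  rewrite sqrtrM ?sqr_ge0// sqrtr_sqr gtr0_norm//.
  by field; rewrite gt_eqF.
- by move=> x y xy; rewrite /F ltr_pM2r ?invr_gt0// ltrD2r.
- by rewrite F'E; exact: cst_continuous.
- by rewrite F'E; exact: is_cvg_cst.
- by rewrite F'E; exact: is_cvg_cst.
- by move=> x; have [] := dF x.
- apply/cvgrNyPle => M; near=> x; rewrite /F ler_pdivrMr// lerBlDr.
  by near: x; apply: nbhs_ninfty_le; rewrite num_real.
- apply/cvgryPge => M; near=> x; rewrite /F ler_pdivlMr// lerBrDr.
  by near: x; apply: nbhs_pinfty_ge; rewrite num_real.
- exact: cG.
- by move=> x; rewrite /G mulr_ge0 ?sqrtr_ge0.
Unshelve. all: by end_near. Qed.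

Lemma aint_dct D (h_ : nat -> R * R -> R) (h G : R * R -> R) : measurable D ->
  (forall n, measurable_fun D (h_ n)) -> measurable_fun D h ->
  (forall p, D p -> (fun n => h_ n p) @ \oo --> h p) -> aintegrable D G ->
  (forall n p, D p -> `|h_ n p| <= G p) ->
  (fun n => aint D (h_ n)) @ \oo --> aint D h.
Proof.
move=> mD mh_ mh hh iG hG.
have [||||ih _ H] := @dominated_convergence _ _ _ area _ mD (fun n p => (h_ n p)%:E)
    (fun p => (h p)%:E) (fun p => (G p)%:E) _ _ _ iG.
- by move=> n; apply/measurable_EFinP; exact: mh_.
- by apply/measurable_EFinP; exact: mh.
- by apply: aeW => p Dp; apply: cvg_EFin; [exact: nearW|exact: hh].
- by apply: aeW => p n Dp; rewrite lee_fin hG.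
apply: fine_cvg; rewrite fineK//; exact: integrable_fin_num.
Qed.

Lemma cvg_line (phi : Cplx R -> Cplx R) (c : R) (c_ : nat -> R) : ccont phi c%:C ->
  c_ @ \oo --> c ->
  (fun n => complex.Re (phi (c_ n)%:C)) @ \oo --> complex.Re (phi c%:C) /\
  (fun n => complex.Im (phi (c_ n)%:C)) @ \oo --> complex.Im (phi c%:C).
Proof.
move=> /(@ccont_hline _ _ c 0)[cR cI] cc; split.
  exact: (cvg_comp _ _ cc cR).
exact: (cvg_comp _ _ cc cI).
Qed.

(* Exhaust the disc by closed discs of radii increasing to [r], where
   repro_closed applies. *)
Lemma repro f a r z : 0 < r -> nc (z - a) < r -> cderivable (cdisc a r) f ->
  Cintegrable (cdisc a r) f ->
  Cintegral (cdisc a r) (fun w => f w * Num.conj (bker a r z w ^+ 2)) =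
  (disc_area a r)%:C * f z.
Proof.
move=> r0 zr df i_f; have oD := @cdisc_open R a r; have mD := measurable_plane oD.
have [f' [dff' df']] := cderivable_deriv oD df.
have cf w : cdisc a r w -> ccont f w by move=> /dff'/cder_continuous.
set t := nc (z - a) in zr *; have t0 : 0 <= t by exact: nc_ge0.
(* The gap [rr n - t] is at least [(r - t) / 2] for every [n], so the kernels of all the smaller
   discs share the bound [B]. *)
pose rr (n : nat) : R := r - (r - t) / 2 * n.+1%:R^-1.
have rr_cvg : rr @ \oo --> r.
  rewrite -[X in _ --> X]subr0; apply: cvgB; first exact: cvg_cst.
  rewrite -(mulr0 ((r - t) / 2)); apply: cvgM; first exact: cvg_cst.
  exact: cvg_harmonic.
have hn n : 0 < (n.+1%:R^-1 : R) <= 1 by rewrite invr_gt0 ltr0n/= invf_le1 ?ler1n ?ltr0n.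
have rrP n : [/\ t < rr n, rr n < r & (r - t) / 2 <= rr n - t].
  have /andP[h1 h2] := hn n; have s0 : 0 < r - t by rewrite subr_gt0.
  have h3 : 0 < (r - t) * n.+1%:R^-1 by rewrite mulr_gt0.
  have h4 : (r - t) * n.+1%:R^-1 <= r - t by rewrite ler_piMr// ltW.
  have E : rr n = r - (r - t) * n.+1%:R^-1 / 2 by rewrite /rr mulrAC.
  by rewrite E; move: ((r - t) * _) h3 h4 => q h3 h4; split; lra.
have rr0 n : 0 < rr n by have [h _ _] := rrP n; exact: le_lt_trans h.
pose phi (n : nat) w := f w * Num.conj (bker a (rr n) z w ^+ 2).
have I_n n : Cintegral (cdisc a (rr n)) (phi n) = (disc_area a (rr n))%:C * f z.
  have [h1 h2 _] := rrP n; have sub w : nc (w - a) <= rr n -> cdisc a r w.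
    by move=> h; rewrite /cdisc /= (le_lt_trans h).
  have d1 w : nc (w - a) <= rr n -> cder f w (f' w) by move=> h; exact: dff' (sub w h).
  have d2 w : nc (w - a) <= rr n -> exists d, cder f' w d by move=> h; exact: df' (sub w h).
  exact: (repro_closed (rr0 n) h1 d1 d2).
pose Phi w := f w * Num.conj (bker a r z w ^+ 2).
set DD := plane @^-1` cdisc a r in mD.
pose P n := plane @^-1` cdisc a (rr n).
have mP n : measurable (P n) := measurable_plane (@cdisc_open R a (rr n)).
have PD n : DD `&` P n = P n.
  by apply/setIidPr => p h; have [_ h2 _] := rrP n; exact: lt_trans h h2.
have cphi n w : cdisc a (rr n) w -> ccont (phi n) w.
  move=> wr; have [h1 h2 _] := rrP n.
  have cb := cder_continuous (cder_bker (rr0 n) h1 (ltW wr)).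
  exact: (ccontM (cf _ (lt_trans wr h2)) (ccontJ (ccontM cb cb))).
have cPhi w : cdisc a r w -> ccont Phi w.
  move=> wr; have cb := cder_continuous (cder_bker r0 zr (ltW wr)).
  exact: (ccontM (cf _ wr) (ccontJ (ccontM cb cb))).
pose B := r / ((r - t) / 2).
(* Dominated convergence, proved once for [part] and used for the real and the imaginary part. *)
have key (part : R[i] -> R) : (forall z, `|part z| <= nc z) ->
    (forall W g, open W -> (forall w, W w -> ccont g w) ->
       measurable_fun (plane @^-1` W) (fun p => part (g (plane p)))) ->
    (forall (psi : Cplx R -> Cplx R) (c : R) (c_ : nat -> R), ccont psi c%:C ->
       c_ @ \oo --> c -> (fun n => part (psi (c_ n)%:C)) @ \oo --> part (psi c%:C)) ->
    (fun n => aint (P n) (fun p => part (phi n (plane p)))) @ \oo -->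
      aint DD (fun p => part (Phi (plane p))).
  move=> part_le part_m part_c.
  pose h_ n := (fun p => part (phi n (plane p))) \_ (P n).
  have -> : (fun n => aint (P n) (fun p => part (phi n (plane p)))) = (fun n => aint DD (h_ n)).
    by apply/funext => n; rewrite -{1}(PD n) /aint Rintegral_mkcondr.
  apply: (@aint_dct _ _ _ (fun p => B ^+ 2 * nc (f (plane p))) mD).
  - move=> n; apply/measurable_restrict => //; rewrite PD; apply: part_m; last exact: cphi.
    exact: cdisc_open.
  - by apply: part_m; [exact: oD|exact: cPhi].
  - move=> p pD; set w := plane p; pose k := Num.conj (z - a) * (w - a).
    (* For fixed [z] and [w] the kernel depends on the radius only through its square [c], so
       pointwise convergence is continuity in [c]. *)
    pose psi (c : Cplx R) := f w * Num.conj ((c / (c - k)) ^+ 2).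
    have k0 : (r ^+ 2)%:C - k != 0 := bker_neq0 r0 zr (ltW pD).
    have cpsi : ccont psi (r ^+ 2)%:C.
      have c1 := ccontB (@ccont_id R (r ^+ 2)%:C) (@ccont_cst R k (r ^+ 2)%:C).
      have c2 := @ccontV R (fun c => c - k) _ k0 c1.
      have c3 := ccontM (@ccont_id R (r ^+ 2)%:C) c2.
      exact: (ccontM (@ccont_cst R (f w) (r ^+ 2)%:C) (ccontJ (ccontM c3 c3))).
    have rr2 : (fun n => rr n ^+ 2) @ \oo --> r ^+ 2 by exact: (cvgM rr_cvg rr_cvg).
    apply: cvg_trans (part_c psi _ _ cpsi rr2); apply: near_eq_cvg.
    have : \forall n \near \oo, nc (w - a) < rr n by exact: (cvgr_gt _ rr_cvg _ pD).
    by apply: filterS => n wn; rewrite /h_ patchE mem_set.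
  - exact: (aintegrableZ _ mD (integrable_nc oD cf i_f)).
  - move=> n p pD; rewrite /h_ patchE; case: ifPn => [/set_mem wn|_]; last first.
      by rewrite normr0 mulr_ge0 ?nc_ge0// sqr_ge0.
    apply: le_trans (part_le _) _; rewrite /phi [nc (_ * _)]ncM mulrC ler_wpM2r ?nc_ge0//.
    have [h1 h2 h3] := rrP n.
    rewrite ncJC ncX lerXn2r ?nnegrE ?nc_ge0//; first by rewrite /B !divr_ge0 ?subr_ge0 ?ltW.
    apply: le_trans (bker_le (rr0 n) (lexx _) h1 (ltW wn)) _; rewrite -/t.
    apply: ler_pM; rewrite ?(ltW (rr0 n)) ?(ltW h2) ?invr_ge0 ?subr_ge0 ?(ltW h1)//.
    by rewrite lef_pV2// posrE ?subr_gt0// divr_gt0// subr_gt0.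
have area_cvg : (fun n => disc_area a (rr n)) @ \oo --> disc_area a r.
  rewrite (disc_area_scale a r0).
  have -> : (fun n => disc_area a (rr n)) = (fun n => rr n ^+ 2 * disc_area 0 1).
    by apply/funext => n; rewrite disc_area_scale.
  by apply: cvgM; [exact: (cvgM rr_cvg rr_cvg)|exact: cvg_cst].
apply: complexP.
  have h1 := key _ (@nc_Re R) (fun W g oW cg => (ccont_measurable oW cg).1)
    (fun psi c c_ h1 h2 => (cvg_line h1 h2).1).
  have h2 : (fun n => disc_area a (rr n) * complex.Re (f z)) @ \oo --> disc_area a r * complex.Re (f z).
    by apply: cvgM => //; exact: cvg_cst.
  rewrite cReM /= mul0r subr0; apply: (cvg_unique _ h1); rewrite // (_ : (fun n => _) = (fun n => disc_area a (rr n) * complex.Re (f z)))//.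
  by apply/funext => n; rewrite -[LHS]/(complex.Re (Cintegral (cdisc a (rr n)) (phi n))) I_n cReM /= mul0r subr0.
have h1 := key _ (@nc_Im R) (fun W g oW cg => (ccont_measurable oW cg).2)
  (fun psi c c_ h1 h2 => (cvg_line h1 h2).2).
have h2 : (fun n => disc_area a (rr n) * complex.Im (f z)) @ \oo --> disc_area a r * complex.Im (f z).
  by apply: cvgM => //; exact: cvg_cst.
rewrite cImM /= mul0r addr0; apply: (cvg_unique _ h1); rewrite // (_ : (fun n => _) = (fun n => disc_area a (rr n) * complex.Im (f z)))//.
by apply/funext => n; rewrite -[LHS]/(complex.Im (Cintegral (cdisc a (rr n)) (phi n))) I_n cImM /= mul0r addr0.
Qed.

End disc_area_and_reproduction.

(** * Hilbert spaces *)

Section hilbert.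
Context {R : realType} {V : lmodType R[i]} (form : {dot V for Num.conj}).
Implicit Types (u v w h : V) (a : R[i]) (s e : R).

Lemma conjD (a b : R[i]) : Num.conj (a + b) = Num.conj a + Num.conj b.
Proof. exact: rmorphD. Qed.

Lemma conjM (a b : R[i]) : Num.conj (a * b) = Num.conj a * Num.conj b.
Proof. exact: rmorphM. Qed.

Lemma conjN (a : R[i]) : Num.conj (- a) = - Num.conj a.
Proof. exact: rmorphN. Qed.

Definition sqnorm u : R := complex.Re (form u u).

Lemma formDl u v w : form (u + v) w = form u w + form v w.
Proof. exact: linearDl. Qed.

Lemma formBl u v w : form (u - v) w = form u w - form v w.
Proof. exact: linearBl. Qed.

Lemma formZl a u v : form (a *: u) v = a * form u v.
Proof. exact: linearZl_LR. Qed.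

Lemma formC u v : form u v = Num.conj (form v u).
Proof. by rewrite hermC expr0 mul1r. Qed.

Lemma form_sqnorm u : form u u = (sqnorm u)%:C.
Proof. by rewrite /sqnorm RRe_real// ger0_real// dnorm_ge0. Qed.

Lemma sqnorm_ge0 u : 0 <= sqnorm u.
Proof. by rewrite -lecR -form_sqnorm dnorm_ge0. Qed.

Lemma sqnorm0 : sqnorm 0 = 0.
Proof. by rewrite /sqnorm linear0r. Qed.

Lemma sqnorm_eq0 u : sqnorm u = 0 -> u = 0.
Proof.
by move=> u0; apply/eqP; rewrite -(dnorm_eq0 form) form_sqnorm u0.
Qed.

Lemma Re_conj (z : R[i]) : complex.Re (Num.conj z) = complex.Re z.
Proof. by case: z. Qed.

Lemma sqnormD u v : sqnorm (u + v) = sqnorm u + sqnorm v + 2 * complex.Re (form u v).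
Proof.
rewrite /sqnorm formDl (formC u) (formC v) !formDl !rmorphD !cReD !Re_conj /=.
by rewrite (formC v u) Re_conj; ring.
Qed.

Lemma sqnormZ a u : sqnorm (a *: u) = nc a ^+ 2 * sqnorm u.
Proof.
rewrite /sqnorm formZl formC formZl conjM -formC mulrA.
rewrite [a * _](mul_conjc a) form_sqnorm.
by rewrite -rmorphM.
Qed.

Lemma sqnormN u : sqnorm (- u) = sqnorm u.
Proof. by rewrite -scaleN1r sqnormZ ncN nc1 expr1n mul1r. Qed.

Lemma sqnormBC u v : sqnorm (u - v) = sqnorm (v - u).
Proof. by rewrite -sqnormN opprB. Qed.

Lemma formNl u v : form (- u) v = - form u v.
Proof. by rewrite -scaleN1r formZl mulN1r. Qed.

Lemma formNr u v : form u (- v) = - form u v.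
Proof. by rewrite formC formNl conjN -formC. Qed.

Lemma formZr a u v : form u (a *: v) = Num.conj a * form u v.
Proof. by rewrite formC formZl conjM -formC. Qed.

Lemma sqnormB u v : sqnorm (u - v) = sqnorm u + sqnorm v - 2 * complex.Re (form u v).
Proof. by rewrite sqnormD sqnormN formNr raddfN /= mulrN. Qed.

Lemma form_cauchy_schwarz u v : nc (form u v) ^+ 2 <= sqnorm u * sqnorm v.
Proof.
have := dot_cauchy_schwarz form u v.
move=> h; have := lerXn2r 2 (normr_ge0 _) _ h; rewrite nnegrE.
rewrite mulr_ge0 ?sqrtC_ge0 ?dnorm_ge0// => /(_ erefl).
by rewrite exprMn !sqrtCK !form_sqnorm normE -rmorphXn -rmorphM lecR.
Qed.

Lemma sqnormD_le u v : sqnorm (u + v) <= 2 * sqnorm u + 2 * sqnorm v.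
Proof.
have := sqnorm_ge0 (u - v); rewrite sqnormB sqnormD; lra.
Qed.

(** Convergence is measured by the squared norm, a real number, rather than by the norm, which takes
    values in [R[i]]. *)
Definition sqcvg (u : nat -> V) v := forall e, 0 < e -> exists N, forall n, (N <= n)%N ->
  sqnorm (u n - v) <= e.

Definition sqcauchy (u : nat -> V) := forall e, 0 < e -> exists N, forall m n,
  (N <= m)%N -> (N <= n)%N -> sqnorm (u m - u n) <= e.

Definition sqcomplete := forall u : nat -> V, sqcauchy u -> exists v, sqcvg u v.

Lemma quadratic_ge0 (D N : R) : 0 <= N -> (forall s, 0 <= 2 * s * D + s ^+ 2 * N) -> D = 0.
Proof.
(* Near the minimiser [- D / N]; the added 1 keeps the denominator positive when [N = 0]. *)
move=> N0 /(_ (- D / (N + 1))); have N1 : 0 < N + 1 by rewrite ltr_wpDl.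
have -> : 2 * (- D / (N + 1)) * D + (- D / (N + 1)) ^+ 2 * N =
   - (D ^+ 2 * ((N + 2) / (N + 1) ^+ 2)) by field; rewrite gt_eqF.
rewrite oppr_ge0 pmulr_lle0; last by rewrite divr_gt0 ?exprn_gt0// ltr_wpDl.
by move=> D2; apply/eqP; rewrite -sqrf_eq0 eq_le D2 sqr_ge0.
Qed.

(** A minimising sequence for the distance from [v] to [K] is Cauchy by the parallelogram law, and
    its limit is tested by variations in [K]. *)
Lemma projection (K : set V) v : sqcomplete -> K 0 ->
  (forall a u w, K u -> K w -> K (a *: u + w)) ->
  (forall (u : nat -> V) w, (forall n, K (u n)) -> sqcvg u w -> K w) ->
  exists2 p, K p & forall k, K k -> form k (v - p) = 0.
Proof.
move=> comp K0 Klin Kcl.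
have KZ a u : K u -> K (a *: u) by move=> Ku; have := Klin a u 0 Ku K0; rewrite addr0.
have KD u w : K u -> K w -> K (u + w) by move=> Ku Kw; have := Klin 1 u w Ku Kw; rewrite scale1r.
pose J := [set sqnorm (v - k) | k in K]; pose m := inf J.
have Jhas : has_inf J.
  split; first by exists (sqnorm (v - 0)), 0.
  by exists 0 => _ [k _ <-]; exact: sqnorm_ge0.
have mJ k : K k -> m <= sqnorm (v - k) by move=> Kk; apply: ge_inf; [case: Jhas|exists k].
have hn (n : nat) : 0 < (n.+1%:R^-1 : R) by rewrite invr_gt0.
have ex n : exists k, K k /\ sqnorm (v - k) < m + n.+1%:R^-1.
  by have [_ [k Kk <-] h] := inf_adherent (hn n) Jhas; exists k.
have [u uP] := choice ex.
have nbig e : 0 < e -> exists N, forall n, (N <= n)%N -> (n.+1%:R^-1 : R) <= e.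
  move=> e0; have /cvgrPdist_le/(_ _ e0)[N _ h] := @cvg_harmonic R.
  by exists N => n /h /=; rewrite sub0r normrN gtr0_norm.
have cau : sqcauchy u.
  move=> e e0; have [|N hN] := nbig (e / 4); first by rewrite divr_gt0.
  exists N => i j /hN hi /hN hj; have [Ki ui] := uP i; have [Kj uj] := uP j.
  have := mJ _ (KZ (2^-1) _ (KD _ _ Ki Kj)).
  (* The parallelogram law: the midpoint lies in [K], so the left side is at least [m], which forces
     [u i] and [u j] together. *)
  have -> : sqnorm (v - 2^-1 *: (u i + u j)) = 2^-1 * sqnorm (v - u i) +
      2^-1 * sqnorm (v - u j) - 4^-1 * sqnorm (u i - u j).
    have -> : v - 2^-1 *: (u i + u j) = 2^-1 *: ((v - u i) + (v - u j)).
      rewrite addrACA -opprD scalerBr; congr (_ - _).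
      by rewrite -{2 3}[v]scale1r -scalerDl scalerA mulVf ?scale1r// pnatr_eq0.
    have -> : u i - u j = (v - u j) - (v - u i) by rewrite opprB [RHS]addrC addrA subrK.
    move: (v - u i) (v - u j) => P Q; rewrite sqnormZ sqnormD sqnormB ncV.
    have -> : nc (2 : R[i]) = 2 by rewrite -(rmorph_nat (real_complex R)) ncR ger0_norm.
    by rewrite (formC Q) Re_conj; field.
  have := lt_le_trans ui (lerD (lexx m) hi); have := lt_le_trans uj (lerD (lexx m) hj).
  clear; move: (sqnorm _) (sqnorm _) (sqnorm _) => x y w ? ? ?; lra.
have [p up] := comp _ cau.
have Kp : K p by apply: (Kcl u) => // n; have [] := uP n.
exists p => // k Kk.
(* The variation is taken around [u n], whose distance to [v] is nearly minimal by construction;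
   replacing [u n] by [p] costs the error [E]. *)
have key k' : K k' -> complex.Re (form k' (v - p)) = 0.
  move=> Kk'; set D := complex.Re _; apply: (@quadratic_ge0 _ (sqnorm k')) => [|s].
    exact: sqnorm_ge0.
  apply/ler_addgt0Pr => e e0.
  (* Cauchy-Schwarz gives [E ^+ 2 <= eta * sqnorm k'], and this [eta] turns it into
     [|4 * s * E| <= e]. *)
  pose eta := e ^+ 2 / (16 * s ^+ 2 * sqnorm k' + 1).
  have N0 := sqnorm_ge0 k'; have q0 : 0 <= 16 * s ^+ 2 * sqnorm k'.
    by rewrite mulr_ge0// mulr_ge0// sqr_ge0.
  have eta0 : 0 < eta by rewrite divr_gt0 ?exprn_gt0// ltr_wpDl.
  have e2 : 0 < e / 2 by rewrite divr_gt0.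
  have [N1 h1] := up _ eta0; have [N2 h2] := nbig _ e2.
  pose n := maxn N1 N2; have := h1 n (leq_maxl _ _) => un; have := h2 n (leq_maxr _ _) => nn.
  have [Kn un'] := uP n.
  have := mJ _ (KD _ _ Kn (KZ (- s)%:C _ Kk')).
  have -> : v - (u n + (- s)%:C *: k') = (v - u n) + s%:C *: k'.
    by rewrite opprD addrA rmorphN scaleNr opprK.
  rewrite sqnormD sqnormZ formZr ncR real_normK ?num_real//.
  have -> : complex.Re (Num.conj s%:C * form (v - u n) k') =
     s * (D + complex.Re (form (p - u n) k')).
    rewrite (_ : Num.conj s%:C = s%:C); last exact: conjc_real.
    rewrite cReM /= mul0r subr0; congr (_ * _).
    by rewrite /D (formC k') Re_conj -cReD -formDl addrA subrK.
  set E := complex.Re (form (p - u n) k').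
  have hE : (4 * s * E) ^+ 2 <= e ^+ 2.
    have : E ^+ 2 <= eta * sqnorm k'.
      apply: le_trans (_ : nc (form (p - u n) k') ^+ 2 <= _).
        by rewrite -real_normK ?num_real// lerXn2r ?nnegrE ?nc_ge0// nc_Re.
      apply: le_trans (form_cauchy_schwarz _ _) _.
      by rewrite ler_wpM2r// sqnormBC.
    move=> h; rewrite (_ : (4 * s * E) ^+ 2 = 16 * s ^+ 2 * E ^+ 2); last by ring.
    apply: le_trans (_ : 16 * s ^+ 2 * (eta * sqnorm k') <= _).
      by rewrite ler_wpM2l// mulr_ge0// sqr_ge0.
    rewrite /eta (_ : _ * (_ * _) = e ^+ 2 * ((16 * s ^+ 2 * sqnorm k') / (16 * s ^+ 2 * sqnorm k' + 1))).
      by rewrite ler_piMr ?sqr_ge0// ler_pdivrMr ?ltr_wpDl// mul1r lerDl.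
    by field; rewrite gt_eqF// ltr_wpDl.
  have {}hE : `|4 * s * E| <= e.
    by rewrite -(@ler_pXn2r _ 2)// ?nnegrE ?(ltW e0)// real_normK ?num_real.
  have := lt_le_trans un' (lerD (lexx m) nn); move: hE; rewrite ler_norml => /andP[].
  rewrite -[4 * s * E]mulrA [s * (D + E)]mulrDr -[2 * s * D]mulrA.
  clear; move: (s * E) (s * D) (s ^+ 2 * _) (sqnorm _) => x y w t ? ? ? ?; lra.
(* The imaginary part is the real part tested against ['i *: k]. *)
have r1 := key _ Kk; have r2 := key _ (KZ 'i _ Kk).
apply: complexP => //; move: r2; rewrite formZl cReM /= mul0r mul1r sub0r => /eqP.
by rewrite oppr_eq0 => /eqP.
Qed.

(** The bound makes the kernel of [l] closed. Either [l] is 0, or the representing vector is a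
    multiple of a vector normal to the kernel. *)
Lemma riesz (l : V -> R[i]) (C : R) : sqcomplete ->
  (forall a u v, l (a *: u + v) = a * l u + l v) ->
  (forall u, nc (l u) ^+ 2 <= C * sqnorm u) ->
  exists w, forall u, l u = form u w.
Proof.
move=> comp llin lb.
have l0 : l 0 = 0.
  have := llin 1 0 0; rewrite scaler0 addr0 mul1r => /eqP.
  by rewrite -[X in X == _]addr0 (can_eq (addKr _)) eq_sym => /eqP.
have lZ a u : l (a *: u) = a * l u by rewrite -[a *: u]addr0 llin l0 addr0.
have lB u v : l (u - v) = l u - l v by rewrite addrC -scaleN1r llin mulN1r addrC.
have [[v lv]|nv] := pselect (exists v, l v != 0); last first.
  exists 0 => u; rewrite formC linear0l rmorph0.
  by apply/eqP; apply: contrapT => /negP h; apply: nv; exists u.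
have [] := @projection [set u | l u = 0] v comp.
- exact: l0.
- by move=> a u w /= lu lw; rewrite llin lu lw mulr0 addr0.
- move=> u w lu uw /=; apply/eqP; rewrite -nc_eq0 -sqrf_eq0 eq_le sqr_ge0 andbT.
  apply/ler_addgt0Pr => e e0; rewrite add0r.
  have C1 : 0 < `|C| + 1 by rewrite ltr_wpDl.
  have [N h] := uw _ (divr_gt0 e0 C1).
  have := lb (u N - w); rewrite lB lu sub0r ncN => /le_trans; apply.
  apply: le_trans (_ : `|C| * (e / (`|C| + 1)) <= _).
    apply: le_trans (_ : `|C| * sqnorm (u N - w) <= _).
      by rewrite ler_wpM2r ?sqnorm_ge0// ler_norm.
    by rewrite ler_wpM2l// h.
  by rewrite mulrCA ler_piMr ?(ltW e0)// ler_pdivrMr// mul1r lerDl.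
move=> p /= lp orth; pose r := v - p.
have lr : l r != 0 by rewrite /r lB lp subr0.
have r0 : sqnorm r != 0.
  by apply: contra lr => /eqP/sqnorm_eq0 ->; rewrite l0.
exists ((Num.conj (l r) / (sqnorm r)%:C) *: r) => u.
have := orth (u - (l u / l r) *: r); rewrite /= -/r lB lZ divfK// subrr => /(_ erefl).
rewrite formBl formZl form_sqnorm => /eqP; rewrite subr_eq0 => /eqP ur.
have c0 : (sqnorm r)%:C != 0 :> R[i] by rewrite -nc_eq0 ncR normr_eq0.
rewrite formZr ur fmorph_div /= (_ : Num.conj (Num.conj (l r)) = l r); last exact: conjcK.
rewrite (_ : Num.conj (sqnorm r)%:C = (sqnorm r)%:C); last exact: conjc_real.
by field; rewrite c0 lr.
Qed.

(* Lax-Milgram: the range of [B] is closed, and its orthogonal is trivial. *)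
Lemma coercive_bijective (B : V -> V) (omega : R[i]) (C de : R) : sqcomplete -> 0 < de ->
  (forall a u v, B (a *: u + v) = a *: B u + B v) ->
  (forall u, sqnorm (B u) <= C * sqnorm u) ->
  (forall u, de * sqnorm u <= complex.Re (omega * form (B u) u)) ->
  exists (S : V -> V) (K : R), [/\ forall v, B (S v) = v, forall u, S (B u) = u,
    forall a u v, S (a *: u + v) = a *: S u + S v & forall v, sqnorm (S v) <= K * sqnorm v].
Proof.
move=> comp de0 Blin Bb Bco.
(* Coercivity and Cauchy-Schwarz bound [de] times the norm of [u] by [nc omega] times the norm of
   [B u]. The square of the ratio makes [B] injective with closed range and bounds its inverse. *)
pose K := (nc omega / de) ^+ 2.
have low u : sqnorm u <= K * sqnorm (B u).
  have := le_trans (Bco u) (le_trans (ler_norm _) (nc_Re _)); rewrite ncM => h.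
  have h2 : (de * sqnorm u) ^+ 2 <= nc omega ^+ 2 * (sqnorm (B u) * sqnorm u).
    apply: le_trans (_ : (nc omega * nc (form (B u) u)) ^+ 2 <= _).
      by rewrite lerXn2r ?nnegrE ?mulr_ge0 ?nc_ge0 ?sqnorm_ge0 ?(ltW de0).
    by rewrite exprMn ler_wpM2l ?sqr_ge0// form_cauchy_schwarz.
  have := sqnorm_ge0 u; rewrite le_eqVlt => /predU1P[<-|u0].
    by rewrite mulr_ge0 ?sqr_ge0 ?sqnorm_ge0.
  rewrite /K expr_div_n mulrAC ler_pdivlMr ?exprn_gt0// -(ler_pM2r u0).
  by move: h2; rewrite exprMn !mulrA; apply: le_trans; rewrite le_eqVlt; apply/orP; left; apply/eqP; ring.
have BB u v : B (u - v) = B u - B v.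
  by rewrite addrC -scaleN1r Blin scaleN1r addrC.
have B0 : B 0 = 0 by have := BB 0 0; rewrite !subrr.
have Binj u v : B u = B v -> u = v.
  move=> uv; apply/eqP; rewrite -subr_eq0; apply/eqP/sqnorm_eq0/eqP.
  by rewrite eq_le sqnorm_ge0 andbT (le_trans (low _))// BB uv subrr sqnorm0 mulr0.
have K1 : 0 < K + 1 by rewrite ltr_wpDl// sqr_ge0.
have C1 : 0 < `|C| + 1 by rewrite ltr_wpDl.
have surj v : exists u, B u = v.
  have [] := @projection (range B) v comp.
  - by exists 0.
  - by move=> a _ _ [u _ <-] [w _ <-]; exists (a *: u + w).
  - move=> y w yB yw; have exB n : exists x, B x = y n.
      by have [x _ <-] := yB n; exists x.
    have [x xy] := choice exB.
    have [x0 xx0] : exists x0, sqcvg x x0.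
      apply: comp => e e0; have e4 : 0 < e / (K + 1) / 4 by rewrite !divr_gt0.
      have [N h] := yw _ e4; exists N => i j /h hi /h hj.
      apply: le_trans (low _) _; rewrite BB !xy.
      apply: le_trans (_ : K * (e / (K + 1)) <= _).
        rewrite ler_wpM2l ?sqr_ge0//.
        rewrite (_ : y i - y j = (y i - w) - (y j - w)); last by rewrite opprB addrA subrK.
        apply: le_trans (sqnormD_le _ _) _; rewrite sqnormN; lra.
      by rewrite mulrCA ler_piMr ?(ltW e0)// ler_pdivrMr// mul1r lerDl.
    exists x0 => //; apply/eqP; rewrite -subr_eq0; apply/eqP/sqnorm_eq0/eqP.
    rewrite eq_le sqnorm_ge0 andbT; apply/ler_addgt0Pr => e e0; rewrite add0r.
    have e4 : 0 < e / 4 by rewrite divr_gt0.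
    have [N1 h1] := yw _ e4; have [N2 h2] := xx0 _ (divr_gt0 e4 C1).
    pose n := maxn N1 N2; have := h1 n (leq_maxl _ _); have := h2 n (leq_maxr _ _) => a1 a2.
    rewrite (_ : B x0 - w = (y n - w) - B (x n - x0)); last first.
      by rewrite BB xy opprB [RHS]addrC addrA subrK.
    apply: le_trans (sqnormD_le _ _) _; rewrite sqnormN.
    have : sqnorm (B (x n - x0)) <= e / 4.
      apply: le_trans (Bb _) _; apply: le_trans (_ : (`|C| + 1) * (e / 4 / (`|C| + 1)) <= _).
        apply: le_trans (_ : (`|C| + 1) * sqnorm (x n - x0) <= _).
          by rewrite ler_wpM2r ?sqnorm_ge0// (le_trans (ler_norm _))// lerDl.
        by rewrite ler_wpM2l// ltW.
      by rewrite mulrC divfK// gt_eqF.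
    lra.
  - move=> _ [u _ <-] orth; exists u; apply/eqP; rewrite -subr_eq0 -opprB oppr_eq0.
    apply/eqP/sqnorm_eq0/eqP; rewrite eq_le sqnorm_ge0 andbT.
    have := Bco (v - B u); rewrite orth ?mulr0; last by exists (v - B u).
    by rewrite pmulr_rle0.
have [S SP] := choice surj.
exists S, K; split=> //.
- by move=> u; apply: Binj; rewrite SP.
- by move=> a u v; apply: Binj; rewrite Blin !SP.
- by move=> v; rewrite -{2}(SP v); exact: low.
Qed.

End hilbert.

(** * The Bergman space of the unit disc *)

Section bergman_generic.
Context {R : realType} {W : set (Cplx R)} (oW : open W).
Implicit Types (f g : bergmanType oW).
Local Notation area := (@lebesgue_measure R \x @lebesgue_measure R)%E.
Local Notation form := (@bergman_dot R W oW).

Lemma bergman_cderivable f : cderivable W f.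
Proof. by move=> w Ww; exact: ((derivable_cder _ _).1 (@bergman_holomorphic R W oW f w Ww)). Qed.

Lemma bergman_ccont f w : W w -> ccont f w.
Proof. by move=> /(bergman_cderivable f)[d /cder_continuous]. Qed.

Lemma bergman_sqr_integrable f :
  aintegrable (plane @^-1` W) (fun p => nc (f (plane p)) ^+ 2).
Proof. exact: bergman_square_integrable. Qed.

Lemma bergman_sqnormE f :
  sqnorm form f = aint (plane @^-1` W) (fun p => nc (f (plane p)) ^+ 2).
Proof. exact: (f_equal (@complex.Re R) (Cintegral_sqr W f)). Qed.

Lemma sqr_integrable_Cintegrable (h : Cplx R -> Cplx R) : (area (plane @^-1` W) < +oo)%E ->
  (forall w, W w -> ccont h w) ->
  aintegrable (plane @^-1` W) (fun p => nc (h (plane p)) ^+ 2) -> Cintegrable W h.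
Proof.
move=> fW ch ih; have mW := measurable_plane oW.
apply: (Cintegrable_le oW ch (aintegrableD mW (integrable_cst_fin 1 mW fW) ih)) => p Wp.
by have := sqr_ge0 (nc (h (plane p)) - 1); have := nc_ge0 (h (plane p)); nra.
Qed.

Lemma bergman_mem (h : Cplx R -> Cplx R) : cderivable W h ->
  aintegrable (plane @^-1` W) (fun p => nc (h (plane p)) ^+ 2) ->
  (forall w, ~ W w -> h w = 0) -> h \in bergman_pred oW.
Proof.
by move=> dh ih h0; rewrite inE; split=> // w /dh/derivable_cder.
Qed.

(** Elements of the Bergman space are represented by functions vanishing off [W]; this adapts a
    formula to that convention. *)
Definition bergman_cut (h : Cplx R -> Cplx R) (w : Cplx R) : Cplx R :=
  if `[< W w >] then h w else 0.

Lemma bergman_cutE h w : W w -> bergman_cut h w = h w.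
Proof. by move=> Ww; rewrite /bergman_cut asboolT. Qed.

Lemma cderivable_cut h : cderivable W h -> cderivable W (bergman_cut h).
Proof.
move=> dh w Ww; have [d hd] := dh w Ww; exists d; apply: cder_near hd.
have : \forall u \near w, W u by exact: open_nbhs_nbhs.
by apply: filterS => u /bergman_cutE ->.
Qed.

Lemma bergman_cut_mem (h : Cplx R -> Cplx R) : cderivable W h ->
  aintegrable (plane @^-1` W) (fun p => nc (h (plane p)) ^+ 2) ->
  bergman_cut h \in bergman_pred oW.
Proof.
move=> dh ih; apply: bergman_mem; first exact: cderivable_cut.
  apply: eq_aintegrable ih; first exact: measurable_plane.
  by move=> p Wp; rewrite bergman_cutE.
by move=> w Ww; rewrite /bergman_cut asboolF.
Qed.

Lemma bounded_sqr_integrable (h : Cplx R -> Cplx R) (M : R) :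
  (area (plane @^-1` W) < +oo)%E -> (forall w, W w -> ccont h w) ->
  (forall w, W w -> nc (h w) <= M) ->
  aintegrable (plane @^-1` W) (fun p => nc (h (plane p)) ^+ 2).
Proof.
move=> fW ch hM; have mW := measurable_plane oW.
apply: (aintegrable_le mW _ (integrable_cst_fin (M ^+ 2) mW fW)).
  by apply: measurable_funX; exact: (ccont_measurable_nc oW ch).
move=> p Wp; rewrite ger0_norm ?sqr_ge0// lerXn2r ?nnegrE ?nc_ge0//; last exact: hM.
by rewrite (le_trans (nc_ge0 _) (hM _ Wp)).
Qed.

Lemma bergmanP f g : (forall w, W w -> f w = g w) -> f = g.
Proof.
move=> fg; apply/val_inj/funext => w; have [/fg//|nW] := pselect (W w).
by rewrite /= !bergman_out.
Qed.

End bergman_generic.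

Section limits.
Context {R : realType}.
Implicit Types (D : set (R * R)).
Local Notation area := (@lebesgue_measure R \x @lebesgue_measure R)%E.

Lemma real_cauchy_cvg (x : nat -> R) :
  (forall e : R, 0 < e -> exists N, forall m n, (N <= m)%N -> (N <= n)%N -> `|x m - x n| <= e) ->
  exists l : R, x @ \oo --> l.
Proof.
move=> cx; have /cauchy_cvgP cvx : cauchy (x @ \oo).
  apply: cauchy_exP => e e0; have [N h] := cx _ (divr_gt0 e0 (@ltr0Sn R 1)).
  exists (x N); exists N => // n Nn /=.
  rewrite /ball/=; apply: le_lt_trans (h N n (leqnn _) Nn) _; lra.
by exists (lim (x @ \oo)).
Qed.

Lemma complex_cauchy_cvg (z : nat -> R[i]) :
  (forall e, 0 < e -> exists N, forall m n, (N <= m)%N -> (N <= n)%N -> nc (z m - z n) <= e) ->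
  exists l : R[i], forall e, 0 < e -> exists N, forall n, (N <= n)%N -> nc (z n - l) <= e.
Proof.
move=> cz.
have [|x xl] := real_cauchy_cvg (x := fun n => complex.Re (z n)).
  move=> e /cz[N h]; exists N => m n Nm Nn; rewrite -RecB.
  exact: le_trans (nc_Re _) (h _ _ Nm Nn).
have [|y yl] := real_cauchy_cvg (x := fun n => complex.Im (z n)).
  move=> e /cz[N h]; exists N => m n Nm Nn; rewrite -ImcB.
  exact: le_trans (nc_Im _) (h _ _ Nm Nn).
exists (x +i* y) => e e0; have e2 : 0 < e / 2 by rewrite divr_gt0.
have /cvgrPdist_le/(_ _ e2)[N1 _ h1] := xl; have /cvgrPdist_le/(_ _ e2)[N2 _ h2] := yl.
exists (maxn N1 N2) => n; rewrite geq_max => /andP[/h1/= a1 /h2/= a2].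
apply: le_trans (nc_le_ReIm _) _; rewrite RecB ImcB /= distrC [X in _ + X]distrC; lra.
Qed.

(** Fatou's lemma with the integrability of the limit as part of the conclusion, from a bound that
    holds only eventually. *)
Lemma fatou_bound D (g_ : nat -> R * R -> R) (g : R * R -> R) (c : R) (N : nat) :
  measurable D -> (forall n, measurable_fun D (g_ n)) -> measurable_fun D g ->
  (forall n p, D p -> 0 <= g_ n p) ->
  (forall p, D p -> (fun n => g_ n p) @ \oo --> g p) ->
  (forall n, (N <= n)%N -> aintegrable D (g_ n) /\ aint D (g_ n) <= c) ->
  aintegrable D g /\ aint D g <= c.
Proof.
move=> mD mg_ mg g_0 g_g gc.
have g0 p : D p -> 0 <= g p.
  by move=> Dp; rewrite -(cvg_lim _ (g_g p Dp))//; apply: limr_ge; first (by apply/cvg_ex; exists (g p); exact: g_g); apply: nearW => n; exact: g_0.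
have H : (\int[area]_(p in D) (g p)%:E <= c%:E)%E.
  have -> : (\int[area]_(p in D) (g p)%:E)%E =
      (\int[area]_(p in D) limn_einf (fun n => (g_ n p)%:E))%E.
    apply: eq_integral => p /set_mem Dp.
    have gp : (fun n => (g_ n p)%:E) @ \oo --> (g p)%:E.
      by apply: cvg_EFin; [exact: nearW|exact: g_g].
    by rewrite is_cvg_limn_einfE; [rewrite (cvg_lim _ gp)|apply/cvg_ex; eexists; exact: gp].
  apply: le_trans (fatou area mD (fun n => (measurable_EFinP _ _).2 (mg_ n)) _) _.
    by move=> n p Dp; rewrite lee_fin g_0.
  rewrite limn_einf_lim; apply: lime_le; first exact: is_cvg_einfs.
  (* The index [maxn k N] belongs both to the tail starting at [k] and to the range where the bound
     holds. *)
  apply: nearW => k; apply: le_trans (_ : (\int[area]_(p in D) (g_ (maxn k N) p)%:E <= _)%E).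
    by apply: ereal_inf_lbound; exists (maxn k N) => //=; exact: leq_maxl.
  have [i_g h] := gc (maxn k N) (leq_maxr _ _).
  by rewrite -(fineK (@integrable_fin_num _ _ _ area _ mD _ i_g)) lee_fin.
have ig : aintegrable D g.
  apply/integrableP; split; first exact/measurable_EFinP.
  apply: le_lt_trans (ltry c); apply: le_trans H; rewrite le_eqVlt; apply/orP; left; apply/eqP.
  by apply: eq_integral => p /set_mem Dp; rewrite /= ger0_norm// g0.
split=> //; rewrite -lee_fin; apply: le_trans H; rewrite /aint /Rintegral fineK//.
exact: integrable_fin_num.
Qed.

End limits.

(** * Point evaluations and completeness on the unit disc *)

Section bergman_disc.
Context {R : realType} (oD : open (cdisc (0 : Cplx R) 1)).
Implicit Types (f g : bergmanType oD) (z w : Cplx R).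
Local Notation area := (@lebesgue_measure R \x @lebesgue_measure R)%E.
Local Notation D := (cdisc (0 : Cplx R) 1).
Local Notation form := (@bergman_dot R D oD).
Local Notation A := (disc_area (0 : Cplx R) 1).

Lemma bker_sqr_cderivable z : nc (z - 0) < 1 -> cderivable D (fun w => bker 0 1 z w ^+ 2).
Proof.
move=> zr w /ltW wr; have d := cder_bker ltr01 zr wr; eexists; exact: (cderM d d).
Qed.

Lemma bker_sqr_le z w (t : R) : nc (z - 0) <= t -> t < 1 -> D w ->
  nc (bker 0 1 z w ^+ 2) <= (1 / (1 - t)) ^+ 2.
Proof.
move=> zt t1 /ltW wr; rewrite ncX; apply: lerXn2r; rewrite ?nnegrE ?nc_ge0//.
  by rewrite divr_ge0 ?subr_ge0 ?ltW.
exact: bker_le.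
Qed.

Lemma bker_sqr_integrable z : nc (z - 0) < 1 ->
  aintegrable (plane @^-1` D) (fun p => nc (bker 0 1 z (plane p) ^+ 2) ^+ 2).
Proof.
move=> zr; apply: (bounded_sqr_integrable oD (h := fun w => bker 0 1 z w ^+ 2)).
- exact: area_cdisc_fin.
- by move=> w /(bker_sqr_cderivable zr)[d /cder_continuous].
- by move=> w; exact: bker_sqr_le.
Qed.

Definition bergman_kernel z (zr : nc (z - 0) < 1) : bergmanType oD :=
  Bergman (bergman_cut_mem oD (bker_sqr_cderivable zr) (bker_sqr_integrable zr)).

Lemma bergman_kernelE z (zr : nc (z - 0) < 1) w : D w ->
  bergman_kernel zr w = bker 0 1 z w ^+ 2.
Proof. exact: bergman_cutE. Qed.

Lemma bergman_Cintegrable f : Cintegrable D f.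
Proof.
apply: (sqr_integrable_Cintegrable oD (area_cdisc_fin _ _)); first exact: bergman_ccont.
exact: bergman_sqr_integrable.
Qed.

Lemma bergman_repro f z (zr : nc (z - 0) < 1) :
  form f (bergman_kernel zr) = A%:C * f z.
Proof.
rewrite -(repro ltr01 zr (bergman_cderivable f) (bergman_Cintegrable f)).
by apply: eq_Cintegral => w Dw; rewrite bergman_kernelE.
Qed.

(** Cauchy-Schwarz against the kernel, whose norm is estimated crudely by its supremum. What matters
    is that the constant is uniform on [nc z <= t]. *)
Lemma bergman_eval_le f z (t : R) : nc (z - 0) <= t -> t < 1 ->
  nc (f z) ^+ 2 <= (1 / (1 - t)) ^+ 4 / A * sqnorm form f.
Proof.
move=> zt t1; have zr := le_lt_trans zt t1; have A0 := disc_area_gt0 (0 : Cplx R) (@ltr01 R).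
have h0 := form_cauchy_schwarz form f (bergman_kernel zr).
have {h0} : nc (A%:C * f z) ^+ 2 <= sqnorm form f * sqnorm form (bergman_kernel zr).
  by rewrite -(bergman_repro f zr).
rewrite ncM ncR gtr0_norm// exprMn => h.
have mD := measurable_plane oD.
have k_le : sqnorm form (bergman_kernel zr) <= (1 / (1 - t)) ^+ 4 * A.
  rewrite bergman_sqnormE.
  have -> : (1 / (1 - t)) ^+ 4 * A = aint (plane @^-1` D) (fun=> (1 / (1 - t)) ^+ 4 * 1).
    by rewrite aintZ//; apply: integrable_cst_fin => //; exact: area_cdisc_fin.
  apply: aint_le => //; first exact: bergman_sqr_integrable.
    by apply: integrable_cst_fin => //; exact: area_cdisc_fin.
  move=> p Dp; rewrite bergman_kernelE// mulr1 [in leRHS](exprM _ 2 2).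
  by apply: lerXn2r; rewrite ?nnegrE ?nc_ge0 ?sqr_ge0//; exact: bker_sqr_le.
rewrite -(ler_pM2l (exprn_gt0 2 A0)); apply: le_trans h _.
rewrite mulrC; apply: le_trans (ler_wpM2r (sqnorm_ge0 form f) k_le) _.
by rewrite le_eqVlt; apply/orP; left; apply/eqP; field; rewrite gt_eqF//= gt_eqF// subr_gt0.
Qed.

(* The locally uniform limit f satisfies f = A^-1 * int f conj(k), hence is
   holomorphic by kernel_cder. *)
Lemma bergman_complete : sqcomplete form.
Proof.
move=> u cu; have A0 := disc_area_gt0 (0 : Cplx R) (@ltr01 R).
have mD := measurable_plane oD.
(* A weighted mean inequality, in place of Cauchy-Schwarz: it will bound an integral against the
   kernel while [f] is not yet known to belong to the space. *)
have amgm (m b x : R) : 0 < m -> 0 < b -> 0 <= x -> x * m <= m * b + m / b * x ^+ 2.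
  move=> m0 b0 x0; have -> : m * b + m / b * x ^+ 2 = m * (b + x ^+ 2 / b) by field; rewrite gt_eqF.
  rewrite mulrC ler_pM2l//.
  have : 0 <= (x - b) ^+ 2 / b by rewrite divr_ge0 ?sqr_ge0 ?ltW.
  have -> : (x - b) ^+ 2 / b = x ^+ 2 / b + b - 2 * x by field; rewrite gt_eqF.
  lra.
(* By the evaluation bound, a Cauchy sequence in norm is uniformly Cauchy on smaller discs. *)
have ptw (t : R) : t < 1 -> forall e, 0 < e -> exists N, forall m n z,
    (N <= m)%N -> (N <= n)%N -> nc (z - 0) <= t -> nc (u m z - u n z) <= e.
  move=> t1 e e0; pose C := (1 / (1 - t)) ^+ 4 / A.
  have C0 : 0 < C by rewrite divr_gt0// exprn_gt0// divr_gt0// subr_gt0.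
  have [N h] := cu _ (divr_gt0 (exprn_gt0 2 e0) C0); exists N => m n z Nm Nn zt.
  rewrite -(@ler_pXn2r _ 2)// ?nnegrE ?nc_ge0 ?(ltW e0)//.
  apply: le_trans (bergman_eval_le (u m - u n) zt t1) _.
  by rewrite mulrC -ler_pdivlMr//; exact: h.
have lim_ex z : exists l : R[i], (nc (z - 0) < 1 -> forall e, 0 < e ->
    exists N, forall n, (N <= n)%N -> nc (u n z - l) <= e) /\ (~ nc (z - 0) < 1 -> l = 0).
  have [z1|z1] := pselect (nc (z - 0) < 1); last by exists 0.
  have [|l h] := @complex_cauchy_cvg R (fun n => u n z); last by exists l.
  by move=> e e0; have [N h] := ptw _ z1 _ e0; exists N => m n Nm Nn; exact: h.
have [f fP] := choice lim_ex.
have unif (t : R) : t < 1 -> forall e, 0 < e -> exists N, forall n z,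
    (N <= n)%N -> nc (z - 0) <= t -> nc (u n z - f z) <= e.
  move=> t1 e e0; have e2 : 0 < e / 2 by rewrite divr_gt0.
  have [N h] := ptw t t1 _ e2; exists N => n z Nn zt.
  have [N' h'] := (fP z).1 (le_lt_trans zt t1) _ e2.
  rewrite (_ : u n z - f z = (u n z - u (maxn N N') z) + (u (maxn N N') z - f z)); last by ring.
  apply: le_trans (ncD _ _) _.
  have := h n (maxn N N') z Nn (leq_maxl _ _) zt; have := h' (maxn N N') (leq_maxr _ _); lra.
have cf w : D w -> ccont f w.
  move=> w1; apply/ccontP => e e0; pose t := (1 + nc (w - 0)) / 2.
  have t1 : t < 1 by move: w1; rewrite /cdisc/= /t; lra.
  have wt : nc (w - 0) < t by move: w1; rewrite /cdisc/= /t; lra.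
  have e4 : 0 < e / 4 by rewrite divr_gt0.
  have [N h] := unif t t1 _ e4.
  have /ccontP/(_ _ e4) cN := bergman_ccont (f := u N) w1.
  have near_t : \forall v \near w, nc (v - 0) < t by apply: open_nbhs_nbhs; split; [exact: (@cdisc_open R 0 t)|].
  near=> v.
  have v1 : nc (u N v - u N w) < e / 4 by near: v.
  have v2 : nc (v - 0) < t by near: v.
  have a1 := h N v (leqnn _) (ltW v2); have a2 := h N w (leqnn _) (ltW wt).
  rewrite (_ : f v - f w = (u N v - u N w) - (u N v - f v) + (u N w - f w)); last by ring.
  apply: le_lt_trans (ncD _ _) _; apply: le_lt_trans (lerD (ncB _ _) (lexx _)) _; lra.
have cd m w : D w -> ccont (fun w => f w - u m w) w.
  by move=> w1; exact: (ccontB (cf w w1) (bergman_ccont (f := u m) w1)).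
(* Fatou's lemma carries the Cauchy estimate over to the pointwise limit. *)
have bnd m c N : (forall n, (N <= n)%N -> sqnorm form (u n - u m) <= c) ->
    aintegrable (plane @^-1` D) (fun p => nc (f (plane p) - u m (plane p)) ^+ 2) /\
    aint (plane @^-1` D) (fun p => nc (f (plane p) - u m (plane p)) ^+ 2) <= c.
  move=> h; apply: (@fatou_bound _ _ (fun n p => nc ((u n - u m) (plane p)) ^+ 2) _ c N mD).
  - move=> n; apply: measurable_funX; apply: (ccont_measurable_nc oD).
    by move=> w; exact: bergman_ccont.
  - by apply: measurable_funX; exact: (ccont_measurable_nc oD (cd m)).
  - by move=> n p _; exact: sqr_ge0.
  - move=> p Dp; set w := plane p.
    have : (fun n => nc ((u n - u m) w)) @ \oo --> nc (f w - u m w).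
      apply/cvgrPdist_le => e e0; have [N' h'] := (fP w).1 Dp _ e0.
      exists N' => // n /= /h' h1; apply: le_trans h1.
      have := ncB_ge (f w - u m w) ((u n - u m) w); have := ncB_ge ((u n - u m) w) (f w - u m w).
      rewrite -[(u n - u m) w]/(u n w - u m w).
      have -> : u n w - u m w - (f w - u m w) = u n w - f w by ring.
      have -> : f w - u m w - (u n w - u m w) = - (u n w - f w) by ring.
      by rewrite ncN => ? ?; rewrite ler_norml; apply/andP; split; lra.
    by move=> hc; rewrite expr2; under eq_fun do rewrite expr2; exact: cvgM.
  - move=> n /h; rewrite bergman_sqnormE; split=> //; exact: bergman_sqr_integrable.
have small e : 0 < e -> exists N, forall m, (N <= m)%N ->
    aintegrable (plane @^-1` D) (fun p => nc (f (plane p) - u m (plane p)) ^+ 2) /\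
    aint (plane @^-1` D) (fun p => nc (f (plane p) - u m (plane p)) ^+ 2) <= e.
  by move=> /cu[N h]; exists N => m Nm; apply: (bnd m e N) => n Nn; exact: h.
have i_f : aintegrable (plane @^-1` D) (fun p => nc (f (plane p)) ^+ 2).
  have [N /(_ N (leqnn _))[h _]] := small 1 ltr01.
  have := aintegrableD mD (aintegrableZ 2 mD h) (aintegrableZ 2 mD (bergman_sqr_integrable (u N))).
  move=> hs; apply: (aintegrable_le mD _ hs); first by apply: measurable_funX; exact: (ccont_measurable_nc oD cf).
  move=> p Dp; rewrite ger0_norm ?sqr_ge0//; set x := f _; set y := u N _.
  have := ncD (x - y) y; rewrite subrK; have := nc_ge0 x; have := nc_ge0 (x - y); have := nc_ge0 y.
  by have := sqr_ge0 (nc (x - y) - nc y); nra.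
have If := sqr_integrable_Cintegrable oD (area_cdisc_fin _ _) cf i_f.
have rep z : nc (z - 0) < 1 ->
    A%:C^-1 * Cintegral D (fun w => f w * jker 0 1 z w ^+ 2) = f z.
  move=> z1.
  have Ac : A%:C != 0 :> Cplx R by rewrite -nc_eq0 ncR normr_eq0 gt_eqF.
  have ij := jker_Cintegrable 2 ltr01 z1 cf If.
  suff : Cintegral D (fun w => f w * jker 0 1 z w ^+ 2) = A%:C * f z.
    by move=> ->; rewrite mulrA mulVf// mul1r.
  apply/eqP; rewrite -subr_eq0 -nc_eq0 eq_le nc_ge0 andbT; apply/ler_addgt0Pr => e e0; rewrite add0r.
  pose M := (1 / (1 - nc (z - 0))) ^+ 2.
  have M0 : 0 < M by rewrite exprn_gt0// divr_gt0// subr_gt0.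
  (* With weight [e1] the mean inequality bounds the integral by [M * e1 * (A + 1) = e / 4], which
     [Cintegral_le] doubles. *)
  pose e1 := e / (4 * M * (A + 1)).
  have A10 : 0 < A + 1 by rewrite addr_gt0.
  have e10 : 0 < e1 by exact: (divr_gt0 e0 (mulr_gt0 (mulr_gt0 (ltr0Sn R 3) M0) A10)).
  have [N1 h1] := small (e1 ^+ 2) (exprn_gt0 _ e10).
  have e20 : 0 < e / (2 * A) by rewrite divr_gt0// mulr_gt0.
  have [N2 h2] := (fP z).1 z1 _ e20.
  pose m := maxn N1 N2; have [i1 b1] := h1 m (leq_maxl _ _); have b2 := h2 m (leq_maxr _ _).
  have rm : Cintegral D (fun w => u m w * jker 0 1 z w ^+ 2) = A%:C * u m z.
    rewrite -(repro ltr01 z1 (bergman_cderivable (u m)) (bergman_Cintegrable (u m))).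
    by apply: eq_Cintegral => w _; rewrite /jker rmorphXn.
  have ijm := jker_Cintegrable 2 ltr01 z1 (fun w => @bergman_ccont _ _ oD (u m) w) (bergman_Cintegrable (u m)).
  have := CintegralB oD ij ijm; rewrite rm => E.
  rewrite (_ : _ - A%:C * f z = (Cintegral D (fun w => f w * jker 0 1 z w ^+ 2) - A%:C * u m z) +
      A%:C * (u m z - f z)); last by ring.
  rewrite -E; apply: le_trans (ncD _ _) _; rewrite [nc (A%:C * _)]ncM ncR gtr0_norm//.
  have bA : A * nc (u m z - f z) <= e / 2.
    by rewrite mulrC -ler_pdivlMr// -mulrA -invfM.
  have bI : nc (Cintegral D (fun w => f w * jker 0 1 z w ^+ 2 - u m w * jker 0 1 z w ^+ 2)) <= e / 2.
    have iG := aintegrableD mD (integrable_cst_fin (M * e1) mD (area_cdisc_fin 0 1))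
      (aintegrableZ (M / e1) mD i1).
    apply: le_trans (Cintegral_le oD (CintegrableB oD ij ijm) iG _) _.
      move=> p Dp; rewrite -mulrBl [nc (_ * _)]ncM.
      have jM : nc (jker 0 1 z (plane p) ^+ 2) <= M.
        by rewrite ncX ncJC -ncX; exact: bker_sqr_le.
      apply: le_trans (ler_wpM2l (nc_ge0 _) jM) _; set x := nc _.
      exact: (amgm _ _ _ M0 e10 (nc_ge0 _)).
    rewrite aintD//; [|exact: integrable_cst_fin (area_cdisc_fin 0 1)|exact: aintegrableZ].
    have -> : aint (plane @^-1` D) (fun=> M * e1) = M * e1 * A.
      rewrite -aintZ//; last exact: integrable_cst_fin (area_cdisc_fin 0 1).
      by apply: eq_aint => p _; rewrite mulr1.
    rewrite aintZ//.
    have : M / e1 * aint (plane @^-1` D) (fun p => nc (f (plane p) - u m (plane p)) ^+ 2) <= M * e1.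
      apply: le_trans (ler_wpM2l _ b1) _; first by rewrite divr_ge0 ?ltW.
      by rewrite expr2 mulrA divfK// gt_eqF.
    have : M * e1 * (A + 1) = e / 4 by rewrite /e1; field; rewrite !gt_eqF// addr_gt0.
    by rewrite mulrDr mulr1; lra.
  lra.
have df : cderivable D f.
  move=> z z1; have d := cderZ A%:C^-1 (kernel_cder 2 ltr01 z1 cf If).
  eexists; apply: cder_near d.
  have : \forall w \near z, D w by exact: open_nbhs_nbhs.
  by apply: filterS => w; exact: rep.
have f0 w : ~ D w -> f w = 0 by exact: (fP w).2.
exists (Bergman (bergman_mem oD df i_f f0)) => e e0.
have [N h] := small e e0; exists N => n Nn.
by rewrite sqnormBC bergman_sqnormE; have [] := h n Nn.
Unshelve. all: by end_near. Qed.

End bergman_disc.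

(** * The operator of a horodisc *)

Section subdomains.
Context {R : realType}.
Implicit Types (B D : set (R * R)) (U V W : set (Cplx R)).
Local Notation area := (@lebesgue_measure R \x @lebesgue_measure R)%E.

Lemma aintegrableS D B h : measurable D -> measurable B -> B `<=` D ->
  aintegrable D h -> aintegrable B h.
Proof. by move=> mD mB BD; exact: (@integrableS _ _ _ area _ _ _ mD mB BD). Qed.

Lemma aint_setU D B h : measurable D -> measurable B -> D `&` B = set0 ->
  aintegrable (D `|` B) h -> aint (D `|` B) h = aint D h + aint B h.
Proof.
move=> mD mB DB ih; apply: (@Rintegral_setU _ _ _ area _ _ h mD mB ih).
by apply/disj_setPS; rewrite DB.
Qed.

Lemma aint_ge0 D h : (forall p, D p -> 0 <= h p) -> 0 <= aint D h.
Proof. by move=> h0; apply: Rintegral_ge0. Qed.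

Lemma aint_subset_le D B h : measurable D -> measurable B -> B `<=` D ->
  (forall p, D p -> 0 <= h p) -> aintegrable D h -> aint B h <= aint D h.
Proof.
move=> mD mB BD h0 ih; have E := setDUK BD.
rewrite -E aint_setU ?E//; [|exact: measurableD|by rewrite setDIK].
by rewrite lerDl; apply: aint_ge0 => p [/h0].
Qed.

Lemma CintegrableS W V g : open W -> open V -> V `<=` W -> Cintegrable W g -> Cintegrable V g.
Proof.
move=> oW oV VW [i1 i2].
have [mW mV] := (measurable_plane oW, measurable_plane oV).
by split; [apply: (aintegrableS mW mV _ i1)|apply: (aintegrableS mW mV _ i2)] => p /VW.
Qed.

End subdomains.

Lemma form_inj {R : realType} {V : lmodType R[i]} (form : {dot V for Num.conj}) (x y : V) :
  (forall u, form x u = form y u) -> x = y.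
Proof.
move=> h; apply/eqP; rewrite -subr_eq0; apply/eqP/(@sqnorm_eq0 _ _ form).
by rewrite /sqnorm formBl h subrr.
Qed.

(** * The operator T_U for an open subset of the disc *)

Section gram.
Context {R : realType} (oD : open (cdisc (0 : Cplx R) 1)).
Context (U : set (Cplx R)) (oU : open U) (UD : U `<=` cdisc (0 : Cplx R) 1).
Local Notation D := (cdisc (0 : Cplx R) 1).
Local Notation dotD := (@bergman_dot R D oD).
Local Notation dotU := (@bergman_dot R U oU).
Local Notation A := (disc_area (0 : Cplx R) 1).
Local Notation res := (@restriction R D U oD oU UD).
Local Notation T := (restriction_gram oD oU UD).
Implicit Types (f g u : bergmanType oD).

Lemma restrictE f w : U w -> res f w = f w.
Proof. by move=> Uw; rewrite /restriction/= patchE mem_set. Qed.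

Lemma restrict_linear a f g : res (a *: f + g) = a *: res f + res g.
Proof.
apply: bergmanP => w Uw; rewrite restrictE//.
rewrite -[RHS]/(a * res f w + res g w) !restrictE//.
Qed.

Lemma sqnorm_restrict_le f : sqnorm dotU (res f) <= sqnorm dotD f.
Proof.
rewrite !bergman_sqnormE; have mD := measurable_plane oD; have mU := measurable_plane oU.
rewrite (@eq_aint _ _ _ (fun p => nc (f (plane p)) ^+ 2)); last by move=> p /restrictE ->.
apply: aint_subset_le => //; [by move=> p /UD|by move=> *; exact: sqr_ge0|].
exact: bergman_sqr_integrable.
Qed.

(** [adjoint] is picked by choice, so its defining property holds as soon as some adjoint exists.
    Riesz representation on the disc provides one, restriction being a contraction. *)
Lemma adjoint_restriction u (v : bergmanType oU) :
  dotU (res u) v = dotD u (adjoint dotD dotU res v).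
Proof.
suff [B hB] : exists B : bergmanType oU -> bergmanType oD,
    forall u v, dotU (res u) v = dotD u (B v).
  rewrite /adjoint; case: xgetP => [_ -> h|/(_ B) //]; exact: h.
have ex v' : exists w, forall u, dotU (res u) v' = dotD u w.
  apply: (@riesz _ _ dotD (fun u => dotU (res u) v') (sqnorm dotU v')).
  - exact: bergman_complete.
  - by move=> a f g; rewrite restrict_linear [LHS]bergman_dot_linear.
  - move=> f; apply: le_trans (form_cauchy_schwarz dotU (res f) v') _.
    by rewrite mulrC ler_wpM2l ?sqnorm_ge0// sqnorm_restrict_le.
have [B hB] := choice ex; exists B => *; exact: hB.
Qed.

Lemma gram_dot u f : dotD u (T f) = dotU (res u) (res f).
Proof. by rewrite adjoint_restriction. Qed.

Lemma gram_dotl u f : dotD (T u) f = dotU (res u) (res f).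
Proof. by rewrite (bergman_dotC (T u)) gram_dot -bergman_dotC. Qed.

Lemma gram_linear a f g : T (a *: f + g) = a *: T f + T g.
Proof.
apply: (@form_inj _ _ dotD) => u.
suff : dotD (T (a *: f + g)) u = dotD (a *: T f + T g) u by [].
by rewrite bergman_dot_linear !gram_dotl restrict_linear bergman_dot_linear.
Qed.

Lemma gram_selfadjoint u f : dotD (T u) f = dotD u (T f).
Proof. by rewrite gram_dotl gram_dot. Qed.

Lemma gram_form f : dotD (T f) f = (sqnorm dotU (res f))%:C.
Proof. by rewrite gram_selfadjoint gram_dot form_sqnorm. Qed.

(** Reproduce [T f] at [z], then move [T] onto the kernel: what remains is an inner product over
    [U], the formula T_U f = P(chi_U f) at [z]. *)
Lemma gram_integral f z : nc (z - 0) < 1 ->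
  A%:C * T f z = Cintegral U (fun w => f w * Num.conj (bker 0 1 z w ^+ 2)).
Proof.
move=> zr; rewrite -(bergman_repro (T f) zr) [LHS]gram_selfadjoint gram_dot.
apply: eq_Cintegral => w Uw; rewrite !restrictE// bergman_kernelE//; exact: UD.
Qed.

(** The squared norm of [T f] is the inner product over [U] of [T f] and [f]; Cauchy-Schwarz bounds
    it by the product of their norms on the disc. *)
Lemma sqnorm_gram_le f : sqnorm dotD (T f) <= sqnorm dotD f.
Proof.
have : nc (sqnorm dotD (T f))%:C ^+ 2 <= sqnorm dotU (res (T f)) * sqnorm dotU (res f).
  have -> : (sqnorm dotD (T f))%:C = dotU (res (T f)) (res f).
    by rewrite -gram_dot; exact: (esym (form_sqnorm dotD (T f))).
  exact: (form_cauchy_schwarz dotU).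
rewrite ncR ger0_norm ?sqnorm_ge0// => h.
have := sqnorm_ge0 dotD (T f); rewrite le_eqVlt => /predU1P[<-|T0]; first exact: sqnorm_ge0.
rewrite -(ler_pM2l T0) -expr2; apply: le_trans h _.
by apply: ler_pM; rewrite ?sqnorm_ge0 ?sqnorm_restrict_le.
Qed.

End gram.

Lemma rcB {R : realType} (x y : R) : (x - y)%:C = x%:C - y%:C :> Cplx R.
Proof. exact: rmorphB. Qed.

Lemma rcN {R : realType} (x : R) : (- x)%:C = - x%:C :> Cplx R.
Proof. exact: rmorphN. Qed.

Lemma rcD {R : realType} (x y : R) : (x + y)%:C = x%:C + y%:C :> Cplx R.
Proof. exact: rmorphD. Qed.

Lemma rcM {R : realType} (x y : R) : (x * y)%:C = x%:C * y%:C :> Cplx R.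
Proof. exact: rmorphM. Qed.

Lemma rcX {R : realType} (x : R) n : (x ^+ n)%:C = x%:C ^+ n :> Cplx R.
Proof. exact: rmorphXn. Qed.

(** * Geometry and kernel of a horodisc *)

Section horodisc.
Context {R : realType} (p : Cplx R) (p1 : nc p = 1).
Implicit Types (z w : Cplx R) (s t : R) (f : Cplx R -> Cplx R).
Local Notation D := (cdisc (0 : Cplx R) 1).
Local Notation A := (disc_area (0 : Cplx R) 1).

(* In the coordinate [1 / hv z], which maps the unit disc to a half-plane and
   [p] to infinity, [hmap s] is the translation by [s]. *)
Definition hv z : Cplx R := 1 - Num.conj p * z.
Definition hden s z : Cplx R := 1 + s%:C * hv z.
Definition hmap s z : Cplx R := p * (1 - hv z / hden s z).
(** In the coordinate [1 / hv] the unit disc is the half-plane Re > 1/2 and the horodisc of this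
    radius is Re > (1 + s) / 2, while the image of the disc under [hmap s] is Re > 1/2 + s. *)
Definition hrad s : R := (1 + s)^-1.
Definition hcen s : Cplx R := (1 - hrad s)%:C * p.
Definition hdisc s := cdisc (hcen s) (hrad s).
(** C_s of the overview. The factor in front is the derivative of [hmap s], which is why these
    operators compose by the chain rule. *)
Definition hop s f z : Cplx R := (hden s z)^-1 ^+ 2 * f (hmap s z).

Lemma conjp_p : Num.conj p * p = 1.
Proof. by have := mul_conjc p; rewrite p1 expr1n mulrC => ->. Qed.

Lemma hvK z : p * (1 - hv z) = z.
Proof. by rewrite /hv subKr mulrA [p * _]mulrC conjp_p mul1r. Qed.

Lemma Re_hv_gt0 z : D z -> 0 < complex.Re (hv z).
Proof.
rewrite /cdisc/= subr0 => z1; rewrite RecB subr_gt0; apply: le_lt_trans (ler_norm _) _.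
by apply: le_lt_trans (nc_Re _) _; rewrite ncM ncJC p1 mul1r.
Qed.

Lemma Re_hden_ge1 s z : 0 <= s -> D z -> 1 <= complex.Re (hden s z).
Proof.
move=> s0 /Re_hv_gt0 v0; rewrite cReD cReM /= mul0r subr0 lerDl.
by rewrite mulr_ge0// ltW.
Qed.

Lemma hden_neq0 s z : 0 <= s -> D z -> hden s z != 0.
Proof.
move=> s0 /(Re_hden_ge1 s0); apply: contraTneq => ->; rewrite /= -ltNge; exact: ltr01.
Qed.

Lemma hrad_gt0 s : 0 <= s -> 0 < hrad s.
Proof. by move=> s0; rewrite invr_gt0 ltr_pwDl. Qed.

Lemma hrad_le1 s : 0 <= s -> hrad s <= 1.
Proof. by move=> s0; rewrite invf_le1 ?ltr_pwDl// lerDl. Qed.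

Lemma hdisc_open s : open (hdisc s). Proof. exact: (@cdisc_open R). Qed.

Lemma hdisc_sub s : 0 <= s -> hdisc s `<=` D.
Proof.
move=> s0 w; rewrite /hdisc /cdisc/= subr0 => h.
have -> : w = (w - hcen s) + hcen s by rewrite subrK.
apply: le_lt_trans (ncD _ _) _.
rewrite [nc (hcen s)]ncM ncR p1 mulr1 ger0_norm ?subr_ge0 ?hrad_le1//.
by move: h; set x := nc _; lra.
Qed.

Lemma hradC s : (hrad s)%:C = (1 + s%:C)^-1 :> Cplx R.
Proof. by rewrite /hrad fmorphV rmorphD rmorph1. Qed.

Lemma one_addC_neq0 s : 0 <= s -> 1 + s%:C != 0 :> Cplx R.
Proof.
move=> s0; rewrite -(rmorph1 (real_complex R)) -rmorphD -nc_eq0 ncR normr_eq0.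
by rewrite gt_eqF// ltr_pwDl.
Qed.

Lemma hmapBcen s z : 0 <= s -> D z -> hmap s z - hcen s = (hrad s)%:C * z / hden s z.
Proof.
move=> s0 Dz; have := hden_neq0 s0 Dz; have := one_addC_neq0 s0.
rewrite /hmap /hcen rcB hradC -[X in _ * X / _]hvK.
rewrite /hden; by move: (hv z) (s%:C : Cplx R) => v c c1 cv; field; rewrite c1 cv.
Qed.

Lemma hv_hmap s z : hv (hmap s z) = hv z / hden s z.
Proof. by rewrite {1}/hv /hmap mulrA conjp_p mul1r subKr. Qed.

(** Since [hrad s * s = 1 - hrad s], the denominator of [hmap] is, up to a constant, the one that
    the kernel of the unit disc has at the centre of the horodisc. *)
Lemma hden_affine s z : 0 <= s ->
  (hrad s)%:C * hden s z = 1 - Num.conj (hcen s) * z.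
Proof.
move=> s0; have c1 := one_addC_neq0 s0.
rewrite /hcen (cjM (1 - hrad s)%:C p) (_ : Num.conj (1 - hrad s)%:C = (1 - hrad s)%:C); last exact: conjc_real.
rewrite rcB hradC /hden /hv.
by move: (Num.conj p) (s%:C : Cplx R) c1 => q c c1; field.
Qed.

Lemma hmap_in s z : 0 <= s -> D z -> hdisc s (hmap s z).
Proof.
move=> s0 Dz; rewrite /hdisc /cdisc/= hmapBcen// ncM ncV ncM ncR gtr0_norm ?hrad_gt0//.
have r0 := hrad_gt0 s0; have d0 : 0 < nc (hden s z) by rewrite nc_gt0 hden_neq0.
rewrite -mulrA gtr_pMr// ltr_pdivrMr// mul1r -(ltr_pM2l r0).
have <- : nc ((hrad s)%:C * hden s z) = hrad s * nc (hden s z) by rewrite ncM ncR gtr0_norm.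
rewrite hden_affine//; apply: lt_le_trans (ncB_ge _ _).
rewrite nc1 ncM ncJC ncM ncR p1 mulr1 ger0_norm ?subr_ge0 ?hrad_le1//.
by move: Dz; rewrite /cdisc/= subr0; set x := nc z; lra.
Qed.

(** The reason why T_U is explicit: restricted to the horodisc, the kernel at [z] is a multiple,
    independent of [w], of the kernel of the horodisc at [hmap s z]. It follows by expanding the
    denominator around [hcen s]. *)
Lemma hbker s z w : 0 <= s -> D z -> hdisc s w ->
  bker 0 1 z w = (Num.conj ((hrad s)%:C * hden s z))^-1 * bker (hcen s) (hrad s) (hmap s z) w.
Proof.
move=> s0 Dz hw; rewrite /bker !subr0 expr1n hmapBcen//.
have dn := hden_neq0 s0 Dz; have r0 := hrad_gt0 s0.
have rC : (hrad s)%:C != 0 :> Cplx R by rewrite -nc_eq0 ncR normr_eq0 gt_eqF.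
have Dw := hdisc_sub s0 hw.
have zw : 1 - Num.conj z * w != 0.
  rewrite -nc_gt0; apply: lt_le_trans (ncB_ge _ _); rewrite nc1 ncM ncJC subr_gt0.
  move: Dz Dw; rewrite /cdisc/= !subr0 => Dz Dw; have := nc_ge0 z; have := nc_ge0 w.
  by move: Dz Dw; set x := nc z; set y := nc w => *; nra.
have E : Num.conj ((hrad s)%:C * hden s z) = 1 - hcen s * Num.conj z.
  by rewrite hden_affine// conjD conjN (conjM (Num.conj (hcen s)) z) [Num.conj (Num.conj _)]conjcK [Num.conj 1]conjc1.
have cd : Num.conj (hden s z) != 0 by rewrite -nc_eq0 ncJC nc_eq0.
have cr : Num.conj (hrad s)%:C = (hrad s)%:C by exact: conjc_real.
have E2 : (hrad s)%:C * Num.conj (hden s z) = 1 - hcen s * Num.conj z.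
  by rewrite -E (cjM (hrad s)%:C (hden s z)) cr.
have E3 : Num.conj ((hrad s)%:C * z / hden s z) = (hrad s)%:C * Num.conj z / Num.conj (hden s z).
  rewrite (cjM ((hrad s)%:C * z) (hden s z)^-1) (cjM (hrad s)%:C z) cr; congr (_ * _).
  exact: (fmorphV (@Num.conj R[i])).
rewrite E -E2 E3 rcX.
have E4 : (hrad s)%:C ^+ 2 - (hrad s)%:C * Num.conj z / Num.conj (hden s z) * (w - hcen s) =
   (hrad s)%:C / Num.conj (hden s z) * (1 - Num.conj z * w).
  have -> : 1 - Num.conj z * w = (hrad s)%:C * Num.conj (hden s z) - Num.conj z * (w - hcen s).
    by rewrite E2; ring.
  move: cd rC; move: (Num.conj (hden s z)) (hrad s)%:C (Num.conj z) => d r zc d0 r00.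
  by field.
rewrite [X in _ = _ * (_ / X)]E4.
move: zw cd rC; move: (1 - Num.conj z * w) (Num.conj (hden s z)) (hrad s)%:C => x d r x0 d00 r00.
by field; rewrite x0 d00 r00.
Qed.

(** The square of the radius in the area of the horodisc cancels the one that [hbker] produces,
    leaving the factor of [hop]. *)
Lemma hdisc_repro s z f : 0 <= s -> D z -> cderivable (hdisc s) f -> Cintegrable (hdisc s) f ->
  Cintegral (hdisc s) (fun w => f w * Num.conj (bker 0 1 z w ^+ 2)) = A%:C * hop s f z.
Proof.
move=> s0 Dz df If; have r0 := hrad_gt0 s0; have hz := hmap_in s0 Dz.
have dn := hden_neq0 s0 Dz.
have rC : (hrad s)%:C != 0 :> Cplx R by rewrite -nc_eq0 ncR normr_eq0 gt_eqF.
pose c : Cplx R := ((hrad s)%:C * hden s z)^-1 ^+ 2.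
have -> : Cintegral (hdisc s) (fun w => f w * Num.conj (bker 0 1 z w ^+ 2)) =
    Cintegral (hdisc s) (fun w => c * (f w * jker (hcen s) (hrad s) (hmap s z) w ^+ 2)).
  apply: eq_Cintegral => w hw; rewrite (hbker s0 Dz hw) [RHS]mulrCA; congr (_ * _).
  rewrite exprMn [LHS]cjM /c /jker; congr (_ * _).
    rewrite [LHS](rmorphXn (@Num.conj R[i])); congr (_ ^+ 2).
    rewrite [LHS](fmorphV (@Num.conj R[i])); congr (_^-1); exact: conjcK.
  exact: (rmorphXn (@Num.conj R[i])).
rewrite CintegralZ; last 2 first.
- exact: hdisc_open.
- apply: jker_Cintegrable => // w /df[d hd]; exact: cder_continuous hd.
have -> : Cintegral (hdisc s) (fun w => f w * jker (hcen s) (hrad s) (hmap s z) w ^+ 2) =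
    (disc_area (hcen s) (hrad s))%:C * f (hmap s z).
  rewrite -(repro r0 hz df If); apply: eq_Cintegral => w _; congr (_ * _).
  exact: esym (rmorphXn (@Num.conj R[i]) _ _).
rewrite disc_area_scale// rcM rcX /c /hop.
move: rC dn; move: (hrad s)%:C (hden s z) (A%:C : Cplx R) (f _) => r d a y r00 d0.
by field; rewrite r00 d0.
Qed.

Lemma hop_comp s t f z : 0 <= s -> 0 <= t -> D z -> hop s (hop t f) z = hop (s + t) f z.
Proof.
move=> s0 t0 Dz; rewrite /hop; have dst := hden_neq0 (addr_ge0 s0 t0) Dz; have ds := hden_neq0 s0 Dz.
(* The cocycle identity behind the semigroup law. *)
have E : hden t (hmap s z) = hden (s + t) z / hden s z.
  rewrite {1}/hden hv_hmap; apply: (canRL (mulfK ds)); rewrite mulrDl mul1r mulrA divfK//.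
  by rewrite /hden rmorphD; ring.
have -> : hmap t (hmap s z) = hmap (s + t) z.
  rewrite /hmap -/(hmap s z) hv_hmap E; congr (_ * (_ - _)).
  by rewrite invf_div mulrA divfK.
rewrite E mulrA -exprMn; congr (_ ^+ 2 * _).
by rewrite invf_div mulrA mulVf// mul1r.
Qed.

Lemma hop0 f z : hop 0 f z = f z.
Proof. by rewrite /hop /hmap /hden mul0r addr0 invr1 expr1n mul1r mulr1 hvK. Qed.

End horodisc.

(** * Bounds of the spectrum *)

Section convexity.
Context {R : realType}.

(* On either half of the interval, midpoint convexity gives sup g <= (sup g) / 2. *)
Lemma midconvex_le0 (g : R -> R) (L B : R) : 0 < L ->
  (forall x, 0 <= x <= L -> g x <= B) ->
  (forall x y, 0 <= x <= L -> 0 <= y <= L -> 2 * g ((x + y) / 2) <= g x + g y) ->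
  g 0 <= 0 -> g L <= 0 -> forall x, 0 <= x <= L -> g x <= 0.
Proof.
move=> L0 gB gmid g0 gL x xL; pose E := [set g y | y in [set y | 0 <= y <= L]].
have leS y : 0 <= y <= L -> g y <= sup E.
  by move=> yL; apply: ub_le_sup; [exists B => _ [t tL <-]; exact: gB|exists y].
have : sup E <= sup E / 2.
  apply: ge_sup; first by exists (g x); exists x.
  move=> _ [y /= /andP[y0 yL] <-]; have [h|h] := leP y (L / 2).
    have I0 : 0 <= (0 : R) <= L by apply/andP; split; lra.
    have I1 : 0 <= 2 * y <= L by apply/andP; split; lra.
    have := gmid _ _ I0 I1; have := leS _ I1; rewrite add0r mulrAC divff// mul1r; lra.
  have I0 : 0 <= L <= L by apply/andP; split; lra.
  have I1 : 0 <= 2 * y - L <= L by apply/andP; split; lra.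
  have := gmid _ _ I1 I0; have := leS _ I1; rewrite subrK mulrAC divff// mul1r; lra.
by have := leS _ xL; lra.
Qed.

Lemma le_mean (u v w : R) : 0 <= u -> 0 <= v -> w ^+ 2 <= u * v -> 2 * w <= u + v.
Proof.
move=> u0 v0 w2; rewrite leNgt; apply/negP => h.
have : 0 < (2 * w - (u + v)) * (2 * w + (u + v)) by apply: mulr_gt0; lra.
by have := sqr_ge0 (u - v); lra.
Qed.

(** The exponent [ln al / (s1 - s2)] is the critical point of tau -> exp(-tau s2) - exp(-tau s1), so
    the powers of [al] in the theorem are the two exponentials at the maximum. *)
Lemma powR_gap (s1 s2 al : R) : al = s1 / s2 -> 0 < s2 -> s2 < s1 ->
  al `^ (- (al / (al - 1))) = expR (- (ln al / (s1 - s2) * s1)) /\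
  al `^ (- (1 / (al - 1))) = expR (- (ln al / (s1 - s2) * s2)).
Proof.
move=> alE s20 s21; have s10 : 0 < s1 by exact: lt_trans s21.
have al0 : 0 < al by rewrite alE divr_gt0.
have d0 : 0 < s1 - s2 by rewrite subr_gt0.
have E : al - 1 = (s1 - s2) / s2 by rewrite alE mulrBl divff// gt_eqF.
rewrite /powR gt_eqF//; split; congr expR; rewrite E; last by field; rewrite !gt_eqF.
by rewrite alE; field; rewrite !gt_eqF.
Qed.

(* [phi s * expR (mu * s)] is convex for every mu; take [expR (mu * (s1 - s2)) = al]. *)
Lemma log_midconvex_gap (phi : R -> R) (s1 s2 al : R) : al = s1 / s2 -> 0 < s2 -> s2 < s1 ->
  (forall s : R, 0 <= s -> 0 <= phi s <= phi 0) ->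
  (forall s t : R, 0 <= s -> 0 <= t -> phi (s + t) ^+ 2 <= phi (s + s) * phi (t + t)) ->
  phi s2 - phi s1 <= (al `^ (- (1 / (al - 1))) - al `^ (- (al / (al - 1)))) * phi 0.
Proof.
move=> alE s20 s21 phib mid.
have s10 : 0 < s1 by exact: lt_trans s21.
have al1 : 1 < al by rewrite alE ltr_pdivlMr// mul1r.
have al0 : 0 < al by exact: lt_trans al1.
pose mu := ln al / (s1 - s2).
have d0 : 0 < s1 - s2 by rewrite subr_gt0.
have mu0 : 0 <= mu by rewrite divr_ge0 ?ltW// ln_gt0.
have [p1 p2] := powR_gap alE s20 s21.
have eal : expR (mu * s1) = al * expR (mu * s2).
  have -> : mu * s1 = ln al + mu * s2 by rewrite /mu; field; rewrite gt_eqF.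
  by rewrite expRD lnK.
have eal' : expR (- (mu * s2)) = al * expR (- (mu * s1)).
  have -> : - (mu * s2) = ln al + - (mu * s1) by rewrite /mu; field; rewrite gt_eqF.
  by rewrite expRD lnK.
pose psi s := phi s * expR (mu * s).
(* [psi] minus its chord over [[0, s1]]: midpoint convexity and a bound from above make it
   nonpositive at [s2]. *)
pose g s := psi s - (phi 0 + (psi s1 - phi 0) * (s / s1)).
have psi0 : psi 0 = phi 0 by rewrite /psi mulr0 expR0 mulr1.
have psib s : 0 <= s <= s1 -> 0 <= psi s <= phi 0 * expR (mu * s1).
  move=> /andP[s0 ss1]; have /andP[f0 f1] := phib s s0.
  rewrite mulr_ge0 ?expR_ge0//=; apply: ler_pM; rewrite ?expR_ge0//.
  by rewrite ler_expR ler_wpM2l.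
have gs2 : g s2 <= 0.
  apply: (@midconvex_le0 g s1 (phi 0 * expR (mu * s1) + `|psi s1 - phi 0|)) => //.
  - move=> s sI; have /andP[_ h] := psib s sI; have /andP[f0 _] := phib 0 (lexx _).
    have /andP[s0 ss1] := sI; rewrite /g.
    have : `|(psi s1 - phi 0) * (s / s1)| <= `|psi s1 - phi 0|.
      rewrite normrM ler_piMr// ger0_norm ?divr_ge0 ?(ltW s10)//.
      by rewrite ler_pdivrMr// mul1r.
    by rewrite ler_norml => /andP[]; lra.
  - move=> x y /andP[x0 xs] /andP[y0 ys].
    have psimid : 2 * psi ((x + y) / 2) <= psi x + psi y.
      have x2 : 0 <= x / 2 by rewrite divr_ge0.
      have y2 : 0 <= y / 2 by rewrite divr_ge0.
      have /andP[a0 _] := phib x x0; have /andP[b0 _] := phib y y0.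
      have : psi ((x + y) / 2) ^+ 2 <= psi x * psi y.
        have := mid _ _ x2 y2; rewrite -!splitr -mulrDl /psi exprMn => h.
        have -> : expR (mu * ((x + y) / 2)) ^+ 2 = expR (mu * x) * expR (mu * y).
          by rewrite expr2 -!expRD; congr expR; lra.
        by rewrite [leRHS]mulrACA ler_wpM2r// mulr_ge0 ?expR_ge0.
      by apply: le_mean; rewrite mulr_ge0 ?expR_ge0.
    by rewrite /g; move: psimid; rewrite mulrDl [(x + y) / 2 / s1]mulrAC [(x + y) / s1]mulrDl; lra.
  - by rewrite /g psi0 mul0r mulr0 addr0 subrr.
  - by rewrite /g divff ?gt_eqF// mulr1 [phi 0 + _]addrC subrK subrr.
  - by rewrite (ltW s20) (ltW s21).
rewrite p1 p2 -/mu eal'.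
have E0 := expR_gt0 (mu * s2); have E1 := expR_gt0 (- (mu * s1)).
have s2s1 : s2 / s1 = al^-1 by rewrite alE invf_div.
move: gs2; rewrite /g s2s1 /psi eal.
have EE : expR (mu * s2) * (al * expR (- (mu * s1))) = 1.
  by rewrite -eal' expRN divff// gt_eqF.
(* Multiply the chord inequality at [s2 / s1 = al^-1] by [expR (- (mu * s2))]. The choice of [mu]
   makes the coefficient of [phi s1] exactly 1, and that of [phi 0] is
   [(al - 1) * expR (- (mu * s1))], the gap. *)
move=> H; have : (phi s2 * expR (mu * s2)) * (al * expR (- (mu * s1))) <=
   (phi 0 + (phi s1 * (al * expR (mu * s2)) - phi 0) * al^-1) * (al * expR (- (mu * s1))).
  by rewrite ler_wpM2r ?mulr_ge0 ?(ltW al0) ?(ltW E1)//; lra.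
rewrite -mulrA EE mulr1.
have -> : (phi 0 + (phi s1 * (al * expR (mu * s2)) - phi 0) * al^-1) * (al * expR (- (mu * s1))) =
  phi s1 * (expR (mu * s2) * (al * expR (- (mu * s1)))) + (al - 1) * expR (- (mu * s1)) * phi 0.
  by field; rewrite gt_eqF.
rewrite EE; lra.
Qed.

End convexity.

(** * The self-adjoint semigroup and its quadratic form *)

Section horodisc_operator.
Context {R : realType} (oD : open (cdisc (0 : Cplx R) 1)) (p : Cplx R) (p1 : nc p = 1).
Local Notation D := (cdisc (0 : Cplx R) 1).
Local Notation dotD := (@bergman_dot R D oD).
Local Notation A := (disc_area (0 : Cplx R) 1).
Implicit Types (f g u : bergmanType oD) (s t : R).

Definition hT s (s0 : 0 <= s) : bergmanType oD -> bergmanType oD :=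
  restriction_gram oD (@hdisc_open R p s) (hdisc_sub p1 s0).

Lemma areaC_neq0 : A%:C != 0 :> Cplx R.
Proof. by rewrite -nc_eq0 ncR normr_eq0 gt_eqF// disc_area_gt0. Qed.

Lemma hT_E s (s0 : 0 <= s) f z : D z -> hT s0 f z = hop p s f z.
Proof.
move=> Dz; apply: (mulfI areaC_neq0); rewrite (gram_integral _ (hdisc_sub p1 s0))//.
apply: hdisc_repro => //.
  by move=> w /(hdisc_sub p1 s0) Dw; exact: bergman_cderivable.
apply: CintegrableS (bergman_Cintegrable f) => //; first exact: hdisc_open.
exact: hdisc_sub.
Qed.

Lemma hT_comp s t (s0 : 0 <= s) (t0 : 0 <= t) f : hT s0 (hT t0 f) = hT (addr_ge0 s0 t0) f.
Proof.
apply: bergmanP => z Dz; rewrite !hT_E// -hop_comp// /hop hT_E//.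
exact: (hdisc_sub p1 s0 (hmap_in p1 s0 Dz)).
Qed.

Lemma hT0 f : hT (lexx 0) f = f.
Proof. by apply: bergmanP => z Dz; rewrite hT_E// hop0. Qed.

(** The quadratic form of C_s, written as an integral so that it is a function of a real [s]
    carrying no proof of [0 <= s], as the convexity lemmas require. *)
Definition hphi f s : R := aint (plane @^-1` hdisc p s) (fun w => nc (f (plane w)) ^+ 2).

Lemma hphi_form f s (s0 : 0 <= s) : dotD (hT s0 f) f = (hphi f s)%:C.
Proof.
rewrite gram_form bergman_sqnormE; congr (_%:C); apply: eq_aint => w hw.
by rewrite restrictE.
Qed.

(** Self-adjointness and the semigroup law. It lets Cauchy-Schwarz be stated in terms of [hphi]
    alone. *)
Lemma hphi_sqnorm f s (s0 : 0 <= s) : sqnorm dotD (hT s0 f) = hphi f (s + s).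
Proof.
apply: (@complexI R); rewrite -(hphi_form _ (addr_ge0 s0 s0)) -hT_comp [in RHS]gram_selfadjoint.
exact: esym (form_sqnorm dotD _).
Qed.

Lemma hphi_ge0 f s : 0 <= hphi f s.
Proof. by apply: aint_ge0 => w _; exact: sqr_ge0. Qed.

Lemma hphi0 f : hphi f 0 = sqnorm dotD f.
Proof.
by apply: (@complexI R); rewrite -(hphi_form f (lexx 0)) hT0; exact: form_sqnorm dotD f.
Qed.

Lemma hphi_le f s : 0 <= s -> hphi f s <= hphi f 0.
Proof.
move=> s0; rewrite hphi0; have := sqnorm_restrict_le (@hdisc_open R p s) (hdisc_sub p1 s0) f.
apply: le_trans; rewrite le_eqVlt; apply/orP; left; apply/eqP/(@complexI R).
by rewrite -(hphi_form f s0) [LHS]gram_form.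
Qed.

Lemma hphi_mid f s t : 0 <= s -> 0 <= t ->
  hphi f (s + t) ^+ 2 <= hphi f (s + s) * hphi f (t + t).
Proof.
move=> s0 t0; rewrite -(hphi_sqnorm f s0) -(hphi_sqnorm f t0).
have := form_cauchy_schwarz dotD (hT t0 f) (hT s0 f).
have -> : nc ((dotD : {dot _ for Num.conj}) (hT t0 f) (hT s0 f)) = hphi f (s + t).
  have E : dotD (hT t0 f) (hT s0 f) = dotD (hT s0 (hT t0 f)) f by rewrite [RHS]gram_selfadjoint.
  rewrite -[X in nc X]/(dotD _ _) E hT_comp hphi_form ncR ger0_norm//; exact: hphi_ge0.
by rewrite [X in _ <= X -> _]mulrC.
Qed.

End horodisc_operator.

(** * Criteria for belonging to the spectrum *)

Section spectrum_bergman.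
Context {R : realType} (W : set (Cplx R)) (oW : open W).
Local Notation V := (bergmanType oW).
Local Notation form := (@bergman_dot R W oW).
Implicit Types (f g : V).

Lemma norm_sqnorm f : `|f| = (Num.sqrt (sqnorm form f))%:C.
Proof.
apply/eqP; rewrite -(@eqrXn2 _ 2)//; last by rewrite ler0c sqrtr_ge0.
rewrite -rcX sqr_sqrtr ?sqnorm_ge0//; apply/eqP.
transitivity (form f f); first exact: sqrtCK.
exact: form_sqnorm form f.
Qed.

Lemma sqnorm_bounded_continuous (S : {linear V -> V}) (K : R) :
  (forall f, sqnorm form (S f) <= K * sqnorm form f) -> continuous S.
Proof.
move=> SK; apply: bounded_linear_continuous; apply/linear_boundedP.
exists (Num.sqrt `|K|)%:C; split=> [|r Kr f]; first by apply/complex_realP; eexists.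
apply: le_trans (_ : (Num.sqrt `|K|)%:C * `|f| <= _); last by rewrite ler_wpM2r// ltW.
rewrite !norm_sqnorm -rcM lecR -sqrtrM//; apply: ler_wsqrtr.
by apply: le_trans (SK f) _; rewrite ler_wpM2r ?sqnorm_ge0// ler_norm.
Qed.

Lemma continuous_sqnorm_bounded (S : {linear V -> V}) : continuous S ->
  exists2 K : R, 0 < K & forall f, sqnorm form (S f) <= K * sqnorm form f.
Proof.
move=> cS; have /linear_boundedP := (linear_bounded_continuous S).2 cS.
move=> /pinfty_ex_gt0[r r0 rS].
have /complex_realP[a ra] : r \is Num.real by rewrite gtr0_real.
have a0 : 0 < a by move: r0; rewrite ra ltcR.
exists (a ^+ 2) => [|f]; first exact: exprn_gt0.
have := rS f; rewrite ra !norm_sqnorm -rcM lecR => h.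
rewrite -[leLHS]sqr_sqrtr ?sqnorm_ge0// -[X in _ * X]sqr_sqrtr ?sqnorm_ge0// -exprMn.
by apply: lerXn2r; rewrite ?nnegrE ?mulr_ge0 ?sqrtr_ge0 ?(ltW a0).
Qed.

(** A bounded left inverse with squared bound [K] contradicts an approximate eigenvector of quality
    [(2 * K)^-1]. *)
Lemma spectrum_approx (T : V -> V) (l : R[i]) :
  (forall e : R, 0 < e -> exists2 f, 0 < sqnorm form f &
    sqnorm form (T f - l *: f) <= e * sqnorm form f) -> spectrum T l.
Proof.
move=> app [S [/continuous_sqnorm_bounded[K K0 SK] TS _]].
have e0 : 0 < (2 * K)^-1 by rewrite invr_gt0 mulr_gt0.
have [f f0 fe] := app _ e0; have := SK (T f - l *: f); rewrite TS => h.
have : sqnorm form f <= K * ((2 * K)^-1 * sqnorm form f).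
  by apply: le_trans h _; rewrite ler_pM2l.
have -> : K * ((2 * K)^-1 * sqnorm form f) = sqnorm form f / 2 by field; rewrite gt_eqF.
lra.
Qed.

Lemma spectrum_subset (T : V -> V) (q : V -> R) (M : R) : sqcomplete form ->
  (forall a f g, T (a *: f + g) = a *: T f + T g) ->
  (forall f, sqnorm form (T f) <= sqnorm form f) ->
  (forall f, form (T f) f = (q f)%:C) ->
  (forall f, 0 <= q f <= M * sqnorm form f) ->
  spectrum T `<=` real_complex R @` `[0, M].
Proof.
move=> comp Tlin Tb Tq qM l; apply: contraPP => nl sp; apply: sp.
(* It is enough to rotate the numerical range of [T - l] into a half-plane away from 0. For
   [l = a +i* b], take ['i * b] if [b] is nonzero, 1 if [a < 0], and -1 if [M < a]. *)
suff [om [de de0 co]] : exists om : R[i], exists2 de : R, 0 < de &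
    forall f, de * sqnorm form f <= complex.Re (om * ((q f)%:C - l * (sqnorm form f)%:C)).
  have Blin a f g : T (a *: f + g) - l *: (a *: f + g) =
      a *: (T f - l *: f) + (T g - l *: g).
    by rewrite Tlin scalerDr scalerBr !scalerA [l * a]mulrC opprD addrACA.
  have Bb f : sqnorm form (T f - l *: f) <= (2 + 2 * nc l ^+ 2) * sqnorm form f.
    apply: le_trans (sqnormD_le form _ _) _; rewrite sqnormN sqnormZ.
    by have := Tb f; lra.
  have Bco f : de * sqnorm form f <= complex.Re (om * form (T f - l *: f) f).
    have -> : form (T f - l *: f) f = (q f)%:C - l * (sqnorm form f)%:C.
      have ff : form f f = (sqnorm form f)%:C := form_sqnorm form f.
      by rewrite -scaleNr addrC bergman_dot_linear Tq ff mulNr addrC.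
    exact: co.
  have [S [K [BS SB Slin SK]]] := coercive_bijective comp de0 Blin Bb Bco.
  pose SL : {linear V -> V} := HB.pack S (GRing.isLinear.Build _ _ _ _ S Slin).
  exists SL; split=> //; exact: (@sqnorm_bounded_continuous SL K).
case: l nl => a b nl.
have ReE (om : R[i]) (x y : R) : complex.Re (om * (x%:C - (a +i* b) * y%:C)) =
    complex.Re om * (x - a * y) + complex.Im om * (b * y).
  by case: om => u v /=; ring.
have [b0|b0] := eqVneq b 0; last first.
  exists (0 +i* b); exists (b ^+ 2); first by rewrite exprn_even_gt0.
  by move=> f; rewrite ReE /= mul0r add0r mulrA -expr2.
rewrite {}b0 in nl ReE *.
have [a0|a0] := ltP a 0.
  exists 1, (- a) => [|f]; first by rewrite oppr_gt0.
  by rewrite ReE /=; have /andP[] := qM f; lra.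
have [aM|aM] := ltP M a; last by exfalso; apply: nl; exists a => //=; rewrite in_itv/= a0 aM.
exists (-1), (a - M) => [|f]; first by rewrite subr_gt0.
by rewrite ReE /= oppr0; have /andP[] := qM f; lra.
Qed.

End spectrum_bergman.

(** * The operator of a horocyclic strip as a difference *)

Section strip.
Context {R : realType}.
Implicit Types (W U V : set (Cplx R)) (B C E : set (R * R)).
Local Notation area := (@lebesgue_measure R \x @lebesgue_measure R)%E.

Lemma aint_split E B C h : measurable E -> measurable B -> measurable C ->
  B `<=` E -> C `<=` E -> B `&` C = set0 -> area (E `\` (B `|` C)) = 0%E ->
  aintegrable E h -> aint E h = aint B h + aint C h.
Proof.
move=> mE mB mC BE CE BC N0 ih; have mBC := measurableU _ _ mB mC.
have BCE : B `|` C `<=` E by move=> x [/BE|/CE].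
have mN := measurableD mE mBC.
rewrite -{1}(setDUK BCE) aint_setU ?setDUK ?setDIK//.
rewrite aint_setU//; last exact: aintegrableS ih.
suff -> : aint (E `\` (B `|` C)) h = 0 by rewrite addr0.
rewrite /aint /Rintegral null_set_integral//.
by have /integrableP[] := @aintegrableS R E _ h mE mN (@subDsetl _ _ _) ih.
Qed.

Lemma Cintegral_split W U V g : open W -> open U -> open V -> U `<=` W -> V `<=` W ->
  U `&` V = set0 -> area (plane @^-1` W `\` (plane @^-1` U `|` plane @^-1` V)) = 0%E ->
  Cintegrable W g -> Cintegral W g = Cintegral U g + Cintegral V g.
Proof.
move=> oW oU oV UW VW UV N0 [i1 i2].
have [mW mU mV] := And3 (measurable_plane oW) (measurable_plane oU) (measurable_plane oV).
have UVp : plane @^-1` U `&` plane @^-1` V = set0 by rewrite -preimage_setI UV preimage_set0.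
have sp h : aintegrable (plane @^-1` W) h ->
    aint (plane @^-1` W) h = aint (plane @^-1` U) h + aint (plane @^-1` V) h.
  by apply: aint_split => // x; [exact: UW|exact: VW].
by have := sp _ i1; have := sp _ i2; rewrite /aint /Cintegral => -> ->.
Qed.

Context (oD : open (cdisc (0 : Cplx R) 1)) (p : Cplx R) (p1 : nc p = 1).
Context (s1 s2 : R) (s20 : 0 <= s2) (s12 : s2 < s1).
Context (U : set (Cplx R)) (oU : open U) (UD : U `<=` cdisc (0 : Cplx R) 1).
Context (UE : U = hdisc p s2 `\` closed_cdisc (hcen p s1) (hrad s1)).
Let s10 : 0 <= s1 := ltW (le_lt_trans s20 s12).

Lemma hdisc_subset : hdisc p s1 `<=` hdisc p s2.
Proof.
move=> w; rewrite /hdisc /cdisc/= => h.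
have -> : w - hcen p s2 = (w - hcen p s1) + (hcen p s1 - hcen p s2) by rewrite addrA subrK.
apply: le_lt_trans (ncD _ _) _.
have r12 : hrad s1 <= hrad s2 by rewrite ler_pV2 ?inE ?unitfE ?gt_eqF ?ltr_pwDl ?lerD2l// ?(ltW s12).
have -> : hcen p s1 - hcen p s2 = (hrad s2 - hrad s1)%:C * p.
  by rewrite /hcen -mulrBl -rcB; congr ((_)%:C * _); ring.
rewrite [nc (_ * p)]ncM ncR p1 mulr1 ger0_norm ?subr_ge0//.
by move: h; set x := nc _; lra.
Qed.

(** The larger horodisc, with parameter [s2], splits into the strip, the smaller horodisc and a part
    of a circle, which is null; the integral formula for T_U is additive. *)
Lemma strip_gram (f : bergmanType oD) :
  restriction_gram oD oU UD f = hT p1 s20 f - hT p1 s10 f.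
Proof.
apply: bergmanP => z Dz; apply: (mulfI (@areaC_neq0 R)); rewrite gram_integral//.
rewrite -[X in _ = _ * X]/(hT p1 s20 f z - hT p1 s10 f z) mulrBr.
rewrite !(gram_integral _ (hdisc_sub p1 _))//; apply/eqP; rewrite eq_sym subr_eq; apply/eqP.
apply: Cintegral_split => //.
- exact: hdisc_open.
- exact: hdisc_open.
- by rewrite UE => w [].
- exact: hdisc_subset.
- by rewrite UE; apply/seteqP; split=> // w [[_ h] /ltW].
- apply/eqP; rewrite -measure_le0 -(area_circle (hcen p s1) (hrad_gt0 s10)).
  apply: le_measure; rewrite ?inE.
  + apply: measurableD; first exact: measurable_plane (@hdisc_open R p s2).
    by apply: measurableU; apply: measurable_plane => //; exact: hdisc_open.
  + apply: measurableD; first exact: measurable_closed_cdisc.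
    exact: measurable_plane (@hdisc_open R p s1).
  + move=> w [/= h2 nU]; split; last by move=> h; apply: nU; right.
    by apply: contrapT => nc1; apply: nU; left; rewrite UE.
- apply: CintegrableS (hdisc_sub p1 s20) _ => //; first exact: hdisc_open.
  have c := jker_Cintegrable 2 ltr01 Dz (fun w => @bergman_ccont _ _ oD f w) (bergman_Cintegrable f).
  by move: c; congr Cintegrable; apply/funext => w; rewrite /jker rmorphXn.
Qed.

End strip.

(** * Approximate eigenvectors *)

Section complex_exponential.
Context {R : realType}.
Implicit Types (z w : Cplx R) (x y : R).

Definition cexp z : Cplx R :=
  (expR (complex.Re z))%:C * (cos (complex.Im z) +i* sin (complex.Im z)).

Lemma cexpD z w : cexp (z + w) = cexp z * cexp w.
Proof.
case: z w => [a b] [c d]; rewrite /cexp /= expRD cosD sinD.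
by apply/eqP; rewrite eq_complex; apply/andP; split; apply/eqP => /=; ring.
Qed.

Lemma nc_cexp z : nc (cexp z) = expR (complex.Re z).
Proof.
rewrite ncM ncR ger0_norm ?expR_ge0//; case: z => a b /=.
by rewrite cos2Dsin2 sqrtr1 mulr1.
Qed.

Lemma cexpR x : cexp x%:C = (expR x)%:C.
Proof. by rewrite /cexp /= cos0 sin0 -[RHS]mulr1; congr (_ * _). Qed.

Lemma is_derive_eps (F : R -> R) d (e : R) : is_derive (0 : R) 1 F d -> 0 < e ->
  \forall s \near (0 : R), `|F s - F 0 - d * s| <= e * `|s|.
Proof.
move=> [dF <-] e0.
have H : (fun h : R => h^-1 *: (F (h *: (1 : R) + 0) - F 0)) @ (0 : R)^' --> 'D_1 F 0.
  exact: dF.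
have /cvgrPdist_le/(_ _ e0)/nbhs_ballP[r /= r0 h] := H.
apply/nbhs_ballP; exists r => // s sr; have [->|s0] := eqVneq s 0.
  by rewrite subrr mulr0 subr0 normr0 mulr0.
have := h s sr s0; rewrite addr0 [s *: _]mulr1 => h2.
have -> : F s - F 0 - 'D_1 F 0 * s = - (('D_1 F 0 - s^-1 * (F s - F 0)) * s) by field.
by rewrite normrN normrM ler_wpM2r.
Qed.

(** Real and imaginary parts of the remainder are sums of products with one small factor. The other
    factors are at most 1 or 2, giving [e / 6] for the real part of [w] and (2 + 2 + 1) times
    [e / 6] for the imaginary part. *)
Lemma cder_cexp0 : cder cexp 0 1.
Proof.
apply/cderP => e e0; have e6 : 0 < e / 6 by rewrite divr_gt0.
have nE : \forall s \near (0 : R), `|expR s - expR 0 - expR 0 * s| <= e / 6 * `|s|.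
  exact: is_derive_eps.
have nC : \forall s \near (0 : R), `|cos s - cos 0 - - sin 0 * s| <= e / 6 * `|s|.
  exact: is_derive_eps.
have nS : \forall s \near (0 : R), `|sin s - sin 0 - cos 0 * s| <= e / 6 * `|s|.
  exact: is_derive_eps.
have m0 : 0 < Num.min (e / 6) 1 by rewrite lt_min e6 ltr01.
have nE1 : \forall s \near (0 : R), `|expR 0 - expR s| < Num.min (e / 6) 1.
  by have /cvgrPdist_lt/(_ _ m0) := @continuous_expR R 0.
have n1 : \forall s \near (0 : R), `|0 - s| < 1 by apply/nbhs_ballP; exists 1 => /=.
have hx1 := @Re_continuous R 0 _ nE; have hx2 := @Re_continuous R 0 _ nE1.
have hx3 := @Re_continuous R 0 _ n1.
have hy1 := @Im_continuous R 0 _ nC; have hy2 := @Im_continuous R 0 _ nS.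
near=> w; have a1 : `|expR (complex.Re w) - expR 0 - expR 0 * complex.Re w| <= e / 6 * `|complex.Re w|.
  by near: w; exact: hx1.
have a2 : `|expR 0 - expR (complex.Re w)| < Num.min (e / 6) 1 by near: w; exact: hx2.
have a3 : `|0 - complex.Re w| < 1 by near: w; exact: hx3.
have b1 : `|cos (complex.Im w) - cos 0 - - sin 0 * complex.Im w| <= e / 6 * `|complex.Im w|.
  by near: w; exact: hy1.
have b2 : `|sin (complex.Im w) - sin 0 - cos 0 * complex.Im w| <= e / 6 * `|complex.Im w|.
  by near: w; exact: hy2.
move: a1 a2 a3 b1 b2; rewrite subr0 mul1r.
rewrite expR0 cos0 sin0 oppr0 !mul1r mul0r !subr0 => a1 a2 a3 b1 b2.
have wR := nc_Re w; have wI := nc_Im w; rewrite addr0 in b2.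
apply: le_trans (_ : e / 6 * `|complex.Re w| + 5 * (e / 6 * `|complex.Im w|) <= _); last first.
  by move: wR wI; move: (nc w) (`|_|) (`|_|) => n u v *; nra.
apply: le_trans (nc_le_ReIm _) _.
have -> : complex.Re (cexp w - cexp 0 - w) =
   (expR (complex.Re w) - 1 - complex.Re w) * cos (complex.Im w) +
   (1 + complex.Re w) * (cos (complex.Im w) - 1).
  by rewrite !RecB /cexp /= expR0 cos0 sin0; ring.
have -> : complex.Im (cexp w - cexp 0 - w) =
   expR (complex.Re w) * (sin (complex.Im w) - complex.Im w) +
   (expR (complex.Re w) - 1) * complex.Im w.
  by rewrite !ImcB /cexp /= expR0 cos0 sin0; ring.
clear wR wI; move: a1 a2 a3 b1 b2; move: (complex.Re w) (complex.Im w) => x y a1 a2 a3 b1 b2.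
have c1 : `|cos y| <= 1 by rewrite ler_norml cos_geN1 cos_le1.
have ex2 : `|expR x| <= 2.
  rewrite (_ : expR x = 1 - (1 - expR x)); last by ring.
  apply: le_trans (ler_normB _ _) _; rewrite normr1.
  have : `|1 - expR x| < 1 by apply: lt_le_trans a2 _; rewrite ge_min lexx orbT.
  lra.
have ex1 : `|expR x - 1| <= e / 6.
  by rewrite distrC; apply: ltW; apply: lt_le_trans a2 _; rewrite ge_min lexx.
have x1 : `|1 + x| <= 2.
  by apply: le_trans (ler_normD _ _) _; rewrite normr1; move: a3; rewrite sub0r normrN; lra.
apply: le_trans (lerD (ler_normD _ _) (ler_normD _ _)) _; rewrite !normrM.
have h1 : `|expR x - 1 - x| * `|cos y| <= e / 6 * `|x| * 1 by apply: ler_pM.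
have h2 : `|1 + x| * `|cos y - 1| <= 2 * (e / 6 * `|y|) by apply: ler_pM.
have h3 : `|expR x| * `|sin y - y| <= 2 * (e / 6 * `|y|) by apply: ler_pM.
have h4 : `|expR x - 1| * `|y| <= e / 6 * `|y| by apply: ler_pM.
lra.
Unshelve. all: by end_near. Qed.

Lemma cder_cexp z : cder cexp z (cexp z).
Proof.
have d1 : cder (fun w => w - z) z 1.
  by apply: cder_eq (cderB (cder_id z) (cder_cst z z)) _; rewrite subr0.
have d2 : cder cexp (z - z) 1 by rewrite subrr; exact: cder_cexp0.
have d3 := cderZ (cexp z) (cder_comp d1 d2); apply: cder_eq (cder_near _ d3) _; last by rewrite !mulr1.
by apply: filterS (near_nc_ball z ltr01) => w _; rewrite -cexpD addrC subrK.
Qed.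

End complex_exponential.

(** * Regularised exponentials in the Bergman space *)

Section approximate_eigenvectors.
Context {R : realType} (oD : open (cdisc (0 : Cplx R) 1)) (p : Cplx R) (p1 : nc p = 1).
Local Notation D := (cdisc (0 : Cplx R) 1).
Local Notation dotD := (@bergman_dot R D oD).
Implicit Types (s b : R) (z w : Cplx R).
Context (tau : R) (tau0 : 0 <= tau).

(* [cexp (- tau / hv) / hv ^+ 2] is an eigenvector of [hop s] for the eigenvalue
   [expR (- tau * s)], but is not square integrable. Replacing [hv] by [hden b],
   which behaves like [b * hv] as [b] grows, costs a factor 1 + O(s / b). *)
Definition happrox b z : Cplx R := cexp (- (tau%:C / hv p z)) * (hden p b z)^-1 ^+ 2.

Lemma hv_neq0 z : D z -> hv p z != 0.
Proof. by move=> /(Re_hv_gt0 p1); apply: contraTneq => ->; rewrite /= ltxx. Qed.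

Lemma Re_inv_ge0 (w : R[i]) : 0 <= complex.Re w -> 0 <= complex.Re w^-1.
Proof. by case: w => x y /= x0; rewrite divr_ge0// addr_ge0 ?sqr_ge0. Qed.

(** On the disc [hv] has positive real part, hence so has its inverse, and [hden] has real part at
    least 1. Boundedness gives square integrability. *)
Lemma happrox_le b z : 0 <= b -> D z -> nc (happrox b z) <= 1.
Proof.
move=> b0 Dz; rewrite ncM ncX ncV nc_cexp.
have h1 : expR (complex.Re (- (tau%:C / hv p z))) <= 1.
  rewrite -expR0 ler_expR (_ : complex.Re (- _) = - (tau * complex.Re (hv p z)^-1)).
    by rewrite oppr_le0 mulr_ge0// Re_inv_ge0// ltW// (Re_hv_gt0 p1).
  by case: (_^-1) => u v /=; ring.
have h2 : (nc (hden p b z))^-1 <= 1.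
  have := le_trans (Re_hden_ge1 p1 b0 Dz) (le_trans (ler_norm _) (nc_Re _)) => h.
  by rewrite invf_le1//; exact: lt_le_trans h.
rewrite -[leRHS]mulr1; apply: ler_pM; rewrite ?expR_ge0 ?sqr_ge0//.
by rewrite expr_le1// invr_ge0 nc_ge0.
Qed.

Lemma happrox_neq0 b z : 0 <= b -> D z -> happrox b z != 0.
Proof.
move=> b0 Dz; rewrite mulf_neq0//; first by rewrite -nc_gt0 nc_cexp expR_gt0.
by rewrite expf_neq0// invr_neq0// (hden_neq0 p1).
Qed.

Lemma cder_hv z : cder (hv p) z (- Num.conj p).
Proof.
apply: cder_eq (cderB (cder_cst 1 z) (cderZ (Num.conj p) (cder_id z))) _.
by rewrite sub0r mulr1.
Qed.

Lemma happrox_cderivable b : 0 <= b -> cderivable D (happrox b).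
Proof.
move=> b0 z Dz; have v0 := hv_neq0 Dz.
have d1 := cderN (cderZ tau%:C (cderV (cder_hv z) v0)).
have d2 := cder_comp d1 (cder_cexp _).
have d3 := cderV (cderD (cder_cst 1 z) (cderZ b%:C (cder_hv z))) (hden_neq0 p1 b0 Dz).
by eexists; exact: (cderM d2 (cderM d3 d3)).
Qed.

Lemma happrox_sqr_integrable b : 0 <= b ->
  aintegrable (plane @^-1` D) (fun q : R * R => nc (happrox b (plane q)) ^+ 2).
Proof.
move=> b0; apply: (@bounded_sqr_integrable _ _ oD _ 1).
- exact: area_cdisc_fin.
- by move=> w /(happrox_cderivable b0)[d /cder_continuous].
- by move=> w; exact: happrox_le.
Qed.

Definition hvec b (b0 : 0 <= b) : bergmanType oD :=
  Bergman (bergman_cut_mem oD (happrox_cderivable b0) (happrox_sqr_integrable b0)).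

Lemma hvecE b (b0 : 0 <= b) z : D z -> hvec b0 z = happrox b z.
Proof. exact: bergman_cutE. Qed.

Lemma hvec_gt0 b (b0 : 0 <= b) : 0 < sqnorm dotD (hvec b0).
Proof.
rewrite lt_neqAle sqnorm_ge0 andbT; apply/negP => /eqP/esym/sqnorm_eq0 h.
have D0 : D 0.
  suff : nc (0 - 0 : Cplx R) < 1 by [].
  by rewrite subrr; apply: le_lt_trans ltr01; rewrite le_eqVlt; apply/orP; left; apply/eqP; exact: nc0.
by have := happrox_neq0 b0 D0; rewrite -(hvecE b0 D0) h eqxx.
Qed.

(** [hmap s] adds [s] to [1 / hv], so the exponential gains the factor [expR (- (tau * s))]; the
    last factor is what the regularisation costs. *)
Lemma hop_happrox s b z : 0 <= s -> 0 <= b -> D z ->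
  hop p s (happrox b) z = (expR (- (tau * s)))%:C * happrox b z *
    (hden p b z / hden p (b + s) z) ^+ 2.
Proof.
move=> s0 b0 Dz; have ds := hden_neq0 p1 s0 Dz; have db := hden_neq0 p1 b0 Dz.
have dbs := hden_neq0 p1 (addr_ge0 b0 s0) Dz; have v0 := hv_neq0 Dz.
have E : hden p b (hmap p s z) = hden p (b + s) z / hden p s z.
  rewrite {1}/hden (hv_hmap p1); apply: (canRL (mulfK ds)); rewrite mulrDl mul1r mulrA divfK//.
  by rewrite /hden rcD; ring.
have Ee : - (tau%:C / hv p (hmap p s z)) = (- (tau * s))%:C + - (tau%:C / hv p z).
  rewrite (hv_hmap p1) invf_div rcN rcM /hden.
  by move: (tau%:C : Cplx R) (s%:C : Cplx R) (hv p z) v0 => t c v v0; field.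
rewrite /hop /happrox E Ee cexpD cexpR.
move: ds db dbs; move: (cexp _) (hden p s z) (hden p b z) (hden p (b + s) z) => ce ds db dbs d1 d2 d3.
by field; rewrite d1 d2 d3.
Qed.

(** The difference is - s v / (1 + (b + s) v) with v = [hv p z]; as Re v > 0, the denominator is at
    least b |v| in modulus. The bound is uniform in [z]. *)
Lemma nc_hden_ratio s b z : 0 <= s -> 0 < b -> D z ->
  nc (hden p b z / hden p (b + s) z - 1) <= s / b.
Proof.
move=> s0 b0 Dz; have dbs := hden_neq0 p1 (addr_ge0 (ltW b0) s0) Dz.
have v0 := Re_hv_gt0 p1 Dz.
have -> : hden p b z / hden p (b + s) z - 1 = - (s%:C * hv p z / hden p (b + s) z).
  apply: (mulIf dbs); rewrite mulrBl divfK// mulNr divfK// mul1r /hden rcD.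
  ring.
rewrite ncN ncM ncV ncM ncR ger0_norm//.
have d0 : 0 < nc (hden p (b + s) z) by rewrite nc_gt0.
rewrite ler_pdivrMr// mulrAC ler_pdivlMr// -mulrA ler_wpM2l// mulrC.
rewrite -(@ler_pXn2r _ 2) ?nnegrE ?mulr_ge0 ?nc_ge0 ?(ltW b0)//.
rewrite exprMn !sqr_normcE /hden.
move: v0; case: (hv p z) => x y /= x0.
rewrite !mul0r !subr0 !addr0 !add0r.
have : 0 <= (b + s) * x by rewrite mulr_ge0 ?addr_ge0 ?(ltW b0) ?(ltW x0).
have : b ^+ 2 * (x ^+ 2 + y ^+ 2) <= (b + s) ^+ 2 * (x ^+ 2 + y ^+ 2).
  by rewrite ler_wpM2r ?addr_ge0 ?sqr_ge0// lerXn2r ?nnegrE ?addr_ge0 ?(ltW b0)// lerDl.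
nra.
Qed.

Lemma hT_hvec s (s0 : 0 <= s) b (b0 : 0 <= b) : 0 < b -> s <= b ->
  sqnorm dotD (hT p1 s0 (hvec b0) - (expR (- (tau * s)))%:C *: hvec b0) <=
  (3 * (s / b)) ^+ 2 * sqnorm dotD (hvec b0).
Proof.
move=> bp sb; rewrite !bergman_sqnormE; have mD := measurable_plane oD.
have ib := bergman_sqr_integrable (hvec b0).
rewrite -aintZ//; apply: aint_le => //; [exact: bergman_sqr_integrable|exact: aintegrableZ|].
move=> w Dw; rewrite -exprMn; apply: lerXn2r; rewrite ?nnegrE ?mulr_ge0 ?nc_ge0 ?invr_ge0 ?(ltW bp)//.
set z := plane w; have Dz : D z := Dw.
have -> : (hT p1 s0 (hvec b0) - (expR (- (tau * s)))%:C *: hvec b0) z =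
    (expR (- (tau * s)))%:C * (happrox b z * ((hden p b z / hden p (b + s) z) ^+ 2 - 1)).
  rewrite -[LHS]/(hT p1 s0 (hvec b0) z - (expR (- (tau * s)))%:C * hvec b0 z) hT_E//.
  rewrite /hop !hvecE//; last exact: (hdisc_sub p1 s0 (hmap_in p1 s0 Dz)).
  rewrite -/(hop p s (happrox b) z) hop_happrox//; ring.
rewrite ncM ncR ger0_norm ?expR_ge0// ncM hvecE//.
have e1 : expR (- (tau * s)) <= 1 by rewrite -expR0 ler_expR oppr_le0 mulr_ge0.
apply: le_trans (ler_piMl _ e1) _; first by rewrite mulr_ge0 ?nc_ge0.
rewrite mulrC ler_wpM2r ?nc_ge0//.
have := nc_hden_ratio s0 bp Dz; move: (_ / hden p (b + s) z) => q h.
have sb1 : s / b <= 1 by rewrite ler_pdivrMr// mul1r.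
(* The constant 3 bounds [q + 1], because [nc (q - 1) <= s / b <= 1]. *)
rewrite (_ : q ^+ 2 - 1 = (q - 1) * ((q - 1) + (1 + 1))); last by ring.
rewrite ncM [leRHS]mulrC; apply: ler_pM; rewrite ?nc_ge0//.
have : nc (1 + 1 : Cplx R) <= 1 + 1 by apply: le_trans (ncD _ _) _; rewrite nc1.
by move=> ?; apply: le_trans (ncD _ _) _; lra.
Qed.

End approximate_eigenvectors.

(** * The two spectra *)

Section spectra.
Context {R : realType} (oD : open (cdisc (0 : Cplx R) 1)) (p : Cplx R) (p1 : nc p = 1).
Local Notation D := (cdisc (0 : Cplx R) 1).
Local Notation dotD := (@bergman_dot R D oD).
Context (U : set (Cplx R)) (oU : open U) (UD : U `<=` D).
Local Notation dotU := (@bergman_dot R U oU).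
Local Notation T := (restriction_gram oD oU UD).
Implicit Types (s b tau : R) (f : bergmanType oD).

(** One vector serves all parameters [t <= s] at once: for a strip, two operators must have a common
    approximate eigenvector. *)
Lemma hT_approx tau (tau0 : 0 <= tau) (s e : R) : 0 <= s -> 0 < e ->
  exists2 f : bergmanType oD, 0 < sqnorm dotD f &
    forall t (t0 : 0 <= t), t <= s ->
      sqnorm dotD (hT p1 t0 f - (expR (- (tau * t)))%:C *: f) <= e * sqnorm dotD f.
Proof.
(* Then x = [t / b] is at most 1 and [9 * x <= e], so that [(3 * x) ^+ 2 <= e]. *)
move=> s0 e0; pose b := (s + 1) * (1 + 9 / e).
have s1 : 0 < s + 1 by rewrite ltr_wpDl.
have c1 : 1 <= 1 + 9 / e by rewrite lerDl divr_ge0// ltW.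
have c0 : 0 < 1 + 9 / e by exact: lt_le_trans c1.
have bp : 0 < b by rewrite mulr_gt0.
have sb : s + 1 <= b by rewrite ler_peMr// ltW.
exists (hvec oD p1 tau0 (ltW bp)) => [|t t0 ts]; first exact: hvec_gt0.
apply: le_trans (hT_hvec oD p1 tau0 t0 (ltW bp) bp _) _; first by lra.
rewrite ler_wpM2r ?sqnorm_ge0//.
have h0 : 0 <= t / b by rewrite divr_ge0// ltW.
have h1 : t / b <= (1 + 9 / e)^-1.
  rewrite ler_pdivrMr// /b mulrCA mulVf ?mulr1 ?gt_eqF//; lra.
have h2 : (1 + 9 / e)^-1 <= 1 by rewrite invf_le1.
have h3 : 9 * (1 + 9 / e)^-1 <= e.
  rewrite ler_pdivrMr// mulrDr mulr1 mulrCA divff ?gt_eqF// mulr1.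
  lra.
by move: h0 h1 h2 h3; move: (t / b) (_^-1) => x y *; nra.
Qed.

Lemma gram_hT s (s0 : 0 <= s) f : U = hdisc p s -> T f = hT p1 s0 f.
Proof.
move=> UE; apply: bergmanP => z Dz; apply: (mulfI (@areaC_neq0 R)).
by rewrite gram_integral// (gram_integral _ (hdisc_sub p1 s0))// UE.
Qed.

Lemma spectrum_gram_subset (M : R) :
  (forall f, sqnorm dotU (restriction oU UD f) <= M * sqnorm dotD f) ->
  spectrum T `<=` real_complex R @` `[0, M].
Proof.
move=> TM; apply: (@spectrum_subset R _ oD T (fun f => sqnorm dotU (restriction oU UD f)) M).
- exact: bergman_complete.
- by move=> a f g; exact: gram_linear.
- exact: sqnorm_gram_le.
- exact: gram_form.
- by move=> f; rewrite sqnorm_ge0 TM.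
Qed.

Lemma spectrum_horodisc s : 0 < s -> U = hdisc p s ->
  spectrum T = real_complex R @` `[0, 1].
Proof.
move=> s0 UE; apply/seteqP; split.
  by apply: spectrum_gram_subset => f; rewrite mul1r; exact: sqnorm_restrict_le.
move=> _ [l /= ll <-]; move: ll; rewrite in_itv/= => /andP[l0 l1].
have app (m e : R) : 0 < m -> m <= 1 -> 0 < e -> exists2 f, 0 < sqnorm dotD f &
    sqnorm dotD (T f - m%:C *: f) <= e * sqnorm dotD f.
  move=> m0 m1 e0; have tau0 : 0 <= - ln m / s by rewrite divr_ge0 ?(ltW s0)// oppr_ge0 ln_le0.
  have [f f0 H] := hT_approx tau0 (ltW s0) e0; exists f => //.
  have E : T f = hT p1 (ltW s0) f := gram_hT (ltW s0) f UE.
  have mE : expR (- (- ln m / s * s)) = m by rewrite divfK ?gt_eqF// opprK lnK.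
  by have := H s (ltW s0) (lexx s); rewrite mE E.
apply: spectrum_approx => e e0.
(* The value 0 is not of the form exp(-tau s), only a limit of such values: an approximate
   eigenvector for a small positive [m] serves for 0. *)
move: l0; rewrite le_eqVlt => /predU1P[<-|l0]; last exact: app.
pose m := Num.min 1 (e / 4).
have m0 : 0 < m by rewrite lt_min ltr01 divr_gt0.
have m1 : m <= 1 by rewrite ge_min lexx.
have m4 : m <= e / 4 by rewrite ge_min lexx orbT.
have e4 : 0 < e / 4 by rewrite divr_gt0.
have [f f0 H] := app _ _ m0 m1 e4; exists f => //.
rewrite scale0r subr0 -[T f](subrK (m%:C *: f)).
apply: le_trans (sqnormD_le dotD _ _) _; rewrite sqnormZ ncR.
have : `|m| ^+ 2 * sqnorm dotD f <= e / 4 * sqnorm dotD f.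
  by rewrite ler_pM2r// (ger0_norm (ltW m0)); nra.
lra.
Qed.

Lemma spectrum_horostrip s1 s2 al : al = s1 / s2 -> 0 < s2 -> s2 < s1 ->
  U = hdisc p s2 `\` closed_cdisc (hcen p s1) (hrad s1) ->
  spectrum T = real_complex R @`
    `[0, al `^ (- (1 / (al - 1))) - al `^ (- (al / (al - 1)))].
Proof.
move=> alE s20 s21 UE; have s10 := lt_trans s20 s21.
have TE f : T f = hT p1 (ltW s20) f - hT p1 (ltW s10) f.
  rewrite (strip_gram p1 (ltW s20) s21 oU UD UE f); congr (_ - _).
  by apply: bergmanP => z Dz; rewrite !hT_E.
apply/seteqP; split.
  apply: spectrum_gram_subset => f.
  have -> : sqnorm dotU (restriction oU UD f) = hphi p f s2 - hphi p f s1.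
    apply: (@complexI R); rewrite -gram_form TE rcB -(hphi_form p1 f (ltW s20)) -(hphi_form p1 f (ltW s10)).
    by rewrite addrC -scaleN1r bergman_dot_linear mulN1r addrC.
  rewrite -(hphi0 p1); apply: (log_midconvex_gap alE) => //.
    by move=> s s0; rewrite hphi_ge0 hphi_le.
  by move=> s t; exact: hphi_mid.
have [P1 P2] := powR_gap alE s20 s21; rewrite P1 P2.
set mu := ln al / (s1 - s2).
have al1 : 1 < al by rewrite alE ltr_pdivlMr// mul1r.
have mu0 : 0 <= mu by rewrite divr_ge0 ?subr_ge0 ?(ltW s21)// ln_ge0// ltW.
move=> _ [l /= ll <-]; move: ll; rewrite in_itv/= => /andP[l0 l1].
pose m t := expR (- (t * s2)) - expR (- (t * s1)).
(* [m] is continuous, vanishes at 0 and equals the upper end of the interval at [mu], so every [l]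
   of the interval is one of its values. *)
have [t /andP[t0 _] <-] : exists2 t, 0 <= t <= mu & m t = l.
  have m0 : m 0 = 0 by rewrite /m !mul0r !oppr0 subrr.
  have lm : l <= m mu by [].
  have cE (s : R) : continuous (fun t : R => expR (- (t * s))).
    move=> t; apply: continuous_comp; last exact: continuous_expR.
    by apply: continuousN; apply: continuousM; [exact: cvg_id|exact: cvg_cst].
  have cm : {within `[0, mu], continuous m}.
    by apply: continuous_subspaceT => t; exact: (continuousB (cE s2 t) (cE s1 t)).
  have [|t] := @IVT R m 0 mu l mu0 cm.
    by rewrite ge_min le_max m0 l0 lm orbT.
  by rewrite in_itv/= => tI <-; exists t.
apply: spectrum_approx => e e0; have e4 : 0 < e / 4 by rewrite divr_gt0.
have [f f0 H] := hT_approx t0 (ltW s10) e4; exists f => //.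
have a1 := H _ (ltW s10) (lexx _); have a2 := H _ (ltW s20) (ltW s21).
have -> : T f - (m t)%:C *: f = (hT p1 (ltW s20) f - (expR (- (t * s2)))%:C *: f) -
    (hT p1 (ltW s10) f - (expR (- (t * s1)))%:C *: f).
  by rewrite TE /m rcB scalerBl ![- (_ - _)]opprD !opprK addrACA.
apply: le_trans (sqnormD_le dotD _ _) _; rewrite sqnormN; move: a1 a2.
by move: (sqnorm _ _) (sqnorm _ _) (sqnorm _ _) => x y u *; lra.
Qed.

End spectra.

Theorem theorem3 (R : realType) (U : set (Cplx R)) (oU : open U)
    (UD : U `<=` disc) :
  (is_horodisc U ->
    spectrum (restriction_gram disc_open oU UD) =
    real_complex R @` `[0, 1]) /\
  (forall r1 r2 : R, 0 < r1 -> r1 < r2 -> r2 < 1 -> is_horostrip r1 r2 U ->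
    let alpha := (r1^-1 - 1) / (r2^-1 - 1) in
    spectrum (restriction_gram disc_open oU UD) =
    real_complex R @`
      `[0, alpha `^ (- (1 / (alpha - 1))) - alpha `^ (- (alpha / (alpha - 1)))]).
Proof.
have lt_nc (z : Cplx R) (x : R) : (`|z| < x%:C) = (nc z < x) by rewrite normE ltcR.
have gt_nc (z : Cplx R) (x : R) : (x%:C < `|z|) = (x < nc z) by rewrite normE ltcR.
have DE : disc = cdisc (0 : Cplx R) 1.
  by apply/seteqP; split=> z; rewrite /disc /cdisc /= subr0 -(lt_nc z 1).
(* The Bergman space depends on the set and on the proof that it is open. Stating the results for a
   variable [W] equal to [cdisc 0 1] lets the equality with [disc] be substituted everywhere. *)
have horodisc W (oW : open W) (UW : U `<=` W) p s : W = cdisc 0 1 -> nc p = 1 -> 0 < s ->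
    U = hdisc p s -> spectrum (restriction_gram oW oU UW) = real_complex R @` `[0, 1].
  by move=> WE p1 s0 UE; subst W; exact: (@spectrum_horodisc R oW p p1 U oU UW s s0 UE).
have horostrip W (oW : open W) (UW : U `<=` W) p s1 s2 al : W = cdisc 0 1 -> nc p = 1 ->
    al = s1 / s2 -> 0 < s2 -> s2 < s1 ->
    U = hdisc p s2 `\` closed_cdisc (hcen p s1) (hrad s1) ->
    spectrum (restriction_gram oW oU UW) = real_complex R @`
      `[0, al `^ (- (1 / (al - 1))) - al `^ (- (al / (al - 1)))].
  by move=> WE p1 alE s20 s21 UE; subst W; exact: (@spectrum_horostrip R oW p p1 U oU UW s1 s2 al alE s20 s21 UE).
(* A radius [r] has parameter [r^-1 - 1], which is how [alpha] becomes a quotient of parameters. *)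
have hradK (r : R) : hrad (r^-1 - 1) = r by rewrite /hrad addrC subrK invrK.
split.
  move=> [c [/andP[c0 c1] UE]].
  have n0 : 0 < nc c by rewrite -(gt_nc c 0).
  have n1 : nc c < 1 by rewrite -(lt_nc c 1).
  have nC : (nc c)%:C != 0 :> Cplx R by rewrite -nc_eq0 ncR normr_eq0 gt_eqF.
  have r0 : 0 < 1 - nc c by rewrite subr_gt0.
  apply: (horodisc _ _ _ (c / (nc c)%:C) ((1 - nc c)^-1 - 1) DE).
  - by rewrite ncM ncV ncR gtr0_norm// divff// gt_eqF.
  - by rewrite subr_gt0 invf_gt1// gtrBl.
  have E : hcen (c / (nc c)%:C) ((1 - nc c)^-1 - 1) = c.
    by rewrite /hcen hradK subKr mulrC divfK.
  by rewrite UE /hdisc E hradK; apply/seteqP; split=> z /=; rewrite (normE c) -(rcB 1) lt_nc.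
move=> r1 r2 r10 r12 r21 [p [np UE]] alpha.
have p1 : nc p = 1 by apply: (@complexI R); rewrite -normE.
have r20 := lt_trans r10 r12.
apply: (horostrip _ _ _ p (r1^-1 - 1) (r2^-1 - 1) _ DE) => //.
- by rewrite subr_gt0 invf_gt1.
- by rewrite ltrD2r ltf_pV2.
rewrite UE /hdisc /hcen !hradK; apply/seteqP; split=> z /=; rewrite lt_nc gt_nc !rcB.
  by move=> [h1 h2]; split=> //; apply/negP; rewrite -ltNge.
by move=> [h1 /negP]; rewrite -ltNge.
Qed.
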